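(* Let $1<p<\infty$ and let $\mathcal{J}_h$ and $\mathcal{J}_h^{BO}$ be the discrete energy functionals $$\mathcal{J}_h(v)=\int_\Omega f(\nabla_hv,v,x)\,dx+\sum_{e\in\mathcal{E}_h^I}\int_e\gamma_eh_e^{1-p}\bigl|[v]\bigr|^p\,dS+\sum_{e\in\mathcal{E}_h^B}\int_e\gamma_eh_e^{1-p}|v-g|^p\,dS,$$ $$\mathcal{J}_h^{BO}(v)=\sum_{T\in\mathcal{T}_h}\int_T f(\nabla v+R(v),v,x)\,dx+\sum_{e\in\mathcal{E}_h^I}\int_e\gamma_eh_e^{1-p}\bigl|[v]\bigr|^p\,dS+\sum_{e\in\mathcal{E}_h^B}\int_e\gamma_eh_e^{1-p}|v-g|^p\,dS,$$ where $\nabla_h$ is the DG-FE central numerical gradient, $\nabla v$ in the second formula is the piecewise gradient, and $R$ is the lifting operator. Then for any $v_h\in V_h$ we have $\mathcal{J}_h(v_h)=\mathcal{J}_h^{BO}(v_h)$.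
   Context: **Domain, mesh, DG space.** $\Omega\subset\mathbb{R}^d$ ($d\in\{1,2,3\}$) is a bounded polygonal domain and $\mathcal{T}_h$ is a quasi-uniform and shape regular mesh of $\Omega$. $\mathcal{E}_h^I$ and $\mathcal{E}_h^B$ are the sets of interior and boundary edges/faces of $\mathcal{T}_h$, $\mathcal{E}_h=\mathcal{E}_h^I\cup\mathcal{E}_h^B$, $h_e$ is the size of $e$, and for each $e\in\mathcal{E}_h$ the penalty parameter $\gamma_e>0$ is a constant on $e$. $W^{1,p}(\mathcal{T}_h)=\prod_{T\in\mathcal{T}_h}W^{1,p}(T)$, and for a polynomial degree $k\ge0$, $V_h=\{v_h\in L^2(\Omega): v_h|_T\in\mathbb{P}_k(T)\ \forall T\in\mathcal{T}_h\}$, $\mathbb{P}_k(T)$ being the polynomials of degree $\le k$ on $T$. **Jumps and averages.** On $e=\partial T^+\cap\partial T^-\in\mathcal{E}_h^I$: $[v]=v^+-v^-$, $\{v\}=\tfrac12(v^++v^-)$, with $v^\pm=v|_{T^\pm}$, where $T^-$ is the element with the smaller global index and $\nu_e$ is the unit normal to $e$ pointing from $T^+$ to $T^-$. On $e\in\mathcal{E}_h^B$: $[v]=\{v\}=v$ and $\nu_e$ is the outward unit normal to $\partial\Omega$. **DG-FE (central) numerical gradient.** For $v\in W^{1,p}(\mathcal{T}_h)$, $\nabla_hv=(\partial_{h,x_1}v,\dots,\partial_{h,x_d}v)\in[V_h]^d$ is defined by $$\int_\Omega \partial_{h,x_i}(v)\,\varphi_h\,dx=\sum_{e\in\mathcal{E}_h}\int_e\{v\}\,\nu_e^i\,[\varphi_h]\,dS-\sum_{T\in\mathcal{T}_h}\int_T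 v\,\partial_{x_i}\varphi_h\,dx\qquad\forall\varphi_h\in V_h,$$ where $\nu_e^i$ is the $i$-th component of $\nu_e$. **Lifting operator.** $R:W^{1,p}(\mathcal{T}_h)\to[V_h]^d$ is defined by $$\int_\Omega R(v)\cdot\varphi_h\,dx=-\sum_{e\in\mathcal{E}_h^I}\int_e[v]\{\varphi_h\cdot\nu_e\}\,dS\qquad\forall\varphi_h\in[V_h]^d.$$ **Data.** $g$ is the given Dirichlet boundary data. The density $f:\mathbb{R}^d\times\mathbb{R}\times\Omega\to\mathbb{R}_+$ satisfies: (1) $f$ is Carathéodory (measurable in $x$ for every $(\xi,v)$, continuous in $(\xi,v)$ for every $x\in\Omega$); (2) $\xi\mapsto f(\xi,v,x)$ is convex for every $(v,x)$; (3) there are $\alpha_0,\alpha_1>0$, $a_0,a_1\in L^1(\Omega)$, and $r,q$ with $r<p$, $r\le q<p^*$ such that $\alpha_0(|\xi|^p-|v|^r+a_0(x))\le f(\xi,v,x)\le\alpha_1(|\xi|^p+|v|^q+a_1(x))$, where $p^*=\frac{dp}{d-p}$ if $p<d$ and $p^*=\infty$ if $p\ge d$. *)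

(* Defs.v *)
From HB Require Import structures.
From mathcomp Require Import all_boot all_order all_algebra.
From mathcomp Require Import all_classical all_reals all_analysis.
Set Implicit Arguments. Unset Strict Implicit. Unset Printing Implicit Defensive.
Import Order.TTheory GRing.Theory Num.Theory numFieldNormedType.Exports.
Local Open Scope classical_set_scope.
Local Open Scope ring_scope.

(* Borel sets and Lebesgue measure on R^n, the latter obtained by iterating the
   product with the one-dimensional Lebesgue measure and then completing, so
   that [measurable_fun] below means Lebesgue measurability. *)
Section EuclideanMeasure.
Context {R : realType}.

Definition coords n (i : 'I_n) (x : 'rV[R]_n) : measurableTypeR R := x 0 i.

Definition rV_display : measure_display.
Proof. exact: default_measure_display. Qed.

Let rV_set0 n : g_sigma_preimage (@coords n) set0.
Proof. exact: sigma_algebra0. Qed.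
Let rV_setC n A : g_sigma_preimage (@coords n) A -> g_sigma_preimage (@coords n) (~` A).
Proof. exact: sigma_algebraC. Qed.
Let rV_bigcup n (F : _^nat) : (forall i, g_sigma_preimage (@coords n) (F i)) ->
  g_sigma_preimage (@coords n) (\bigcup_i (F i)).
Proof. exact: sigma_algebra_bigcup. Qed.

HB.instance Definition _ n := @isMeasurable.Build rV_display
  'rV[R]_n (g_sigma_preimage (@coords n)) (@rV_set0 n) (@rV_setC n) (@rV_bigcup n).

Lemma measurable_coord n (i : 'I_n) :
  measurable_fun [set: 'rV[R]_n] (coords i).
Proof.
move=> _ Y mY; rewrite setTI; apply: sub_sigma_algebra => /=.
rewrite -bigcup_seq/=; exists i => /=; first by rewrite mem_index_enum.
by exists Y => //; rewrite setTI.
Qed.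

Lemma measurable_fun_rV d (T : measurableType d) n (f : T -> 'rV[R]_n) :
  (forall i, measurable_fun [set: T] (coords i \o f)) ->
  measurable_fun [set: T] f.
Proof.
move=> mf; apply: (@measurability _ _ _ _ _ _
  (\big[setU/set0]_(i < n) preimage_set_system setT (@coords n i) measurable)) => //.
move=> _ [A + <-]; rewrite -bigcup_seq => -[i _ [B mB <-]].
by rewrite setTI; exact: mf.
Qed.

Definition cons_rV n (x : measurableTypeR R * 'rV[R]_n) : 'rV[R]_n.+1 :=
  row_mx (const_mx x.1 : 'rV[R]_1) x.2.

Definition uncons_rV n (x : 'rV[R]_n.+1) : measurableTypeR R * 'rV[R]_n :=
  (x 0 0, rsubmx (x : 'rV[R]_(1 + n))).

Lemma measurable_cons_rV n : measurable_fun setT (@cons_rV n).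
Proof.
apply: measurable_fun_rV => i.
rewrite (_ : _ \o _ = fun x : measurableTypeR R * 'rV[R]_n =>
    match fintype.split (i : 'I_(1 + n)) with inl _ => x.1 | inr j => coords j x.2 end); last first.
  by apply/funext => x /=; rewrite /coords mxE; case: fintype.split => // j; rewrite mxE.
case: fintype.split => j; first exact: measurable_fst.
exact: (measurableT_comp (measurable_coord j) measurable_snd).
Qed.

Lemma measurable_uncons_rV n : measurable_fun setT (@uncons_rV n).
Proof.
apply/measurable_fun_pairP; split => /=; first exact: (measurable_coord ord0).
apply: measurable_fun_rV => i.
rewrite (_ : _ \o _ = @coords n.+1 (rshift 1 i)).
  exact: measurable_coord.
by apply/funext => x; rewrite /coords /= mxE.
Qed.

Lemma cons_rVK n : cancel (@cons_rV n) (@uncons_rV n).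
Proof.
move=> [t x]; rewrite /uncons_rV /cons_rV; congr (_, _); last first.
  by rewrite [LHS]row_mxKr.
by rewrite mxE; case: fintype.splitP => // j _; rewrite mxE.
Qed.

Lemma uncons_rVK n : cancel (@uncons_rV n) (@cons_rV n).
Proof.
move=> x; rewrite /uncons_rV /cons_rV /=.
rewrite (_ : const_mx _ = @lsubmx _ 1 1 n x); first exact: (@hsubmxK _ 1 1 n).
by apply/matrixP => i j; rewrite !mxE !ord1; congr (x _ _); exact: val_inj.
Qed.

Section step.
Variables (n : nat) (m : {sigma_finite_measure set 'rV[R]_n -> \bar R}).

Definition leb_step : set 'rV[R]_n.+1 -> \bar R :=
  pushforward (@lebesgue_measure R \x m)%E (@cons_rV n).


Let leb_step0 : leb_step set0 = 0%E.
Proof. by rewrite /leb_step /pushforward preimage_set0 measure0. Qed.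

Let leb_step_ge0 A : (0 <= leb_step A)%E.
Proof. by rewrite /leb_step /pushforward; exact: measure_ge0. Qed.

Let leb_step_sigma_additive : semi_sigma_additive leb_step.
Proof.
have mT A : measurable A -> measurable (@cons_rV n @^-1` A).
  by rewrite -[_ @^-1` _]setTI; exact: measurable_cons_rV.
move=> F mF tF mUF; rewrite /leb_step /pushforward preimage_bigcup.
apply: measure_semi_sigma_additive.
- by move=> k; exact: mT.
- apply/trivIsetP => /= i j _ _ ij; rewrite -preimage_setI.
  by move/trivIsetP : tF => /(_ _ _ _ _ ij) ->//; rewrite preimage_set0.
- by rewrite -preimage_bigcup; exact: mT.
Qed.

HB.instance Definition _ := isMeasure.Build _ _ _ leb_step
  leb_step0 leb_step_ge0 leb_step_sigma_additive.

Let leb_step_sigma_finite : sigma_finite setT leb_step.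
Proof.
have /sigma_finiteP[F [TF ndF Foo]] := sigma_finiteT (@lebesgue_measure R).
have /sigma_finiteP[G [TG ndG Goo]] := sigma_finiteT m.
exists (fun k => @uncons_rV n @^-1` (F k `*` G k)).
  rewrite -preimage_bigcup (_ : \bigcup_k _ = setT) ?preimage_setT// -subTset.
  move=> [x y] _; have [k _ Fx] : (\bigcup_k F k) x by rewrite -TF.
  have [l _ Gy] : (\bigcup_k G k) y by rewrite -TG.
  exists (maxn k l) => //; split.
  - by move: x Fx; exact/subsetPset/ndF/leq_maxl.
  - by move: y Gy; exact/subsetPset/ndG/leq_maxr.
move=> k; have [mF Fk] := Foo k; have [mG Gk] := Goo k; split.
  by rewrite -[_ @^-1` _]setTI; apply: measurable_uncons_rV => //; exact: measurableX.
rewrite /leb_step /pushforward -comp_preimage (_ : _ \o _ = id) ?preimage_id.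
  by rewrite product_measure1E// lte_mul_pinfty// ge0_fin_numE.
by apply/funext => x /=; rewrite cons_rVK.
Qed.

HB.instance Definition _ := Measure_isSigmaFinite.Build _ _ _ leb_step
  leb_step_sigma_finite.

End step.

Fixpoint borel_leb n : {sigma_finite_measure set 'rV[R]_n -> \bar R} :=
  match n with
  | 0%N => dirac (0 : 'rV[R]_0)
  | n'.+1 => leb_step (borel_leb n')
  end.

Definition lebT n : measurableType _ :=
  caratheodory_type (mu_ext (borel_leb n)).

Definition leb n : {measure set (lebT n) -> \bar R} :=
  @completed_measure_extension _ _ _ (borel_leb n).

End EuclideanMeasure.
Arguments leb {R} n.
Arguments lebT R n : clear implicits.

Section Geometry.
Context {R : realType} {d : nat}.
Local Notation E := 'rV[R]_d.

Definition dot (x y : E) : R := \sum_i x 0 i * y 0 i.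
Definition enorm (x : E) : R := Num.sqrt (dot x x).
Definition diam (A : set E) : R :=
  sup [set enorm (z.1 - z.2) | z in A `*` A].
Definition frontier (A : set E) : set E := closure A `\` A°.
Definition hyperplane (nu : E) (c : R) : set E := [set x | dot nu x = c].

(* A is (d-1)-dimensional in the hyperplane: nonempty relative interior *)
Definition fat_in (nu : E) (c : R) (A : set E) : Prop :=
  exists x r, [/\ hyperplane nu c x, 0 < r &
    forall y, hyperplane nu c y -> enorm (y - x) < r -> A y].

(* convex polytopes, presented by their facets: one outward unit normal and
   one offset for each facet, without redundancy (see [proper_polytope]) *)
Record polytope := Polytope {
  nfacets : nat;
  normal : 'I_nfacets -> E;
  offset : 'I_nfacets -> R }.

Definition body (P : polytope) : set E :=
  [set x | forall l : 'I_(nfacets P), dot (normal l) x <= offset l].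

Definition cell (P : polytope) : set E := (body P)°.

Definition facet (P : polytope) (l : 'I_(nfacets P)) : set E :=
  body P `&` hyperplane (normal l) (offset l).

Definition proper_polytope (P : polytope) : Prop :=
  [/\ bounded_set (body P),
      cell P !=set0,
      forall l : 'I_(nfacets P), enorm (normal l) = 1,
      injective (@normal P) &
      forall l : 'I_(nfacets P), fat_in (normal l) (offset l) (facet l)].

(* Being the interior of a finite union of closed polytopes rules out cracks:
   Omega is the interior of its closure. *)
Definition polygonal_domain (Omega : set E) : Prop :=
  [/\ open Omega, connected Omega, Omega !=set0, bounded_set Omega &
      exists n (P : 'I_n -> polytope), (forall i, proper_polytope (P i)) /\
        Omega = (\bigcup_i body (P i))°].

(* Surface integral over a subset A of the hyperplane nu . x = c, |nu| = 1: the
   hyperplane is the graph of the j-th coordinate over the other ones, for any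
   j with nu_j <> 0, and dS = |nu_j|^-1 dy.  For d = 1 this is the evaluation
   at the point c * nu. *)
Definition chart (nu : E) (c : R) (j : 'I_d) (y : 'rV[R]_d.-1) : E :=
  \row_i if unlift j i is Some l then y 0 l
         else (c - \sum_l nu 0 (lift j l) * y 0 l) / nu 0 j.

Definition surface_integral (nu : E) (c : R) (A : set E) (F : E -> \bar R) :
    \bar R :=
  if [pick j | nu 0 j != 0] is Some j then
    ((`|nu 0 j|^-1)%:E *
     \int[leb d.-1]_(y in chart nu c j @^-1` A) F (chart nu c j y))%E
  else 0%E.

End Geometry.
Arguments polytope : clear implicits.

Section Mesh.
Context {R : realType} {d : nat}.
Local Notation E := 'rV[R]_d.

(* the order of the indices of the elements is the global numbering *)
Record mesh := Mesh { nelem : nat; elem : 'I_nelem -> polytope R d }.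

(* no conformity condition: hanging nodes are allowed *)
Definition mesh_of (Omega : set E) (M : mesh) : Prop :=
  [/\ forall i : 'I_(nelem M), proper_polytope (elem i),
      closure Omega = \bigcup_(i : 'I_(nelem M)) body (elem i) &
      forall i j : 'I_(nelem M), i != j ->
        cell (elem i) `&` cell (elem j) = set0].

Definition shape_regular (kappa : R) (M : mesh) : Prop :=
  0 < kappa /\ forall i : 'I_(nelem M), exists x,
    [set y | enorm (y - x) <= diam (body (elem i)) / kappa] `<=` body (elem i).

Definition quasi_uniform (sigma : R) (M : mesh) : Prop :=
  0 < sigma /\ forall i j : 'I_(nelem M),
    diam (body (elem i)) <= sigma * diam (body (elem j)).

Context {M : mesh}.

(* (j, (l, Some i)) stands for the face shared by T^+ = T_j and T^- = T_i, lying
   in the hyperplane of the l-th facet of T_j; (j, (l, None)) for the part of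
   the l-th facet of T_j that lies on the boundary of Omega.  The predicates
   [interior_face] and [boundary_face] select the codes of actual faces. *)
Definition face : finType :=
  {j : 'I_(nelem M) & ('I_(nfacets (elem j)) * option 'I_(nelem M))%type}.

Definition face_plus (e : face) : 'I_(nelem M) := tag e.
Definition face_minus (e : face) : option 'I_(nelem M) := (tagged e).2.
(* outward from T^+, hence pointing from T^+ to T^- *)
Definition face_normal (e : face) : E := normal (tagged e).1.
Definition face_offset (e : face) : R := offset (tagged e).1.

Variable Omega : set E.

Definition face_set (e : face) : set E :=
  if face_minus e is Some i
  then frontier (body (elem (face_plus e))) `&` frontier (body (elem i))
  else facet (tagged e).1 `&` frontier Omega.

Definition face_ok (e : face) : Prop :=
  face_set e `<=` hyperplane (face_normal e) (face_offset e) /\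
  fat_in (face_normal e) (face_offset e) (face_set e).

Definition interior_face (e : face) : bool :=
  (if face_minus e is Some i then (i < face_plus e)%N else false)
  && `[< face_ok e >].

Definition boundary_face (e : face) : bool :=
  (face_minus e == None) && `[< face_ok e >].

Definition face_integral (e : face) (F : E -> \bar R) : \bar R :=
  surface_integral (face_normal e) (face_offset e) (face_set e) F.

Definition face_Rintegral (e : face) (F : E -> R) : R :=
  fine (face_integral e (EFin \o F)).

(* A piecewise function is the family of its restrictions to the elements; its
   trace on the boundary of T_i is given by the values of the i-th function. *)
Definition pwfun (V : Type) := 'I_(nelem M) -> E -> V.

Definition jump (v : pwfun R) (e : face) (x : E) : R :=
  if face_minus e is Some i then v (face_plus e) x - v i x
  else v (face_plus e) x.

Definition avg (v : pwfun R) (e : face) (x : E) : R :=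
  if face_minus e is Some i then (v (face_plus e) x + v i x) / 2
  else v (face_plus e) x.

(* the function on Omega with pieces v, up to the null set where x lies in no cell *)
Definition glue (V : nmodType) (v : pwfun V) (x : E) : V :=
  \sum_(i | x \in cell (elem i)) v i x.

Definition component (w : pwfun E) (a : 'I_d) : pwfun R :=
  fun i x => w i x 0 a.

Definition poly_fun (k : nat) (q : E -> R) : Prop :=
  exists c : {ffun 'I_d -> 'I_k.+1} -> R, forall x,
    q x = \sum_(m : {ffun 'I_d -> 'I_k.+1} | (\sum_a m a <= k)%N)
            c m * \prod_a x 0 a ^+ m a.

(* each piece is the polynomial function on the whole of R^d extending the
   restriction to the element *)
Definition in_Vh (k : nat) (v : pwfun R) : Prop := forall i, poly_fun k (v i).

Definition in_Vh_vec (k : nat) (w : pwfun E) : Prop :=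
  forall a, in_Vh k (component w a).

Definition partial (a : 'I_d) (u : E -> R) (x : E) : R :=
  'D_(delta_mx 0 a) u x.

Definition gradient (u : E -> R) (x : E) : E := \row_a partial a u x.

Definition is_dg_gradient (k : nat) (v : pwfun R) (G : pwfun E) : Prop :=
  in_Vh_vec k G /\
  forall (a : 'I_d) (phi : pwfun R), in_Vh k phi ->
    \int[leb d]_(x in Omega) (glue (component G a) x * glue phi x) =
    \sum_(e | interior_face e || boundary_face e)
       face_Rintegral e (fun x => avg v e x * face_normal e 0 a * jump phi e x)
    - \sum_i \int[leb d]_(x in cell (elem i)) (v i x * partial a (phi i) x).

Definition dg_gradient (k : nat) (v : pwfun R) : pwfun E :=
  xget (fun _ _ => 0) [set G | is_dg_gradient k v G].

Definition is_lifting (k : nat) (v : pwfun R) (L : pwfun E) : Prop :=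
  in_Vh_vec k L /\
  forall phi : pwfun E, in_Vh_vec k phi ->
    \int[leb d]_(x in Omega) dot (glue L x) (glue phi x) =
    - \sum_(e | interior_face e)
        face_Rintegral e (fun x => jump v e x *
          avg (fun i y => dot (phi i y) (face_normal e)) e x).

Definition lifting (k : nat) (v : pwfun R) : pwfun E :=
  xget (fun _ _ => 0) [set L | is_lifting k v L].

Section Energy.
Variables (k : nat) (p : R) (f : E -> R -> E -> R) (g : E -> R).
Variables (gamma h : face -> R).
Local Open Scope ereal_scope.

Definition penalty (v : pwfun R) : \bar R :=
  \sum_(e | interior_face e)
    face_integral e (fun x =>
      (gamma e * h e `^ (1 - p) * `|jump v e x| `^ p)%R%:E)
  + \sum_(e | boundary_face e)
    face_integral e (fun x =>
      (gamma e * h e `^ (1 - p) * `|v (face_plus e) x - g x| `^ p)%R%:E).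

Definition J_h (v : pwfun R) : \bar R :=
  \int[leb d]_(x in Omega) (f (glue (dg_gradient k v) x) (glue v x) x)%:E
  + penalty v.

Definition J_BO (v : pwfun R) : \bar R :=
  \sum_i \int[leb d]_(x in cell (elem i))
    (f (gradient (v i) x + lifting k v i x)%R (v i x) x)%:E
  + penalty v.

End Energy.
End Mesh.
Arguments mesh : clear implicits.
Arguments face {R d} M.
Arguments pwfun {R d} M V.

Section Density.
Context {R : realType} {d : nat}.
Local Notation E := 'rV[R]_d.

Definition sobolev_exponent (p : R) : \bar R :=
  if p < d%:R then (d%:R * p / (d%:R - p))%:E else +oo%E.

Definition growth (p : R) (Omega : set E) (f : E -> R -> E -> R) : Prop :=
  exists (alpha0 alpha1 r q : R) (a0 a1 : E -> R),
    [/\ 0 < alpha0 /\ 0 < alpha1,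
        (leb d).-integrable Omega (EFin \o a0) /\
        (leb d).-integrable Omega (EFin \o a1),
        [/\ r < p, r <= q & (q%:E < sobolev_exponent p)%E] &
        forall xi v x, Omega x ->
          alpha0 * (enorm xi `^ p - `|v| `^ r + a0 x) <= f xi v x /\
          f xi v x <= alpha1 * (enorm xi `^ p + `|v| `^ q + a1 x)].

Record admissible_density (p : R) (Omega : set E) (f : E -> R -> E -> R) :
    Prop := AdmissibleDensity {
  density_ge0 : forall xi v x, Omega x -> 0 <= f xi v x;
  density_measurable : forall xi v,
    measurable_fun (Omega : set (lebT R d)) (f xi v : lebT R d -> R);
  density_continuous : forall x, Omega x ->
    continuous (fun z : E * R => f z.1 z.2 x);
  density_convex : forall v x, Omega x ->
    @convex_function R E setT (fun xi => f xi v x);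
  density_growth : growth p Omega f }.

End Density.

(* Main.v *)
(* On each cell the divergence theorem holds one coordinate at a time (Fubini
   and the fundamental theorem of calculus), because an integral over a
   hyperplane does not depend on the coordinate solved for.  Outside a null
   set, a point of a facet lies on no facet hyperplane other than the one it
   spans, so it belongs to exactly one further element, on the other side, or
   else to the boundary of Omega.  Summing over the cells therefore leaves the
   integrals of [v phi] over the faces; since [v phi] = [v]{phi} + {v}[phi] on
   interior faces, the piecewise gradient plus a lifting of v is a DG gradient
   of v.  A lifting exists by Riesz representation on each element, and a DG
   gradient is unique because a polynomial with zero L^2 norm on a cell
   vanishes.  Hence the two densities agree on the cells, which cover Omega up
   to a null set. *)
Require Import Defs.
From mathcomp Require Import all_boot all_order all_algebra.
From mathcomp Require Import all_classical all_reals all_analysis.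
From mathcomp Require Import measurable_realfun.
From mathcomp Require Import ring zify.
Set Implicit Arguments. Unset Strict Implicit. Unset Printing Implicit Defensive.
Import Order.TTheory GRing.Theory Num.Theory numFieldNormedType.Exports.
Local Open Scope classical_set_scope.
Local Open Scope ring_scope.

(** * Lebesgue measure in coordinates *)
Section LebesgueBorel.
Context {R : realType}.

(** Hanging nodes are allowed, so facets of neighbouring elements need not match, and the coded
    faces are described only through frontiers of sets. Instead of classifying faces geometrically,
    the proof works with all pairs of a facet [l] of T_j and an element [i]. On the hyperplane of
    [l], up to a null set of the chart, [face_set] is an explicit Borel set built from linear
    inequalities, and a pair that codes no face contributes zero. Exceptional points form finitely
    many hyperplanes of the chart space, so every null set that occurs is a null set of [borel_leb].
    Integrals are taken with the completed measure [leb], Fubini is applied to [borel_leb]; hence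
    the passages between the two. Discrete functions are polynomial on each element, thus bounded on
    bounded sets, which settles integrability. The energy density is split over the cells through
    its nonnegativity, by the definition of the integral as a supremum. [lifting] and [dg_gradient]
    are picked by [xget] with default zero, so their equations are available only after solutions
    have been constructed. *)

Lemma measurable_lebT n (A : set 'rV[R]_n) :
  measurable A -> measurable (A : set (lebT R n)).
Proof. by move=> mA; apply: caratheodory_measurable_mu_ext. Qed.

Lemma leb_borelE n (A : set 'rV[R]_n) :
  measurable A -> leb n A = borel_leb n A.
Proof. by move=> mA; rewrite [LHS](@measurable_mu_extE _ _ _ (borel_leb n)). Qed.

Lemma measurable_id_lebT n :
  measurable_fun setT (id : lebT R n -> 'rV[R]_n).
Proof. by move=> _ B mB; rewrite setTI; exact: measurable_lebT. Qed.

Lemma measurable_fun_lebT n d (T : measurableType d) (f : 'rV[R]_n -> T) :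
  measurable_fun setT f -> measurable_fun setT (f : lebT R n -> T).
Proof. by move=> mf; apply: (measurableT_comp mf); exact: measurable_id_lebT. Qed.

Lemma negligible_lebT n (N A : set 'rV[R]_n) : measurable N ->
  borel_leb n N = 0%E -> A `<=` N ->
  measurable (A : set (lebT R n)) /\ leb n A = 0%E.
Proof.
move=> mN N0 AN.
have nA : (leb n).-negligible (A : set (lebT R n)).
  exists N; split => //; first exact: measurable_lebT.
  by rewrite leb_borelE.
have mA : measurable (A : set (lebT R n)).
  exact: (@measure_is_complete_caratheodory _ _ (mu_ext (borel_leb n)) A nA).
by split => //; apply/eqP; rewrite -measure_le0 -N0 -leb_borelE// le_measure// inE//;
  exact: measurable_lebT.
Qed.

(** The identity from [lebT] to the Borel space is measurable and pushes [leb] forward to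
    [borel_leb]; the claim is the change of variables along it. *)
Lemma ge0_integral_leb n (D : set 'rV[R]_n) (f : 'rV[R]_n -> \bar R) :
  measurable D -> measurable_fun D f -> {in D, forall y, (0 <= f y)%E} ->
  (\int[leb n]_(x in D) f x = \int[borel_leb n]_(x in D) f x)%E.
Proof.
move=> mD mf f0.
rewrite -[LHS](ge0_integral_pushforward (@measurable_id_lebT n) (leb n) mD mf f0).
have E : forall A : set 'rV[R]_n, measurable A -> A `<=` D ->
    pushforward (leb n) (id : lebT R n -> 'rV[R]_n) A = borel_leb n A.
  by move=> A mA _; exact: (leb_borelE mA).
exact: (@eq_measure_integral _ _ R D (borel_leb n)
  (measure_function_pushforward__canonical__measure_function_Measure
     (leb n) (@measurable_id_lebT n)) f E).
Qed.

Lemma integral_leb n (D : set 'rV[R]_n) (f : 'rV[R]_n -> \bar R) :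
  measurable D -> measurable_fun D f ->
  (\int[leb n]_(x in D) f x = \int[borel_leb n]_(x in D) f x)%E.
Proof.
move=> mD mf; rewrite integralE [RHS]integralE; congr (_ - _)%E.
- by apply: ge0_integral_leb => //; exact: measurable_funepos.
- by apply: ge0_integral_leb => //; exact: measurable_funeneg.
Qed.

End LebesgueBorel.

(** * Integration along an arbitrary coordinate direction *)

Section CoordinateInsertion.
Context {R : realType}.
Local Arguments borel_leb : simpl never.

(** For fixed [y] this runs through a line parallel to the [i]-th axis. The case [ord0] is
    [cons_rV], from which [borel_leb] is built. *)
Definition ins n (i : 'I_n.+1) (t : R) (y : 'rV[R]_n) : 'rV[R]_n.+1 :=
  \row_k if unlift i k is Some l then y 0 l else t.

Lemma ins_at n (i : 'I_n.+1) t (y : 'rV[R]_n) : ins i t y 0 i = t.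
Proof. by rewrite mxE unlift_none. Qed.

Lemma ins_lift n (i : 'I_n.+1) t (y : 'rV[R]_n) l : ins i t y 0 (lift i l) = y 0 l.
Proof. by rewrite mxE liftK. Qed.

Lemma measurable_fun_ins d (T : measurableType d) n (i : 'I_n.+1)
    (f : T -> measurableTypeR R) (g : T -> 'rV[R]_n) :
  measurable_fun setT f -> measurable_fun setT g ->
  measurable_fun setT (fun z => ins i (f z) (g z)).
Proof.
move=> mf mg; apply: measurable_fun_rV => k; case: (unliftP i k) => [l|] ->.
  rewrite (_ : _ \o _ = coords l \o g); last first.
    by apply/funext => z; rewrite /coords/= ins_lift.
  exact: measurableT_comp (measurable_coord l) mg.
by rewrite (_ : _ \o _ = f)//; apply/funext => z; rewrite /coords/= ins_at.
Qed.

Lemma cons_rVE n t (y : 'rV[R]_n) : cons_rV (t, y) = ins ord0 t y.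
Proof.
apply/rowP => k; case: (unliftP ord0 k) => [l|] ->.
  rewrite ins_lift /cons_rV (_ : lift _ _ = rshift 1 l); last exact: val_inj.
  exact: (row_mxEr _ _ ord0 l).
rewrite ins_at /cons_rV (_ : ord0 = lshift n (ord0 : 'I_1)); last exact: val_inj.
by rewrite [LHS](row_mxEl _ _ ord0 ord0) mxE.
Qed.

Lemma ins_comm n (i : 'I_n.+1) s t (y : 'rV[R]_n) :
  ins ord0 s (ins i t y) = ins (lift ord0 i) t (ins ord0 s y).
Proof.
apply/rowP => k; case: (unliftP ord0 k) => [l|] ->; last first.
  rewrite ins_at (_ : ord0 = lift (lift ord0 i) ord0); last exact: val_inj.
  by rewrite ins_lift ins_at.
rewrite ins_lift; case: (unliftP i l) => [m|] ->; last by rewrite !ins_at.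
rewrite ins_lift (_ : lift ord0 (lift i m) = lift (lift ord0 i) (lift ord0 m)).
  by rewrite !ins_lift.
by apply: val_inj; rewrite /= /bump; lia.
Qed.

Lemma integral_borel_lebS n (F : 'rV[R]_n.+1 -> \bar R) :
  measurable_fun setT F -> (forall x, 0 <= F x)%E ->
  (\int[borel_leb n.+1]_x F x =
   \int[lebesgue_measure]_t \int[borel_leb n]_y F (ins ord0 t y))%E.
Proof.
move=> mF F0.
have mFc : measurable_fun setT (F \o @cons_rV R n).
  by apply: (measurableT_comp mF); exact: measurable_cons_rV.
have -> : (\int[borel_leb n.+1]_x F x =
    \int[lebesgue_measure \x borel_leb n]_z (F \o @cons_rV R n) z)%E.
  by rewrite -(ge0_integral_pushforward (@measurable_cons_rV R n) _ measurableT mF).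
rewrite (fubini_tonelli1 _ mFc); last by move=> z; exact: F0.
by apply: eq_integral => t _; apply: eq_integral => y _ /=; rewrite cons_rVE.
Qed.

Lemma insD n (i : 'I_n.+1) s t (y : 'rV[R]_n) :
  ins i (s + t) y = ins i s y + t *: delta_mx 0 i.
Proof.
apply/rowP => k; rewrite !mxE eqxx/=; case: (unliftP i k) => [l|] ->.
  by rewrite eq_sym (negbTE (neq_lift _ _)) mulr0 addr0.
by rewrite eqxx mulr1.
Qed.

(** The construction of [borel_leb] singles out coordinate 0. By induction on the dimension,
    coordinate 0 is split off, the induction hypothesis splits off the wanted one from the rest,
    Tonelli in the plane exchanges the two, and [ins_comm] puts coordinate 0 back. *)
Lemma tonelli_ins n (i : 'I_n.+1) (F : 'rV[R]_n.+1 -> \bar R) :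
  measurable_fun setT F -> (forall x, 0 <= F x)%E ->
  (\int[borel_leb n.+1]_x F x =
   \int[lebesgue_measure]_t \int[borel_leb n]_y F (ins i t y))%E.
Proof.
elim: n i F => [|n IH] i F mF F0.
  by rewrite (ord1 i) (integral_borel_lebS mF F0).
case: (unliftP ord0 i) => [j|] ->; last exact: integral_borel_lebS.
rewrite (integral_borel_lebS mF F0).
transitivity (\int[lebesgue_measure]_s \int[lebesgue_measure]_t
  \int[borel_leb n]_y F (ins ord0 s (ins j t y)))%E.
  apply: eq_integral => s _.
  apply: (IH j (fun y => F (ins ord0 s y))) => [|y]; last exact: F0.
  apply: (measurableT_comp mF); apply: measurable_fun_ins; last exact: measurable_id.
  exact: measurable_cst.
(* All coordinates except the two to be exchanged are integrated out; Tonelli in one more variable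
   shows that the result is measurable in the plane. *)
pose G (z : (measurableTypeR R * measurableTypeR R)%type) :=
  (\int[borel_leb n]_y F (ins ord0 z.1 (ins j z.2 y)))%E.
have mG : measurable_fun setT G.
  apply: (measurable_fun_fubini_tonelli_F
    (fun w : (measurableTypeR R * measurableTypeR R) * 'rV[R]_n =>
       F (ins ord0 w.1.1 (ins j w.1.2 w.2)))) => [|x]; last exact: F0.
  apply: (measurableT_comp mF).
  apply: measurable_fun_ins.
    exact: (measurableT_comp measurable_fst measurable_fst).
  apply: measurable_fun_ins; last exact: measurable_snd.
  exact: (measurableT_comp measurable_snd measurable_fst).
have G0 z : (0 <= G z)%E by apply: integral_ge0 => y _; exact: F0.
rewrite (fubini_tonelli G mG G0).
apply: eq_integral => t _.
rewrite integral_borel_lebS; last by move=> x; exact: F0.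
  by apply: eq_integral => s _; apply: eq_integral => y _; rewrite /= ins_comm.
apply: (measurableT_comp mF); apply: measurable_fun_ins; last exact: measurable_id.
exact: measurable_cst.
Qed.
End CoordinateInsertion.

Section Fubini.
Context {R : realType}.
Local Arguments borel_leb : simpl never.

Let measurable_ins2 n (i : 'I_n.+1) :
  measurable_fun setT (fun z : measurableTypeR R * 'rV[R]_n => ins i z.1 z.2).
Proof. by apply: measurable_fun_ins; [exact: measurable_fst|exact: measurable_snd]. Qed.

Lemma ge0_integral_ins_prod n (i : 'I_n.+1) (F : 'rV[R]_n.+1 -> \bar R) :
  measurable_fun setT F -> (forall x, 0 <= F x)%E ->
  (\int[borel_leb n.+1]_x F x =
   \int[lebesgue_measure \x borel_leb n]_z F (ins i z.1 z.2))%E.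
Proof.
move=> mF F0; rewrite (tonelli_ins i mF F0).
have mFi : measurable_fun setT (fun z : measurableTypeR R * 'rV[R]_n => F (ins i z.1 z.2)).
  by apply: (measurableT_comp mF); exact: measurable_ins2.
by rewrite (fubini_tonelli1 _ mFi) => [|z]; [|exact: F0].
Qed.

Lemma integral_ins_prod n (i : 'I_n.+1) (F : 'rV[R]_n.+1 -> \bar R) :
  measurable_fun setT F ->
  (\int[borel_leb n.+1]_x F x =
   \int[lebesgue_measure \x borel_leb n]_z F (ins i z.1 z.2))%E.
Proof.
move=> mF; rewrite integralE [RHS]integralE; congr (_ - _)%E.
  rewrite (ge0_integral_ins_prod i (measurable_funepos mF)) => [|x]; last exact: funepos_ge0.
  by rewrite (funepos_comp F (fun z : measurableTypeR R * 'rV[R]_n => ins i z.1 z.2)).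
rewrite (ge0_integral_ins_prod i (measurable_funeneg mF)) => [|x]; last exact: funeneg_ge0.
by rewrite (funeneg_comp F (fun z : measurableTypeR R * 'rV[R]_n => ins i z.1 z.2)).
Qed.

Lemma integrable_ins_prod n (i : 'I_n.+1) (F : 'rV[R]_n.+1 -> \bar R) :
  (borel_leb n.+1).-integrable setT F ->
  (lebesgue_measure \x borel_leb n)%E.-integrable setT
    (fun z : measurableTypeR R * 'rV[R]_n => F (ins i z.1 z.2)).
Proof.
move=> /integrableP[mF iF]; apply/integrableP; split.
  by apply: (measurableT_comp mF); exact: measurable_ins2.
rewrite -(ge0_integral_ins_prod i (F := fun x => `|F x|%E)); first exact: iF.
  exact: measurableT_comp.
by move=> x; exact: abse_ge0.
Qed.

Lemma fubini_ins n (i : 'I_n.+1) (F : 'rV[R]_n.+1 -> \bar R) :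
  (borel_leb n.+1).-integrable setT F ->
  (\int[borel_leb n.+1]_x F x =
   \int[borel_leb n]_y \int[lebesgue_measure]_t F (ins i t y))%E.
Proof.
move=> iF; have /integrableP[mF _] := iF; rewrite (integral_ins_prod i mF).
by rewrite -(integral21_prod_meas1 (integrable_ins_prod i iF)).
Qed.

Lemma measurable_line_integral n (i : 'I_n.+1) (F : 'rV[R]_n.+1 -> \bar R) :
  (borel_leb n.+1).-integrable setT F ->
  measurable_fun setT (fun y : 'rV[R]_n => \int[lebesgue_measure]_t F (ins i t y))%E.
Proof. by move=> iF; exact: (measurable_fubini_G (integrable_ins_prod i iF)). Qed.

(** Cavalieri's principle: Tonelli for the indicator of [A], integrating along the lines in
    direction [i] first. *)
Lemma borel_null_ins n (i : 'I_n.+1) (A : set 'rV[R]_n.+1) : measurable A ->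
  (forall y, lebesgue_measure [set t | A (ins i t y)] = 0)%E ->
  borel_leb n.+1 A = 0%E.
Proof.
move=> mA A0.
have mF : measurable_fun setT (fun x : 'rV[R]_n.+1 => (\1_A x)%:E : \bar R).
  exact/measurable_EFinP/measurable_indic.
rewrite -(setIT A) -(integral_indic _ measurableT)//.
rewrite (ge0_integral_ins_prod i mF); last by move=> x; rewrite lee_fin.
have mFi : measurable_fun setT (fun z : measurableTypeR R * 'rV[R]_n =>
   (\1_A (ins i z.1 z.2))%:E : \bar R).
  by apply: (measurableT_comp mF); exact: measurable_ins2.
rewrite (fubini_tonelli2 _ mFi); last by move=> z; rewrite lee_fin.
apply: integral0_eq => y _; rewrite /fubini_G /=.
have mAy : measurable ([set t | A (ins i t y)] : set (measurableTypeR R)).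
  rewrite -[X in measurable X]setTI.
  have mi : measurable_fun setT (fun t : measurableTypeR R => ins i t y).
    exact: measurable_fun_ins.
  exact: (mi measurableT A mA).
transitivity (\int[lebesgue_measure]_t (\1_[set t | A (ins i t y)] t)%:E)%E.
  by apply: eq_integral => t _; rewrite !indicE; congr (_%:R%:E); apply/idP/idP; rewrite !inE.
rewrite (integral_indic _ measurableT mAy) setIT; exact: A0.
Qed.

Lemma dot_ins n (i : 'I_n.+1) (nu : 'rV[R]_n.+1) t y :
  dot nu (ins i t y) = nu 0 i * t + dot (\row_l nu 0 (lift i l)) y.
Proof.
rewrite /dot (bigD1_ord i)//= ins_at; congr (_ + _).
by apply: eq_bigr => l _; rewrite ins_lift mxE.
Qed.

Lemma measurable_dot n (nu : 'rV[R]_n) :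
  measurable_fun setT (dot nu : 'rV[R]_n -> R).
Proof.
rewrite /dot; apply: measurable_sum => l.
by apply: measurable_funM; [exact: measurable_cst|exact: measurable_coord].
Qed.

Lemma measurable_dot_eq n (nu : 'rV[R]_n) (c : R) :
  measurable [set x | dot nu x = c].
Proof.
by rewrite -[X in measurable X]setTI; exact: (measurable_dot nu measurableT (measurable_set1 c)).
Qed.

(** A line in a direction [i] with [nu 0 i != 0] meets the hyperplane in one point. If [nu = 0], the
    equation [0 = c] has no solution. *)
Lemma hyperplane_null n (nu : 'rV[R]_n) (c : R) : nu != 0 \/ c != 0 ->
  borel_leb n [set x | dot nu x = c] = 0%E.
Proof.
have [->|nu0] := eqVneq nu 0.
  case=> // c0; rewrite (_ : [set x | _] = set0) ?measure0// -subset0 => x /=.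
  by rewrite /dot big1 => [/esym/eqP|i _]; [exact/negP|rewrite mxE mul0r].
move=> _; have [i nui] : exists i, nu 0 i != 0.
  apply/existsP; apply: contraNT nu0 => /existsPn H; apply/eqP/rowP => i.
  by rewrite mxE; apply/eqP; move: (H i); rewrite negbK.
case: n => [|n] in nu nu0 i nui *; first by case: i nui.
apply: (borel_null_ins (i := i)); first exact: measurable_dot_eq.
move=> y; rewrite (_ : [set t | _] = [set (c - dot (\row_l nu 0 (lift i l)) y) / nu 0 i]).
  by rewrite lebesgue_measure_set1.
apply/seteqP; split => t /=; rewrite dot_ins.
  by move=> <-; rewrite addrK mulrC mulKf.
by move=> ->; rewrite mulrC divfK// subrK.
Qed.

End Fubini.

(** * Affine substitution on the line, and independence of surface integrals of the chart *)

Section AffineSubstitution.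
Context {R : realType}.
Local Notation mu := (@lebesgue_measure R).

(** The pushforward of Lebesgue measure under the affine map, scaled by the absolute value of [b],
    gives every half-open interval its length, and this determines Lebesgue measure. *)
Lemma lebesgue_measure_affine (a b : R) (A : set (measurableTypeR R)) : b != 0 ->
  measurable A ->
  mu [set t | A (a + b * t)] = ((`|b|^-1)%:E * mu A)%E.
Proof.
move=> b0 mA.
have mphi : measurable_fun setT ((fun t => a + b * t) : measurableTypeR R -> measurableTypeR R).
  by apply: measurable_funD => //; apply: measurable_funM.
have bp : 0 < `|b| by rewrite normr_gt0.
pose m := mscale (NngNum (ltW bp)) (measure_function_pushforward__canonical__measure_function_Measure mu mphi).
suff E : mu A = m A.
  rewrite E /m /mscale/= muleA -EFinM mulVf ?gt_eqF// mul1e.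
  by congr (mu _); apply/seteqP; split.
apply: (lebesgue_measure_unique (mu := m)) => // _ [[x y]] _ <-.
rewrite lebesgue_measure_itv/= lte_fin /m /mscale/= /pushforward.
have [bgt|blt|] := ltgtP 0 b; last by move=> b00; rewrite -b00 eqxx in b0.
  rewrite (_ : _ @^-1` _ = `](x - a) / b, (y - a) / b]%classic); last first.
    apply/seteqP; split => t /=; rewrite !in_itv/=.
      by rewrite ltr_pdivrMr// ler_pdivlMr// mulrC ltrBlDl lerBrDl.
    by rewrite ltr_pdivrMr// ler_pdivlMr// mulrC ltrBlDl lerBrDl.
  rewrite lebesgue_measure_itv/= lte_fin ltr_pM2r ?invr_gt0// ltrD2r.
  case: ifP => _; last by rewrite mule0.
  rewrite -!EFinD -EFinM gtr0_norm//; congr (_%:E); field; exact: b0.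
(* For negative [b] the preimage is half-open at the other end, with the same length. *)
rewrite (_ : _ @^-1` _ = `[(y - a) / b, (x - a) / b[%classic); last first.
  apply/seteqP; split => t /=; rewrite !in_itv/=.
    by rewrite ler_ndivrMr// ltr_ndivlMr// mulrC ltrBlDl lerBrDl andbC.
  by rewrite ler_ndivrMr// ltr_ndivlMr// mulrC ltrBlDl lerBrDl andbC.
rewrite lebesgue_measure_itv/= lte_fin ltr_nM2r ?invr_lt0// ltrD2r.
case: ifP => _; last by rewrite mule0.
rewrite -!EFinD -EFinM ltr0_norm//; congr (_%:E); field; exact: b0.
Qed.

Lemma ge0_integral_affine (a b : R) (g : R -> \bar R) : b != 0 ->
  measurable_fun setT g -> (forall t, 0 <= g t)%E ->
  (\int[mu]_t g (a + b * t)%R = (`|b|^-1)%:E * \int[mu]_t g t)%E.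
Proof.
move=> b0 mg g0.
have mphi : measurable_fun setT ((fun t => a + b * t) : measurableTypeR R -> measurableTypeR R).
  by apply: measurable_funD => //; apply: measurable_funM.
have bp : 0 <= `|b|^-1 by rewrite invr_ge0.
rewrite -(ge0_integral_pushforward mphi _ measurableT mg); last by move=> t _; exact: g0.
rewrite -(ge0_integral_mscale mu measurableT (NngNum bp) mg (fun x _ => g0 x)).
apply: eq_measure_integral => A mA _.
exact: (lebesgue_measure_affine a b0 mA).
Qed.

End AffineSubstitution.

Section ChartIndependence.
Context {R : realType}.
Local Arguments borel_leb : simpl never.

Definition delrow n (i : 'I_n.+1) (x : 'rV[R]_n.+1) : 'rV[R]_n := \row_l x 0 (lift i l).

Lemma delrowK n (i : 'I_n.+1) (x : 'rV[R]_n.+1) : ins i (x 0 i) (delrow i x) = x.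
Proof.
by apply/rowP => k; case: (unliftP i k) => [l|] ->; rewrite ?ins_at// ins_lift mxE.
Qed.

Lemma chartE n (nu : 'rV[R]_n.+1) c (j : 'I_n.+1) (y : 'rV[R]_n) :
  chart nu c j y = ins j ((c - dot (delrow j nu) y) / nu 0 j) y.
Proof.
apply/rowP => k; rewrite !mxE; case: (unlift j k) => // .
by rewrite /dot; congr ((c - _) / _); apply: eq_bigr => l _; rewrite mxE.
Qed.

Lemma dot_chart n (nu : 'rV[R]_n.+1) c (j : 'I_n.+1) (y : 'rV[R]_n) :
  nu 0 j != 0 -> dot nu (chart nu c j y) = c.
Proof. by move=> nuj; rewrite chartE dot_ins mulrC divfK// subrK. Qed.

Lemma chart_delrow n (nu : 'rV[R]_n.+1) c (j : 'I_n.+1) x :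
  nu 0 j != 0 -> dot nu x = c -> chart nu c j (delrow j x) = x.
Proof.
move=> nuj; rewrite -{1}(delrowK j x) dot_ins => xc.
by rewrite chartE -xc addrK mulrC mulKf// delrowK.
Qed.

Lemma measurable_chart n (nu : 'rV[R]_n.+1) c (j : 'I_n.+1) :
  measurable_fun setT (chart nu c j : 'rV[R]_n -> 'rV[R]_n.+1).
Proof.
rewrite (_ : chart nu c j = fun y => ins j ((c - dot (delrow j nu) y) / nu 0 j) y); last first.
  by apply/funext => y; exact: chartE.
apply: measurable_fun_ins; last exact: measurable_id.
apply: measurable_funM; last exact: measurable_cst.
by apply: measurable_funB; [exact: measurable_cst|exact: measurable_dot].
Qed.

Lemma lift_lift n (a j : 'I_n.+2) (a' j' : 'I_n.+1) (i : 'I_n) :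
  lift j a' = a -> lift a j' = j -> lift j (lift a' i) = lift a (lift j' i).
Proof.
move=> /(congr1 val) /= ja /(congr1 val) /= aj; apply: val_inj => /=.
by move: ja aj; rewrite /bump; lia.
Qed.

(** With all coordinates except [j] and [a] fixed, the hyperplane equation makes the [j]-th
    coordinate an affine function of the [a]-th, with slope [- nu 0 a / nu 0 j]. A substitution on
    the line therefore turns one chart into the other, and its factor is the quotient of the two
    densities. *)
Lemma ge0_chart_indep n (nu : 'rV[R]_n.+1) c (j a : 'I_n.+1) (G : 'rV[R]_n.+1 -> \bar R) :
  nu 0 j != 0 -> nu 0 a != 0 -> measurable_fun setT G -> (forall x, 0 <= G x)%E ->
  ((`|nu 0 j|^-1)%:E * \int[borel_leb n]_y G (chart nu c j y) =
   (`|nu 0 a|^-1)%:E * \int[borel_leb n]_y G (chart nu c a y))%E.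
Proof.
move=> nuj nua mG G0.
have [->//|ja] := eqVneq j a.
case: n => [|n] in nu j a G nuj nua mG G0 ja *.
  by rewrite (ord1 j) (ord1 a) in ja.
case: (unliftP j a) => [a' aE|aE]; last by rewrite aE eqxx in ja.
case: (unliftP a j) => [j' jE|jE]; last by rewrite jE eqxx in ja.
have mGc k : measurable_fun setT (G \o chart nu c k : 'rV[R]_n.+1 -> _).
  by apply: (measurableT_comp mG); exact: measurable_chart.
have Gc0 k y : (0 <= (G \o chart nu c k) y)%E by exact: G0.
(* Here [a'] and [j'] are the positions of [a] and [j] once the other one is deleted. The constant
   [al] is the value of the [j]-th coordinate where the [a]-th one is zero. *)
have key z : exists al, forall t, chart nu c j (ins a' t z) =
    chart nu c a (ins j' (al + (- nu 0 a / nu 0 j) * t) z).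
  exists (chart nu c j (ins a' 0 z) 0 j) => t.
  have [x xE] : exists x, x = chart nu c j (ins a' t z) by eexists.
  have xl i : x 0 (lift j (lift a' i)) = z 0 i by rewrite xE chartE ins_lift ins_lift.
  have xj : x 0 j = chart nu c j (ins a' 0 z) 0 j + (- nu 0 a / nu 0 j) * t.
    rewrite xE !chartE !ins_at !dot_ins !mxE -aE; field; exact: nuj.
  rewrite -xE -xj -[LHS](@chart_delrow _ nu c a)//; last by rewrite xE dot_chart.
  congr chart; apply/rowP => l; rewrite mxE.
  case: (unliftP j' l) => [i|] ->; last by rewrite ins_at -jE.
  by rewrite ins_lift -(lift_lift _ (esym aE) (esym jE)) xl.
have mI : measurable_fun setT (fun z : 'rV[R]_n =>
    \int[lebesgue_measure]_t (G \o chart nu c a) (ins j' t z))%E.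
  apply: (measurable_fun_fubini_tonelli_G
    (fun w : measurableTypeR R * 'rV[R]_n => (G \o chart nu c a) (ins j' w.1 w.2))) => [|w].
    apply: (measurableT_comp (mGc a)).
    by apply: measurable_fun_ins; [exact: measurable_fst|exact: measurable_snd].
  exact: G0.
have swap k (i : 'I_n.+1) : (\int[borel_leb n.+1]_y G (chart nu c k y) =
    \int[borel_leb n]_z \int[lebesgue_measure]_t (G \o chart nu c k) (ins i t z))%E.
  rewrite (ge0_integral_ins_prod i (mGc k) (Gc0 k)).
  rewrite fubini_tonelli2; first by [].
    apply: (measurableT_comp (mGc k)).
    by apply: measurable_fun_ins; [exact: measurable_fst|exact: measurable_snd].
  by move=> w; exact: G0.
rewrite (swap j a') (swap a j').
have b0 : - nu 0 a / nu 0 j != 0 by rewrite mulf_neq0 ?oppr_eq0 ?invr_eq0.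
transitivity ((`|nu 0 j|^-1)%:E * \int[borel_leb n]_z ((`|- nu 0 a / nu 0 j|^-1)%:E *
    \int[lebesgue_measure]_t (G \o chart nu c a) (ins j' t z)))%E.
  congr (_ * _)%E; apply: eq_integral => z _; have [al alE] := key z.
  rewrite -(ge0_integral_affine al b0); last by move=> t; exact: G0.
    by apply: eq_integral => t _; rewrite /= alE.
  apply: (measurableT_comp (mGc a)).
  by apply: measurable_fun_ins; [exact: measurable_id|exact: measurable_cst].
rewrite (ge0_integralZl (borel_leb n) measurableT mI); first last.
- by rewrite lee_fin invr_ge0.
- by move=> z _; apply: integral_ge0 => t _; exact: G0.
rewrite muleA -EFinM; congr (_%:E * _)%E.
by rewrite normrM normrN normfV; field; rewrite !normr_eq0 nuj nua.
Qed.

Lemma chart_indep n (nu : 'rV[R]_n.+1) c (j a : 'I_n.+1) (G : 'rV[R]_n.+1 -> \bar R) :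
  nu 0 j != 0 -> nu 0 a != 0 -> measurable_fun setT G ->
  ((`|nu 0 j|^-1)%:E * \int[borel_leb n]_y G (chart nu c j y) =
   (`|nu 0 a|^-1)%:E * \int[borel_leb n]_y G (chart nu c a y))%E.
Proof.
move=> nuj nua mG.
(* A positive real factor distributes over the difference of the two parts even when both are
   infinite, so no integrability enters. *)
have split k : nu 0 k != 0 -> ((`|nu 0 k|^-1)%:E * \int[borel_leb n]_y G (chart nu c k y) =
    (`|nu 0 k|^-1)%:E * \int[borel_leb n]_y (G^\+)%E (chart nu c k y) -
    (`|nu 0 k|^-1)%:E * \int[borel_leb n]_y (G^\-)%E (chart nu c k y))%E.
  move=> nuk; rewrite integralE (funepos_comp G) (funeneg_comp G) /=.
  have k0 : 0 < `|nu 0 k|^-1 by rewrite invr_gt0 normr_gt0.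
  set x := (\int[_]_y _)%E; set y := (\int[_]_y _)%E.
  case: x => [x| |]; case: y => [y| |] //=; rewrite ?gt0_muley ?gt0_muleNy ?lte_fin//=
    ?gt0_muley ?gt0_muleNy ?lte_fin//=.
  by rewrite -!EFinM -!EFinB mulrBr.
rewrite !split//; congr (_ - _)%E; apply: ge0_chart_indep => //.
- exact: measurable_funepos.
- exact: measurable_funeneg.
Qed.

End ChartIndependence.

(** * Integrals of nonnegative and of locally bounded functions *)
Section IntegralCover.
Context d (T : measurableType d) (R : realType) (mu : {measure set T -> \bar R}).
Local Open Scope ereal_scope.
Import HBNNSimple.

Local Notation nnintegral mu g :=
  (ereal_sup [set sintegral mu h | h in [set h : {nnsfun T >-> R} | forall x, (h x)%:E <= g x]]).

Let nnintegral_ge0 (g : T -> \bar R) : (forall x, 0 <= g x) -> 0 <= nnintegral mu g.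
Proof.
move=> g0; apply: ereal_sup_ubound; exists nnsfun0 => //; exact: sintegral0.
Qed.

(** The sum of simple functions below [g1] and below [g2] is a simple function below [g1 \+ g2].
    Without measurability the supremum is in general only superadditive. *)
Lemma nnintegral_superadd (g1 g2 : T -> \bar R) :
  (forall x, 0 <= g1 x) -> (forall x, 0 <= g2 x) ->
  nnintegral mu g1 + nnintegral mu g2 <= nnintegral mu (g1 \+ g2).
Proof.
move=> g10 g20; set S := nnintegral mu (g1 \+ g2).
have key (h1 h2 : {nnsfun T >-> R}) : (forall x, (h1 x)%:E <= g1 x) ->
    (forall x, (h2 x)%:E <= g2 x) -> sintegral mu h1 + sintegral mu h2 <= S.
  move=> h1g h2g; rewrite -sintegralD; apply: ereal_sup_ubound => /=.
  by exists (add_nnsfun h1 h2) => // x; rewrite EFinD; exact: leeD.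
(* Once the right side is finite, all simple integrals involved are finite, and the two suprema can
   be taken one after the other by subtraction. *)
have [SE|Sfin] := eqVneq S +oo; first by rewrite SE leey.
have S0 : 0 <= S by apply: nnintegral_ge0 => x; exact: adde_ge0.
have sfin (h : {nnsfun T >-> R}) : sintegral mu h <= S -> sintegral mu h \is a fin_num.
  move=> hS; rewrite ge0_fin_numE ?sintegral_ge0//; apply: le_lt_trans hS _.
  by rewrite ltey.
have g2fin : nnintegral mu g2 \is a fin_num.
  rewrite ge0_fin_numE ?nnintegral_ge0//; apply: (@le_lt_trans _ _ S); last by rewrite ltey.
  apply: ge_ereal_sup => _ [h2 h2g <-]; have := key nnsfun0 h2 _ h2g.
  by rewrite sintegral0 add0e; apply => x.
rewrite -leeBrDr//; apply: ge_ereal_sup => _ [h1 h1g <-].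
have h1S : sintegral mu h1 <= S.
  by have := key h1 nnsfun0 h1g; rewrite sintegral0 adde0; apply => x.
rewrite leeBrDr// addeC -leeBrDr ?sfin//; apply: ge_ereal_sup => _ [h2 h2g <-].
by rewrite leeBrDr ?sfin// addeC; exact: key.
Qed.

Lemma le_nnintegral (g1 g2 : T -> \bar R) : (forall x, g1 x <= g2 x) ->
  nnintegral mu g1 <= nnintegral mu g2.
Proof.
move=> g12; apply: ereal_sup_le => _ [h hg <-]; exists h => // x.
exact: le_trans (hg x) (g12 x).
Qed.

(* No measurability of f is needed: the integral is a supremum of integrals of
   simple functions below f. *)
Lemma ge0_integral_cover (I : finType) (C : I -> set T) (D : set T)
    (f : T -> \bar R) :
  measurable D -> (forall i, measurable (C i)) -> (forall i, C i `<=` D) ->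
  (forall i j, i != j -> C i `&` C j = set0) ->
  mu (D `\` \bigcup_i C i) = 0 ->
  (forall x, D x -> 0 <= f x) ->
  \int[mu]_(x in D) f x = \sum_i \int[mu]_(x in C i) f x.
Proof.
move=> mD mC CD tC N0 f0.
have f0C i x : C i x -> 0 <= f x by move=> /CD; exact: f0.
have mU : measurable (\bigcup_i C i).
  by rewrite bigcup_mkcond; apply: fin_bigcup_measurable => // i _; case: ifP.
have rge0 i x : 0 <= (f \_ (C i)) x by apply: erestrict_ge0; exact: f0C.
apply/eqP; rewrite eq_le; apply/andP; split.
  (* Upper bound: a simple function below [f] on [D] is measurable, so its integral splits over the
     [C i], and each of its restrictions competes in the supremum that defines the integral over
     [C i]. *)
  rewrite ge0_integralE//; apply: ge_ereal_sup => _ [h hf <-].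
  have hD x : ~ D x -> h x = 0%R.
    move=> nDx; apply/eqP; rewrite eq_le fun_ge0 andbT -lee_fin.
    by have := hf x; rewrite patchE memNset.
  have hE : sintegral mu h = \int[mu]_(x in D) (h x)%:E.
    rewrite integral_nnsfun//; apply: eq_sintegral => x; rewrite patchE.
    by case: ifPn => // /negP; rewrite inE => /hD.
  have mh A : measurable_fun A (EFin \o h).
    by apply/measurable_EFinP; exact: measurable_funTS.
  rewrite hE.
  have -> : \int[mu]_(x in D) (h x)%:E = \int[mu]_(x in \bigcup_i C i) (h x)%:E.
    have DE : D = (\bigcup_i C i) `|` (D `\` \bigcup_i C i).
      rewrite setUC setDKU//; exact: bigcup_sub.
    have DU : [disjoint \bigcup_i C i & D `\` \bigcup_i C i] by rewrite disj_set2E setDIK.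
    have mDU : measurable (D `\` \bigcup_i C i) by exact: measurableD.
    rewrite {1}DE (ge0_integral_setU mu mU mDU (mh _) _ DU); last first.
      by move=> x _; rewrite lee_fin.
    rewrite [X in _ + X](_ : _ = 0) ?adde0//.
    exact: null_set_integral.
  have -> : \bigcup_i C i = \big[setU/set0]_(i <- enum I) C i.
    rewrite -bigcup_seq; apply/seteqP; split => x [i _ Cx]; exists i => //=.
    by rewrite mem_enum.
  rewrite ge0_integral_bigsetU//=.
  - rewrite big_enum/=; apply: lee_sum => i _.
    rewrite integral_nnsfun// ge0_integralE; last exact: f0C.
    apply: ereal_sup_ubound => /=; exists (proj_nnsfun h (mC i)) => [x|]; last first.
      by apply: eq_sintegral => x; rewrite mrestrict.
    rewrite -mrestrict !patchE; case: ifPn => // /set_mem Cx.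
    by have := hf x; rewrite patchE mem_set//; exact: CD Cx.
  - exact: enum_uniq.
  - apply/trivIsetP => i j _ _ ij; exact: tC.
  - by move=> x _; rewrite lee_fin.
(* Lower bound: by disjointness the restrictions of [f] to the [C i] add up to at most [f]
   restricted to [D], and superadditivity applies. *)
rewrite ge0_integralE//.
apply: (@le_trans _ _ (nnintegral mu (fun x => \sum_i (f \_ (C i)) x))); last first.
  apply: le_nnintegral => x; have [[i _ Cix]|nC] := pselect ((\bigcup_i C i) x).
    rewrite (bigD1 i)//= big1 ?adde0 => [|j ji].
      by rewrite !patchE !mem_set//; exact: CD Cix.
    rewrite patchE memNset// => Cjx.
    by have : (C i `&` C j) x by []; rewrite tC// eq_sym.
  rewrite big1 => [|i _]; first exact: erestrict_ge0.
  by rewrite patchE memNset// => Cix; apply: nC; exists i.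
rewrite (eq_bigr (fun i => nnintegral mu (f \_ (C i)))); last first.
  by move=> i _; rewrite ge0_integralE//; exact: f0C.
elim: (index_enum I) => [|i s IH].
  by rewrite big_nil; apply: nnintegral_ge0 => x; rewrite big_nil.
rewrite big_cons; apply: le_trans (leeD2l _ IH) _.
apply: le_trans (nnintegral_superadd (rge0 i) _) _ => [x|].
  by apply: sume_ge0 => j _; exact: rge0.
by apply: le_nnintegral => x; rewrite big_cons.
Qed.

End IntegralCover.

(** * Measurable functions bounded on cubes *)

Section LocallyBounded.
Context {R : realType}.
Local Arguments borel_leb : simpl never.

Definition cube n (r : R) : set 'rV[R]_n := [set x | forall i, `|x 0 i| <= r].

Definition in_cube n (A : set 'rV[R]_n) : Prop := exists r, A `<=` cube r.

(* locally bounded and measurable *)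
Definition lbm n (F : 'rV[R]_n -> R) : Prop :=
  measurable_fun setT F /\ forall r, exists C, forall x, cube r x -> `|F x| <= C.

Lemma in_cubeS n (A B : set 'rV[R]_n) : A `<=` B -> in_cube B -> in_cube A.
Proof. by move=> AB [r Br]; exists r; exact: subset_trans Br. Qed.

Lemma lbm_cst n c : lbm (fun _ : 'rV[R]_n => c).
Proof. by split; [exact: measurable_cst|move=> r; exists `|c|]. Qed.

Lemma lbm_coord n i : lbm (fun x : 'rV[R]_n => x 0 i).
Proof. by split; [exact: measurable_coord|move=> r; exists r]. Qed.

Lemma lbmD n (F G : 'rV[R]_n -> R) : lbm F -> lbm G -> lbm (fun x => F x + G x).
Proof.
move=> [mF bF] [mG bG]; split; first exact: measurable_funD.
move=> r; have [C FC] := bF r; have [C' GC] := bG r; exists (C + C') => x xr.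
by apply: le_trans (ler_normD _ _) _; apply: lerD; [exact: FC|exact: GC].
Qed.

Lemma lbmM n (F G : 'rV[R]_n -> R) : lbm F -> lbm G -> lbm (fun x => F x * G x).
Proof.
move=> [mF bF] [mG bG]; split; first exact: measurable_funM.
move=> r; have [C FC] := bF r; have [C' GC] := bG r; exists (C * C') => x xr.
by rewrite normrM ler_pM//; [exact: FC|exact: GC].
Qed.

Lemma lbmN n (F : 'rV[R]_n -> R) : lbm F -> lbm (fun x => - F x).
Proof.
move=> [mF bF]; split; first exact: measurable_funN.
by move=> r; have [C FC] := bF r; exists C => x xr; rewrite normrN; exact: FC.
Qed.

Lemma lbmB n (F G : 'rV[R]_n -> R) : lbm F -> lbm G -> lbm (fun x => F x - G x).
Proof. by move=> lF lG; apply: lbmD => //; exact: lbmN. Qed.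

Lemma lbm_sum n (I : Type) (s : seq I) (P : pred I) (F : I -> 'rV[R]_n -> R) :
  (forall i, lbm (F i)) -> lbm (fun x => \sum_(i <- s | P i) F i x).
Proof.
move=> lF; elim: s => [|i s IH].
  by under eq_fun do rewrite big_nil; exact: lbm_cst.
under eq_fun do rewrite big_cons.
by case: (P i) => //; exact: lbmD.
Qed.

Lemma lbm_prod n (I : Type) (s : seq I) (P : pred I) (F : I -> 'rV[R]_n -> R) :
  (forall i, lbm (F i)) -> lbm (fun x => \prod_(i <- s | P i) F i x).
Proof.
move=> lF; elim: s => [|i s IH].
  by under eq_fun do rewrite big_nil; exact: lbm_cst.
under eq_fun do rewrite big_cons.
by case: (P i) => //; exact: lbmM.
Qed.

Lemma lbmX n (F : 'rV[R]_n -> R) k : lbm F -> lbm (fun x => F x ^+ k).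
Proof.
move=> lF; elim: k => [|k IH]; first exact: lbm_cst.
by under eq_fun do rewrite exprS; exact: lbmM.
Qed.

Lemma lbm_dot n (nu : 'rV[R]_n) : lbm (dot nu).
Proof. by apply: lbm_sum => i; apply: lbmM; [exact: lbm_cst|exact: lbm_coord]. Qed.

Lemma lbm_chart n (nu : 'rV[R]_n.+1) c j (F : 'rV[R]_n.+1 -> R) :
  lbm F -> lbm (fun y : 'rV[R]_n => F (chart nu c j y)).
Proof.
move=> [mF bF]; split; first by apply: measurableT_comp => //; exact: measurable_chart.
move=> r.
have lt : lbm (fun y : 'rV[R]_n => (c - dot (delrow j nu) y) / nu 0 j).
  apply: lbmM; last exact: lbm_cst.
  by apply: lbmB; [exact: lbm_cst|exact: lbm_dot].
have [C tC] := lt.2 r; have [C' FC] := bF (Num.max r C); exists C' => y yr.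
apply: FC => i; rewrite le_max chartE.
case: (unliftP j i) => [l|] ->; first by rewrite ins_lift yr.
by rewrite ins_at tC ?orbT.
Qed.

Lemma measurable_cube n r : measurable (@cube n r).
Proof.
rewrite (_ : @cube n r = \bigcap_(i : 'I_n) (coords i @^-1` `[- r, r])).
  rewrite bigcap_mkcond; apply: fin_bigcap_measurable => // i _.
  case: ifP => // _; rewrite -[X in measurable X]setTI.
  by apply: measurable_coord => //; exact: measurable_itv.
by apply/seteqP; split => x H i; [move=> _|]; have := H i; rewrite /= in_itv/= -ler_norml//; exact.
Qed.

Lemma cube_lty n r : (borel_leb n (@cube n r) < +oo)%E.
Proof.
elim: n => [|n IH].
  by apply: le_lt_trans (ltry 1); rewrite [X in (X <= _)%E]diracE; case: (_ \in _).
rewrite (_ : borel_leb n.+1 (@cube n.+1 r) =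
  (lebesgue_measure \x borel_leb n)%E (`[- r, r] `*` @cube n r)).
  rewrite product_measure1E//; last exact: measurable_cube.
  have Ifin : (lebesgue_measure (`[(- r)%R, r]%classic : set R) < +oo)%E.
    by rewrite lebesgue_measure_itv/=; case: ifP => _; rewrite -?EFinD ltry.
  by rewrite lte_mul_pinfty// ge0_fin_numE.
transitivity ((lebesgue_measure \x borel_leb n)%E (@cons_rV R n @^-1` cube r)); first by [].
congr ((lebesgue_measure \x borel_leb n)%E _); apply/seteqP; split => -[t y] /=.
  rewrite cons_rVE => H; split; last by move=> i; have := H (lift ord0 i); rewrite ins_lift.
  by rewrite in_itv/= -ler_norml; have := H ord0; rewrite ins_at.
rewrite in_itv/= -ler_norml => -[Ht Hy]; rewrite cons_rVE => i.
by case: (unliftP ord0 i) => [l|] ->; rewrite ?ins_lift ?ins_at.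
Qed.

Lemma leb_in_cube_lty n (A : set 'rV[R]_n) : measurable (A : set (lebT R n)) ->
  in_cube A -> (leb n A < +oo)%E.
Proof.
move=> mA [r Ar]; apply: le_lt_trans (cube_lty n r).
rewrite -leb_borelE; last exact: measurable_cube.
by rewrite le_measure// inE//; apply: measurable_lebT; exact: measurable_cube.
Qed.

Lemma borel_in_cube_lty n (A : set 'rV[R]_n) : measurable A ->
  in_cube A -> (borel_leb n A < +oo)%E.
Proof.
move=> mA [r Ar]; apply: le_lt_trans (cube_lty n r).
by rewrite le_measure// inE//; exact: measurable_cube.
Qed.

Lemma lbm_bounded n (F : 'rV[R]_n -> R) (A : set 'rV[R]_n) : lbm F -> in_cube A ->
  [bounded F x | x in A].
Proof.
move=> [_ bF] [r Ar]; have [C FC] := bF r; exists C; split; first exact: num_real.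
by move=> M CM x Ax; apply: le_trans (ltW CM); apply: FC; exact: Ar.
Qed.

Lemma integrable_lbm n (F : 'rV[R]_n -> R) (A : set 'rV[R]_n) : lbm F -> in_cube A ->
  measurable A -> (borel_leb n).-integrable A (EFin \o F).
Proof.
move=> lF bA mA; apply: measurable_bounded_integrable => //.
- exact: borel_in_cube_lty.
- by apply: measurable_funTS; exact: lF.1.
- exact: lbm_bounded.
Qed.

Lemma integrable_lbm_leb n (F : 'rV[R]_n -> R) (A : set (lebT R n)) : lbm F -> in_cube A ->
  measurable A -> (leb n).-integrable A (EFin \o (F : lebT R n -> R)).
Proof.
move=> lF bA mA; apply: measurable_bounded_integrable => //.
- exact: leb_in_cube_lty.
- by apply: measurable_funTS; apply: measurable_fun_lebT; exact: lF.1.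
- exact: lbm_bounded.
Qed.

End LocallyBounded.

(** * Polytopes near generic boundary points *)
Section PolytopeTopology.
Context {R : realType} {d : nat}.
Implicit Types (P Q : polytope R d) (x y z w nu : 'rV[R]_d).

(** Serves both neighbourhood filters and the almost everywhere filter. *)
Lemma filter_fin (T : Type) (F : set_system T) {FF : Filter F} (I : finType)
    (P : I -> T -> Prop) :
  (forall i, F (P i)) -> F (fun t => forall i, P i t).
Proof.
move=> H; have : F (fun t => forall i, i \in enum I -> P i t).
  elim: (enum I) => [|i s IH]; first exact: filterE.
  apply: filterS2 (H i) IH => x Pi Ps j; rewrite inE => /orP[/eqP->//|]; exact: Ps.
by apply: filterS => x Px i; apply: Px; rewrite mem_enum.
Qed.

Lemma dotC x y : dot x y = dot y x.
Proof. by apply: eq_bigr => i _; rewrite mulrC. Qed.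

Lemma dot_line nu x t w : dot nu (x + t *: w) = dot nu x + t * dot nu w.
Proof.
rewrite /dot mulr_sumr -big_split/=; apply: eq_bigr => i _; rewrite !mxE; ring.
Qed.

Lemma dotNl nu x : dot (- nu) x = - dot nu x.
Proof. by rewrite /dot -sumrN; apply: eq_bigr => i _; rewrite mxE mulNr. Qed.

Lemma enorm1_dot nu : enorm nu = 1 -> dot nu nu = 1.
Proof.
rewrite /enorm => H; have d0 : 0 <= dot nu nu.
  by apply: sumr_ge0 => i _; rewrite -expr2 sqr_ge0.
by rewrite -(sqr_sqrtr d0) H expr1n.
Qed.

Lemma unit_coord nu : enorm nu = 1 -> exists i, nu 0 i != 0.
Proof.
move=> /enorm1_dot n1; apply/existsP; apply/existsPn => H.
move: n1; rewrite /dot big1 => [/esym/eqP|i _]; first by rewrite oner_eq0.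
by move: (H i); rewrite negbK => /eqP ->; rewrite mul0r.
Qed.

Lemma continuous_dot nu : continuous (dot nu).
Proof.
rewrite /dot; elim: (index_enum _) => [|i s IH] x.
  by rewrite (_ : (fun y => _) = cst 0); [exact: cst_continuous|apply/funext => y; rewrite big_nil].
under eq_fun do rewrite big_cons.
apply: (@continuousD _ _ _ (fun x => nu 0 i * x 0 i)); last exact: IH.
apply: (@continuousM _ _ (cst (nu 0 i)) (fun y => y 0 i)); first exact: cst_continuous.
exact: coord_continuous.
Qed.

Lemma near_dot_lt nu c x : dot nu x < c -> \forall y \near x, dot nu y < c.
Proof.
move=> xc; have := @continuous_dot nu x.
move=> /(_ [set t | t < c]) /=; apply.
exact: lt_nbhsl.
Qed.

Lemma near_dot_gt nu c x : c < dot nu x -> \forall y \near x, c < dot nu y.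
Proof.
move=> xc; have := @continuous_dot nu x.
move=> /(_ [set t | c < t]) /=; apply.
exact: lt_nbhsr.
Qed.

Lemma near_line x w (A : set 'rV[R]_d) : nbhs x A ->
  exists2 e, 0 < e & forall t, 0 < t < e -> A (x + t *: w).
Proof.
move=> Ax; have : \forall t \near (0 : R), A (x + t *: w).
  have c : {for (0 : R), continuous (fun t : R => x + t *: w)}.
    apply: continuousD; first exact: cvg_cst.
    by apply: continuousZ; [exact: cvg_id|exact: cvg_cst].
  by apply: c; rewrite scale0r addr0.
move=> /nbhs_ballP[e /= e0 eA]; exists e => // t /andP[t0 te]; apply: eA.
by rewrite /ball/= sub0r normrN gtr0_norm.
Qed.

(** Neighbourhoods come from the maximum norm while [fat_in] uses Euclidean balls; the maximum norm
    is bounded by the Euclidean one. *)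
Lemma near_enorm x (A : set 'rV[R]_d) : nbhs x A ->
  exists2 r, 0 < r & forall y, enorm (y - x) < r -> A y.
Proof.
move=> /nbhs_ballP[e /= e0 eA]; exists e => // y xy; apply: eA; split=> // i j.
rewrite ord1 /ball/= -normrN opprB; apply: le_lt_trans xy.
rewrite /enorm -sqrtr_sqr ler_wsqrtr// /dot (bigD1 j)//= !mxE -expr2 lerDl.
by apply: sumr_ge0 => k _; rewrite -expr2 sqr_ge0.
Qed.

(** Moving along the unit outward normal from a point of equality violates that inequality at once,
    so the point is not interior. Conversely, finitely many strict inequalities persist nearby. *)
Lemma cellE P : proper_polytope P ->
  cell P = [set x | forall l, dot (normal l) x < @offset _ _ P l].
Proof.
move=> [_ _ P1 _ _]; apply/seteqP; split => x /= Hx.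
  move=> l; have Px := nbhs_singleton Hx; rewrite lt_neqAle Px andbT.
  apply/eqP => xl; have [e e0 He] := near_line (normal l) Hx.
  have e2 : 0 < e / 2 < e by rewrite divr_gt0//= ltr_pdivrMr// ltr_pMr// ltr1n.
  have := He _ e2 l; rewrite dot_line xl enorm1_dot// mulr1 gerDl leNgt.
  by case/andP: e2 => ->.
rewrite /cell /interior /=.
have : \forall y \near x, forall l, dot (normal l) y < @offset _ _ P l.
  by apply: (@filter_fin _ (nbhs x) _ _ (fun l y => dot (normal l) y < offset l)) => l; exact: near_dot_lt.
by apply: filterS => y Hy l; exact: ltW.
Qed.

Lemma cell_open P : open (cell P).
Proof. exact: open_interior. Qed.

Lemma cell_body P : cell P `<=` body P.
Proof. exact: interior_subset. Qed.

Lemma closed_body P : closed (body P).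
Proof.
rewrite -openC openE => x /= /existsNP[l /negP]; rewrite -ltNge => lx.
rewrite /interior; apply: filterS (near_dot_gt lx) => y ly /(_ l).
by apply/negP; rewrite -ltNge.
Qed.

Lemma frontier_body P : frontier (body P) = body P `\` cell P.
Proof. by rewrite /frontier -(closure_id (body P)).1//; exact: closed_body. Qed.

Lemma cell_segment P x z t : proper_polytope P -> body P x -> cell P z ->
  0 < t <= 1 -> cell P (x + t *: (z - x)).
Proof.
move=> pP Px Pz /andP[t0 t1]; move: Pz; rewrite cellE// => Pz l.
rewrite (_ : z - x = z + (- 1) *: x); last by rewrite scaleN1r.
rewrite dot_line dot_line.
rewrite (_ : dot (normal l) x + _ = (1 - t) * dot (normal l) x + t * dot (normal l) z); last by ring.
rewrite (_ : offset l = (1 - t) * offset l + t * offset l); last by ring.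
apply: ler_ltD; last by rewrite ltr_pM2l//; exact: Pz.
by rewrite ler_wpM2l ?subr_ge0//; exact: Px.
Qed.

Definition tight P x (m : 'I_(nfacets P)) := dot (normal m) x = offset m.

(* Almost every point of a hyperplane with normal nu is generic, see [ae_generic]. *)
Definition generic P nu x := forall m : 'I_(nfacets P),
  tight x m -> normal m = nu \/ normal m = - nu.

(** Otherwise the body would lie in a hyperplane, and the cell would be empty. *)
Lemma not_opposite_tight P x m m' : proper_polytope P -> tight x m -> tight x m' ->
  @normal _ _ P m' <> - @normal _ _ P m.
Proof.
move=> pP tm tm' E; have [_ [z Pz] _ _ _] := pP; move: Pz; rewrite cellE// => Pz.
have := Pz m; have := Pz m'; rewrite -tm -tm' E !dotNl ltrN2 => h1 h2.
by have := lt_trans h1 h2; rewrite ltxx.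
Qed.

(** Outside the cell some inequality is tight. A second tight one would also have normal [nu] or
    [- nu]: equal normals are excluded by injectivity, opposite ones by [not_opposite_tight]. *)
Lemma generic_facet P nu x : proper_polytope P -> body P x -> generic P nu x ->
  ~ cell P x -> exists m, [/\ tight x m, normal m = nu \/ normal m = - nu &
    forall m', m' != m -> dot (@normal _ _ P m') x < offset m'].
Proof.
move=> pP Px gx nc; have [m tm] : exists m, @tight P x m.
  apply: contrapT => nt; apply: nc; rewrite cellE// => l.
  by rewrite lt_neqAle Px andbT; apply/eqP => xl; apply: nt; exists l.
exists m; split => //; first exact: gx.
move=> m' m'm; rewrite lt_neqAle Px andbT; apply/eqP => tm'.
have [_ _ _ inj _] := pP.
have := not_opposite_tight pP tm tm'.
have : normal m' <> normal m by move=> /inj E; rewrite E eqxx in m'm.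
case: (gx m tm) => ->; case: (gx m' tm') => -> //; rewrite ?opprK//.
Qed.

(** The strict inequalities persist in a neighbourhood, where the body is thus a half-space. *)
Lemma body_near P m x :
  (forall m', m' != m -> dot (@normal _ _ P m') x < offset m') ->
  \forall y \near x, dot (normal m) y <= offset m -> body P y.
Proof.
move=> H; have : \forall y \near x, forall m', m' != m -> dot (@normal _ _ P m') y < offset m'.
  apply: (@filter_fin _ (nbhs x) _ _ (fun m' y => m' != m -> dot (normal m') y < offset m')) => m'.
  have [->|m'm] := eqVneq m' m; first by apply: (@filterE _ (nbhs x)) => y.
  by apply: filterS (near_dot_lt (H m' m'm)) => y.
apply: filterS => y Hy ym l; have [->//|lm] := eqVneq l m.
exact/ltW/Hy.
Qed.

Lemma cell_near P m x : proper_polytope P ->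
  (forall m', m' != m -> dot (@normal _ _ P m') x < offset m') ->
  \forall y \near x, dot (normal m) y < offset m -> cell P y.
Proof.
move=> pP H; rewrite cellE//.
have : \forall y \near x, forall m', m' != m -> dot (@normal _ _ P m') y < offset m'.
  apply: (@filter_fin _ (nbhs x) _ _ (fun m' y => m' != m -> dot (normal m') y < offset m')) => m'.
  have [->|m'm] := eqVneq m' m; first by apply: (@filterE _ (nbhs x)) => y.
  by apply: filterS (near_dot_lt (H m' m'm)) => y.
apply: filterS => y Hy ym l /=; have [->//|lm] := eqVneq l m.
exact: Hy.
Qed.

(** From [x] one can move towards a point of the cell of [Q]: this enters [cell Q] at once, while
    short moves stay in the open set [cell P]. *)
Lemma disjoint_not_cell P Q x : proper_polytope Q ->
  cell P `&` cell Q = set0 -> body Q x -> ~ cell P x.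
Proof.
move=> pQ PQ Qx Px; have [_ [z Qz] _ _ _] := pQ.
have [e e0 He] := near_line (z - x) (open_nbhs_nbhs (conj (@cell_open P) Px)).
(* Below [e] to stay in [cell P], at most 1 to stay on the segment. *)
pose t := Num.min (e / 2) 1.
have t0 : 0 < t by rewrite lt_min divr_gt0//= ltr01.
have te : t < e by rewrite gt_min ltr_pdivrMr// ltr_pMr// ltr1n.
have : (cell P `&` cell Q) (x + t *: (z - x)).
  split; first by apply: He; rewrite t0.
  by apply: cell_segment => //; rewrite t0/= ge_min lexx orbT.
by rewrite PQ.
Qed.

(** Each polytope has exactly one tight facet at [x], with normal [nu] or [- nu]. If the two normals
    agreed, a short move against them would enter both cells; so they are opposite. *)
Lemma disjoint_facets P Q nu x : proper_polytope P -> proper_polytope Q ->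
  cell P `&` cell Q = set0 -> body P x -> body Q x ->
  generic P nu x -> generic Q nu x ->
  exists m m', [/\ @normal _ _ Q m' = - @normal _ _ P m, offset m' = - offset m,
    [/\ tight x m, normal m = nu \/ normal m = - nu &
      forall l, l != m -> dot (@normal _ _ P l) x < offset l] &
    tight x m' /\ forall l, l != m' -> dot (@normal _ _ Q l) x < offset l].
Proof.
move=> pP pQ PQ Px Qx gP gQ.
have nP : ~ cell P x by exact: disjoint_not_cell PQ Qx.
have nQ : ~ cell Q x by apply: disjoint_not_cell Px => //; rewrite setIC.
have [m [tm mnu Hm]] := generic_facet pP Px gP nP.
have [m' [tm' mnu' Hm']] := generic_facet pQ Qx gQ nQ.
have E : normal m' = - normal m.
  have [|//] : normal m' = normal m \/ normal m' = - normal m.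
    by case: mnu mnu' => -> [] ->; rewrite ?opprK; [left|right|right|left].
  move=> E; exfalso.
  have [e e0 He] := near_line (- normal m) (filterI (cell_near pP Hm) (cell_near pQ Hm')).
  have e2 : 0 < e / 2 < e by rewrite divr_gt0//= ltr_pdivrMr// ltr_pMr// ltr1n.
  have e20 : 0 < e / 2 by case/andP: e2.
  have [_ _ P1 _ _] := pP.
  have dm : dot (normal m) (- normal m) = - 1 by rewrite dotC dotNl enorm1_dot.
  have [Pe Qe] := He _ e2.
  suff : (cell P `&` cell Q) (x + e / 2 *: - normal m) by rewrite PQ.
  split; [apply: Pe|apply: Qe].
    by rewrite dot_line dm tm mulrN1 gtrBl.
  by rewrite dot_line -tm' E dm mulrN1 gtrBl.
exists m, m'; split => //.
by rewrite -tm' -tm E dotNl.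
Qed.

End PolytopeTopology.

Section BoundedSupport.
Context {R : realType}.
Local Arguments borel_leb : simpl never.

(* bounded and measurable, with bounded support *)
Definition blb n (F : 'rV[R]_n -> R) : Prop :=
  lbm F /\ exists r, forall x, F x != 0 -> cube r x.

Lemma integrable_blb n (F : 'rV[R]_n -> R) : blb F ->
  (borel_leb n).-integrable setT (EFin \o F).
Proof.
move=> [lF [r Fr]].
have cr : in_cube (@cube R n r) by exists r.
have := integrable_lbm lF cr (@measurable_cube R n r).
rewrite (integrable_mkcond _ (@measurable_cube R n r)).
rewrite (_ : (EFin \o F) \_ (cube r) = EFin \o F)//.
apply/funext => x; rewrite patchE; case: ifPn => //= xr.
by apply/esym; congr (_%:E); apply/eqP; apply: contraNT xr => Fx; rewrite inE; exact: Fr.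
Qed.

Lemma blbD n (F G : 'rV[R]_n -> R) : blb F -> blb G -> blb (fun x => F x + G x).
Proof.
move=> [lF [r Fr]] [lG [s Gs]]; split; first exact: lbmD.
exists (Num.max r s) => x FGx i; rewrite le_max.
have [F0|F0] := eqVneq (F x) 0; last by rewrite Fr.
by rewrite (Gs x) ?orbT//; move: FGx; rewrite F0 add0r.
Qed.

Lemma blb0 n : blb (fun _ : 'rV[R]_n => 0).
Proof. by split; [exact: lbm_cst|exists 0 => x; rewrite eqxx]. Qed.

Lemma blbMl n (F G : 'rV[R]_n -> R) : lbm F -> blb G -> blb (fun x => F x * G x).
Proof.
move=> lF [lG [s Gs]]; split; first exact: lbmM.
by exists s => x; rewrite mulf_eq0 negb_or => /andP[_]; exact: Gs.
Qed.

Lemma blbZ n c (F : 'rV[R]_n -> R) : blb F -> blb (fun x => c * F x).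
Proof. by apply: blbMl; exact: lbm_cst. Qed.

Lemma blb_sum n (I : Type) (s : seq I) (P : pred I) (F : I -> 'rV[R]_n -> R) :
  (forall i, blb (F i)) -> blb (fun x => \sum_(i <- s | P i) F i x).
Proof.
move=> bF; elim: s => [|i s IH].
  by under eq_fun do rewrite big_nil; exact: blb0.
under eq_fun do rewrite big_cons.
by case: (P i) => //; exact: blbD.
Qed.

Lemma lbm_indic n (A : set 'rV[R]_n) : measurable A -> lbm (\1_A : 'rV[R]_n -> R).
Proof.
move=> mA; split; first exact: measurable_indic.
by move=> r; exists 1 => x _; rewrite indicE; case: (_ \in _); rewrite ?normr1 ?normr0.
Qed.

Lemma blb_indic n (A : set 'rV[R]_n) (F : 'rV[R]_n -> R) : measurable A -> in_cube A ->
  lbm F -> blb (fun x => \1_A x * F x).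
Proof.
move=> mA [r Ar] lF; split; first by apply: lbmM => //; exact: lbm_indic.
exists r => x; rewrite mulf_eq0 negb_or indicE => /andP[+ _].
by case: (boolP (x \in A)) => [/set_mem /Ar//|]; rewrite eqxx.
Qed.

Lemma blb_chart n (nu : 'rV[R]_n.+1) c j (F : 'rV[R]_n.+1 -> R) :
  blb F -> blb (fun y : 'rV[R]_n => F (chart nu c j y)).
Proof.
move=> [lF [r Fr]]; split; first exact: lbm_chart.
exists r => y /Fr H l; have := H (lift j l).
by rewrite chartE ins_lift.
Qed.

Lemma Rintegral_sum_blb n (I : Type) (s : seq I) (P : pred I) (F : I -> 'rV[R]_n -> R) :
  (forall i, blb (F i)) ->
  \int[borel_leb n]_x (\sum_(i <- s | P i) F i x) =
  \sum_(i <- s | P i) \int[borel_leb n]_x F i x.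
Proof.
move=> bF; elim: s => [|i s IH].
  rewrite big_nil; under eq_Rintegral do rewrite big_nil.
  by rewrite /Rintegral integral0.
rewrite big_cons; under eq_Rintegral do rewrite big_cons.
case: ifP => Pi //; rewrite RintegralD ?IH//; first exact: integrable_blb.
by apply: (integrable_blb (F := fun x => \sum_(j <- s | P j) F j x)); exact: blb_sum.
Qed.

Lemma ae_Rintegral n (F G : 'rV[R]_n -> R) : measurable_fun setT F -> measurable_fun setT G ->
  {ae borel_leb n, forall x, F x = G x} ->
  \int[borel_leb n]_x F x = \int[borel_leb n]_x G x.
Proof.
move=> mF mG FG; congr fine; apply: ae_eq_integral => //; [exact/measurable_EFinP..|].
by apply: filterS FG => x /= -> _.
Qed.

Lemma Rintegral_indic n (A : set 'rV[R]_n) (F : 'rV[R]_n -> R) :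
  \int[borel_leb n]_(x in A) F x = \int[borel_leb n]_x (\1_A x * F x).
Proof.
rewrite Rintegral_mkcond; apply: eq_Rintegral => x _.
by rewrite patchE indicE; case: (x \in A); rewrite ?mul1r ?mul0r.
Qed.

End BoundedSupport.

(** * Surface integrals and the divergence theorem *)
Section SurfaceIntegral.
Context {R : realType} {n : nat}.
Local Arguments borel_leb : simpl never.
Implicit Types (nu x : 'rV[R]_n.+1) (c : R) (G : 'rV[R]_n.+1 -> R).

(** Borel counterpart of [surface_integral]; the set of integration is encoded as an indicator
    factor of [G]. *)
Definition surfI nu c G : R :=
  if [pick j | nu 0 j != 0] is Some j then
    `|nu 0 j|^-1 * \int[borel_leb n]_y G (chart nu c j y)
  else 0.

Lemma fine_gt0M (k : R) (x : \bar R) : 0 < k -> fine (k%:E * x)%E = k * fine x.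
Proof.
by move=> k0; case: x => [x| |] //=; rewrite ?gt0_muley ?gt0_muleNy ?lte_fin//= mulr0.
Qed.

Lemma surfI_any nu c G a : nu 0 a != 0 -> measurable_fun setT G ->
  surfI nu c G = `|nu 0 a|^-1 * \int[borel_leb n]_y G (chart nu c a y).
Proof.
move=> nua mG; rewrite /surfI; case: pickP => [j nuj|/(_ a)]; last by rewrite nua.
rewrite /Rintegral -!fine_gt0M ?invr_gt0 ?normr_gt0//; congr fine.
by apply: (chart_indep c nuj nua (G := EFin \o G)); exact/measurable_EFinP.
Qed.

Lemma surfI_opp nu c G : measurable_fun setT G -> surfI (- nu) (- c) G = surfI nu c G.
Proof.
move=> mG; rewrite {2}/surfI; case: pickP => [j nuj|nu0].
  rewrite (surfI_any _ (a := j))//; last by rewrite mxE oppr_eq0.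
  rewrite mxE normrN; congr (_ * _); apply: eq_Rintegral => y _; congr G.
  rewrite !chartE; congr ins; rewrite (_ : delrow j (- nu) = - delrow j nu).
    by rewrite dotNl mxE -opprB opprK invrN mulrN mulNr opprK addrC.
  by apply/rowP => l; rewrite !mxE.
rewrite /surfI; case: pickP => // j; rewrite mxE oppr_eq0.
by move=> nuj; have := nu0 j; rewrite nuj.
Qed.

Lemma surfI_sum (I : Type) (s : seq I) (P : pred I) nu c (G : I -> 'rV[R]_n.+1 -> R) :
  (forall i, blb (G i)) ->
  surfI nu c (fun x => \sum_(i <- s | P i) G i x) = \sum_(i <- s | P i) surfI nu c (G i).
Proof.
move=> bG; rewrite /surfI; case: pickP => [j nuj|_]; last by rewrite big1.
rewrite Rintegral_sum_blb ?mulr_sumr// => i; exact: blb_chart.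
Qed.

Lemma surfID nu c G1 G2 : blb G1 -> blb G2 ->
  surfI nu c (fun x => G1 x + G2 x) = surfI nu c G1 + surfI nu c G2.
Proof.
move=> b1 b2; rewrite /surfI; case: pickP => [j nuj|_]; last by rewrite addr0.
by rewrite RintegralD ?mulrDr//; apply: (integrable_blb (blb_chart nu c j _)).
Qed.

Lemma surfIZ nu c k G : blb G -> surfI nu c (fun x => k * G x) = k * surfI nu c G.
Proof.
move=> bG; rewrite /surfI; case: pickP => [j nuj|_]; last by rewrite mulr0.
have iG := integrable_blb (blb_chart nu c j bG).
by rewrite (RintegralZl k measurableT iG) mulrCA.
Qed.

(** In the chart the equation is again linear, with coefficient vector [b]. If [b] vanished, [nu']
    would be a multiple of [nu], hence [nu] or [- nu] because both have norm one. *)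
Lemma chart_null nu c a (nu' : 'rV[R]_n.+1) c' : nu 0 a != 0 ->
  enorm nu = 1 -> enorm nu' = 1 -> nu' <> nu -> nu' <> - nu ->
  borel_leb n [set y | dot nu' (chart nu c a y) = c'] = 0%E.
Proof.
move=> nua n1 n1' d1 d2.
pose b := delrow a nu' + (- (nu' 0 a / nu 0 a)) *: delrow a nu.
rewrite (_ : [set y | _] = [set y | dot b y = c' - nu' 0 a * c / nu 0 a]).
  apply: hyperplane_null; left; apply/eqP => b0.
  pose k := nu' 0 a / nu 0 a.
  have E : nu' = k *: nu.
    apply/rowP => i; rewrite mxE; case: (unliftP a i) => [l|] ->; last by rewrite /k divfK.
    have := congr1 (fun r : 'rV[R]_n => r 0 l) b0; rewrite !mxE mulNr => /eqP.
    by rewrite subr_eq0 => /eqP.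
  have k2 : k ^+ 2 = 1.
    have := enorm1_dot n1'; rewrite E.
    have -> : dot (k *: nu) (k *: nu) = k ^+ 2 * dot nu nu.
      by rewrite /dot mulr_sumr; apply: eq_bigr => i _; rewrite !mxE; ring.
    by rewrite enorm1_dot// mulr1.
  move/eqP: k2; rewrite sqrf_eq1 => /orP[] /eqP k1.
    by apply: d1; rewrite E k1 scale1r.
  by apply: d2; rewrite E k1 scaleN1r.
have db y : dot b y = dot (delrow a nu') y - (nu' 0 a / nu 0 a) * dot (delrow a nu) y.
  by rewrite (dotC b) dot_line !(dotC y) mulNr.
apply/seteqP; split => y /=; rewrite chartE dot_ins -/(delrow a nu') db.
  move=> <-; ring.
move=> E; have -> : c' = dot (delrow a nu') y - (nu' 0 a / nu 0 a) * dot (delrow a nu) y +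
  nu' 0 a * c / nu 0 a by rewrite E; ring.
ring.
Qed.

Lemma measurable_chart_eq nu c a (nu' : 'rV[R]_n.+1) c' :
  measurable ([set y | dot nu' (chart nu c a y) = c'] : set 'rV[R]_n).
Proof.
rewrite -[X in measurable X]setTI.
exact: (@measurable_chart R n nu c a measurableT _ (measurable_dot_eq nu' c')).
Qed.

Lemma ae_generic (I : finType) (P : I -> polytope R n.+1) nu c a : nu 0 a != 0 ->
  enorm nu = 1 -> (forall i l, enorm (@normal _ _ (P i) l) = 1) ->
  {ae borel_leb n, forall y, forall i, generic (P i) nu (chart nu c a y)}.
Proof.
move=> nua n1 P1.
apply: (@filter_fin _ _ _ _ (fun i y => generic (P i) nu (chart nu c a y))) => i.
apply: (@filter_fin _ _ _ _ (fun m y => tight (chart nu c a y) m ->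
  @normal _ _ (P i) m = nu \/ normal m = - nu)) => m.
have [E|d1] := pselect (@normal _ _ (P i) m = nu); first by apply: filterE => y _; left.
have [E|d2] := pselect (@normal _ _ (P i) m = - nu); first by apply: filterE => y _; right.
exists [set y | dot (@normal _ _ (P i) m) (chart nu c a y) = offset m]; split.
- exact: measurable_chart_eq.
- exact: chart_null.
- move=> y /= /not_implyP[]//.
Qed.

Lemma eq_surfI (I : finType) (P : I -> polytope R n.+1) nu c G1 G2 :
  enorm nu = 1 -> (forall i l, enorm (@normal _ _ (P i) l) = 1) ->
  measurable_fun setT G1 -> measurable_fun setT G2 ->
  (forall x, dot nu x = c -> (forall i, generic (P i) nu x) -> G1 x = G2 x) ->
  surfI nu c G1 = surfI nu c G2.
Proof.
move=> n1 P1 mG1 mG2 G12; rewrite /surfI; case: pickP => // j nuj; congr (_ * _).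
apply: ae_Rintegral.
- by apply: measurableT_comp => //; exact: measurable_chart.
- by apply: measurableT_comp => //; exact: measurable_chart.
apply: filterS (ae_generic c nuj n1 P1) => y gy; apply: G12 => //.
exact: dot_chart.
Qed.

Lemma ae_leb k (Q : 'rV[R]_k -> Prop) : {ae borel_leb k, forall y, Q y} ->
  {ae leb k, forall y, Q y}.
Proof.
move=> [N [mN N0 QN]]; exists N; split => //; first exact: measurable_lebT.
by rewrite leb_borelE.
Qed.

(** [A] and [B] differ by subsets of a Borel null set, which are measurable because [leb] is
    complete. *)
Lemma ae_eq_measurable_leb k (A B : set 'rV[R]_k) : measurable B ->
  {ae borel_leb k, forall y, A y <-> B y} -> measurable (A : set (lebT R k)).
Proof.
move=> mB [N [mN N0 QN]].
have sub C : C `<=` N -> measurable (C : set (lebT R k)).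
  by move=> CN; exact: (negligible_lebT mN N0 CN).1.
rewrite (_ : A = (B `|` (A `\` B)) `\` (B `\` A)).
  apply: measurableD; first apply: measurableU; first exact: measurable_lebT.
    by apply: sub => y [Ay nBy]; apply: QN => /= -[/(_ Ay)].
  by apply: sub => y [By nAy]; apply: QN => /= -[_ /(_ By)].
apply/seteqP; split => y.
  by move=> Ay; split; [have [By|nBy] := pselect (B y); [left|right]|case].
by move=> [[By nBA|[]//]]; apply: contrapT => nA; exact: nBA.
Qed.

(** Meant for [A] a [face_set], given by frontiers, and [B] an explicit Borel set with the same
    generic points. *)
Lemma surface_integral_surfI (I : finType) (P : I -> polytope R n.+1) nu c
    (A B : set 'rV[R]_n.+1) G :
  enorm nu = 1 -> (forall i l, enorm (@normal _ _ (P i) l) = 1) ->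
  measurable B -> in_cube B -> lbm G ->
  (forall x, dot nu x = c -> (forall i, generic (P i) nu x) -> A x <-> B x) ->
  fine (surface_integral nu c A (EFin \o G)) = surfI nu c (fun x => \1_B x * G x).
Proof.
move=> n1 P1 mB bB lG AB; rewrite /surface_integral /surfI; case: pickP => // j nuj.
rewrite fine_gt0M ?invr_gt0 ?normr_gt0//; congr (_ * fine _).
have ae : {ae borel_leb n, forall y, A (chart nu c j y) <-> B (chart nu c j y)}.
  apply: filterS (ae_generic c nuj n1 P1) => y gy; apply: AB => //.
  exact: dot_chart.
have mGB : measurable_fun setT (fun y : 'rV[R]_n => (\1_B (chart nu c j y) * G (chart nu c j y))%:E : \bar R).
  apply/measurable_EFinP.
  exact: (blb_chart nu c j (blb_indic mB bB lG)).1.1.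
rewrite -(integral_leb measurableT mGB) integral_mkcond.
have mcB : measurable ((chart nu c j : 'rV[R]_n -> 'rV[R]_n.+1) @^-1` B).
  by rewrite -[X in measurable X]setTI; exact: (@measurable_chart R n nu c j measurableT _ mB).
have mcA : measurable (chart nu c j @^-1` A : set (lebT R n)).
  exact: (ae_eq_measurable_leb mcB).
apply: ae_eq_integral => //.
- apply/(measurable_restrict _ mcA measurableT).
  apply: measurable_funTS; apply/measurable_EFinP; apply: measurable_fun_lebT.
  exact: (lbm_chart nu c j lG).1.
- exact: measurable_fun_lebT.
have [N [mN N0 sub]] := ae_leb ae; exists N; split; [exact: mN|exact: N0|move=> y /= H; apply: sub => /= AyBy].
apply: H => _; rewrite patchE indicE.
have [Ay|nAy] := pselect (A (chart nu c j y)).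
  by rewrite mem_set// (mem_set (AyBy.1 Ay)) mul1r.
by rewrite memNset// memNset ?mul0r// => /AyBy.2.
Qed.

End SurfaceIntegral.

(** * The divergence theorem on a polytope, one coordinate at a time *)

Section Divergence.
Context {R : realType} {n : nat}.
Local Arguments borel_leb : simpl never.
Local Notation mu := (@lebesgue_measure R).
Implicit Types (P : polytope R n.+1).

Lemma measurable_body d (P : polytope R d) : measurable (body P).
Proof.
rewrite (_ : body P = \bigcap_(l : 'I_(nfacets P)) [set x | dot (normal l) x <= offset l]).
  rewrite bigcap_mkcond; apply: fin_bigcap_measurable => // l _; case: ifP => // _.
  rewrite -[X in measurable X]setTI.
  rewrite (_ : [set x | _] = dot (normal l) @^-1` `]-oo, offset l]).
    exact: (measurable_dot (normal l) measurableT (measurable_itv _)).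
  by apply/seteqP; split => x /=; rewrite in_itv.
by apply/seteqP; split => x H l; [move=> _|]; have := H l => //; apply.
Qed.

Lemma measurable_cell d (P : polytope R d) : proper_polytope P -> measurable (cell P).
Proof.
move=> pP; rewrite cellE//.
rewrite (_ : [set x | _] = \bigcap_(l : 'I_(nfacets P)) [set x | dot (normal l) x < offset l]).
  rewrite bigcap_mkcond; apply: fin_bigcap_measurable => // l _; case: ifP => // _.
  rewrite -[X in measurable X]setTI.
  rewrite (_ : [set x | _] = dot (normal l) @^-1` `]-oo, offset l[).
    exact: (measurable_dot (normal l) measurableT (measurable_itv _)).
  by apply/seteqP; split => x /=; rewrite in_itv.
by apply/seteqP; split => x H l; [move=> _|]; have := H l => //; apply.
Qed.

Lemma measurable_facet d (P : polytope R d) l : measurable (@facet _ _ P l).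
Proof. by apply: measurableI; [exact: measurable_body|exact: measurable_dot_eq]. Qed.

Lemma in_cube_bounded d (A : set 'rV[R]_d) : bounded_set A -> in_cube A.
Proof.
move=> [M [_ HM]]; exists (M + 1) => x Ax i.
have := HM (M + 1) _ x Ax; rewrite ltrDl ltr01 => /(_ isT); apply: le_trans.
rewrite [leRHS]/Num.norm/= mx_normrE; exact: (le_bigmax _ (fun ij => `|x ij.1 ij.2|) (ord0, i)).
Qed.

Lemma in_cube_body d (P : polytope R d) : proper_polytope P -> in_cube (body P).
Proof. by case=> bP _ _ _ _; exact: in_cube_bounded. Qed.

Lemma in_cube_cell d (P : polytope R d) : proper_polytope P -> in_cube (cell P).
Proof. by move=> pP; apply: in_cubeS (in_cube_body pP); exact: cell_body. Qed.

Lemma in_cube_facet d (P : polytope R d) l : proper_polytope P -> in_cube (@facet _ _ P l).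
Proof. by move=> pP; apply: in_cubeS (in_cube_body pP) => x []. Qed.

Section OneCoordinate.
Variables (P : polytope R n.+1) (a : 'I_n.+1).
Hypothesis pP : proper_polytope P.
Let na (l : 'I_(nfacets P)) : R := normal l 0 a.
(** The parameter at which the line over [y] in direction [a] crosses the hyperplane of facet [l];
    meaningful for [na l != 0]. *)
Let T (y : 'rV[R]_n) (l : 'I_(nfacets P)) : R := (offset l - dot (delrow a (normal l)) y) / na l.

Let chartT y l : chart (normal l) (offset l) a y = ins a (T y l) y.
Proof. exact: chartE. Qed.

Let dot_delta (nu : 'rV[R]_n.+1) : dot nu (delta_mx 0 a) = nu 0 a.
Proof.
rewrite /dot (bigD1 a)//= big1 ?addr0 ?mxE ?eqxx ?mulr1// => i /negbTE ia.
by rewrite mxE eqxx ia mulr0.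
Qed.

Let facet_strict y l : na l != 0 -> generic P (normal l) (chart (normal l) (offset l) a y) ->
  body P (chart (normal l) (offset l) a y) ->
  forall m, m != l -> dot (normal m) (chart (normal l) (offset l) a y) < offset m.
Proof.
move=> nal g b; have tl : tight (chart (normal l) (offset l) a y) l by exact: dot_chart.
have nc : ~ cell P (chart (normal l) (offset l) a y).
  by rewrite cellE// => /(_ l); rewrite tl ltxx.
have [m [tm _ Hm]] := generic_facet pP b g nc.
suff E : m = l by rewrite E in Hm.
by apply/esym/eqP; apply: contrapT => /negP /Hm; rewrite tl ltxx.
Qed.

Let ltT y l t : 0 < na l -> (dot (normal l) (ins a t y) < offset l) = (t < T y l).
Proof.
by move=> n0; rewrite dot_ins -/(delrow a (normal l)) /T ltr_pdivlMr// ltrBrDr mulrC.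
Qed.

Let gtT y l t : na l < 0 -> (dot (normal l) (ins a t y) < offset l) = (T y l < t).
Proof.
by move=> n0; rewrite dot_ins -/(delrow a (normal l)) /T ltr_ndivrMr// ltrBrDr mulrC.
Qed.

Let leT y l t : 0 < na l -> (dot (normal l) (ins a t y) <= offset l) = (t <= T y l).
Proof.
by move=> n0; rewrite dot_ins -/(delrow a (normal l)) /T ler_pdivlMr// lerBrDr mulrC.
Qed.

Let geT y l t : na l < 0 -> (dot (normal l) (ins a t y) <= offset l) = (T y l <= t).
Proof.
by move=> n0; rewrite dot_ins -/(delrow a (normal l)) /T ler_ndivrMr// lerBrDr mulrC.
Qed.

Let zeroT y l t s : na l = 0 -> dot (normal l) (ins a t y) = dot (normal l) (ins a s y).
Proof. by move=> n0; rewrite !dot_ins -/(na l) n0 !mul0r. Qed.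

(** If no facet bounded the cell from above in direction [a], the line would stay in the cell
    forever; the shift by |t0| + |r| + 1 already leaves the cube of radius [r]. *)
Let exists_pos y t0 : cell P (ins a t0 y) -> exists l, 0 < na l.
Proof.
move=> c0; apply: contrapT => /forallNP H.
have [r Hr] := in_cube_cell pP.
have : cell P (ins a (t0 + (`|t0| + `|r| + 1)) y).
  move: c0; rewrite cellE// => c0 l; apply: le_lt_trans (c0 l).
  rewrite insD dot_line dot_delta gerDl.
  apply: mulr_ge0_le0; first by rewrite !addr_ge0.
  by rewrite leNgt; apply/negP; exact: H.
move=> /Hr /(_ a); rewrite ins_at; apply/negP; rewrite -ltNge.
apply: (@lt_le_trans _ _ (`|r| + 1)); first by rewrite ltr_pwDr// ler_norm.
rewrite ler_normr; apply/orP; left; rewrite -subr_ge0.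
rewrite (_ : _ - _ = t0 + `|t0|); last by ring.
by rewrite -lerBlDl sub0r; by rewrite -normrN ler_norm.
Qed.

Let exists_neg y t0 : cell P (ins a t0 y) -> exists l, na l < 0.
Proof.
move=> c0; apply: contrapT => /forallNP H.
have [r Hr] := in_cube_cell pP.
have : cell P (ins a (t0 + - (`|t0| + `|r| + 1)) y).
  move: c0; rewrite cellE// => c0 l; apply: le_lt_trans (c0 l).
  rewrite insD dot_line dot_delta gerDl.
  apply: mulr_le0_ge0; first by rewrite oppr_le0 !addr_ge0.
  by rewrite leNgt; apply/negP; exact: H.
move=> /Hr /(_ a); rewrite ins_at; apply/negP; rewrite -ltNge.
apply: (@lt_le_trans _ _ (`|r| + 1)); first by rewrite ltr_pwDr// ler_norm.
rewrite ler_normr; apply/orP; right; rewrite -subr_ge0.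
rewrite (_ : _ - _ = `|t0| - t0); last by ring.
by rewrite subr_ge0 ler_norm.
Qed.

Variables (u w : 'rV[R]_n.+1 -> R).
Hypotheses (lu : lbm u) (lw : lbm w).
Hypothesis du : forall y (t : R), is_derive t (1 : R) (fun s => u (ins a s y)) (w (ins a t y)).
Hypothesis cw : forall y, continuous (fun t => w (ins a t y)).

Let ftc y (lo hi : R) : lo < hi ->
  (\int[mu]_(t in `]lo, hi[) (w (ins a t y))%:E)%E = (u (ins a hi y) - u (ins a lo y))%:E.
Proof.
move=> lohi.
have mwy : measurable_fun `]lo, hi[ (fun t => (w (ins a t y))%:E : \bar R).
  apply/measurable_EFinP; apply: measurable_funTS.
  exact: continuous_measurable_fun.
rewrite -(integral_itv_bndoo true false mwy) EFinB.
have du' t : derivable (fun s => u (ins a s y)) t 1 by have [] := du y t.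
apply: (@continuous_FTC2 _ (fun t => w (ins a t y)) (fun t => u (ins a t y))) => //.
- by apply: continuous_subspaceT => t; exact: cw.
- split => [t _|//|//]; first exact: du'.
  + apply: cvg_at_right_filter; apply: differentiable_continuous.
    exact/derivable1_diffP.
  + apply: cvg_at_left_filter; apply: differentiable_continuous.
    exact/derivable1_diffP.
- by move=> t _; rewrite derive1E; exact: derive_val.
Qed.

(** By convexity the line meets the cell in an open interval, possibly empty. Its ends lie on one
    facet with positive and one with negative [na], where the signs turn the sum into the difference
    of the end values of [u]. *)
Let line_integral y :
  (forall l, na l != 0 -> generic P (normal l) (chart (normal l) (offset l) a y)) ->
  (\int[mu]_t (\1_(cell P) (ins a t y) * w (ins a t y))%:E)%E =
  (\sum_l Num.sg (na l) * (\1_(facet l) (chart (normal l) (offset l) a y) *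
       u (chart (normal l) (offset l) a y)))%:E.
Proof.
move=> gen.
have facetE (l : 'I_(nfacets P)) : na l != 0 -> body P (chart (normal l) (offset l) a y) ->
    \1_(facet l) (chart (normal l) (offset l) a y) = 1 :> R.
  by move=> nal b; rewrite indicE mem_set//; split => //; exact: dot_chart.
have nfacetE (l : 'I_(nfacets P)) : ~ body P (chart (normal l) (offset l) a y) ->
    \1_(facet l) (chart (normal l) (offset l) a y) = 0 :> R.
  by move=> nb; rewrite indicE memNset// => -[].
have [[t0 c0]|nS] := pselect (exists t, cell P (ins a t y)); last first.
  rewrite integral0_eq; last first.
    by move=> t _; rewrite indicE memNset ?mul0r// => c; apply: nS; exists t.
  rewrite big1// => l _; have [n0|nl0] := eqVneq (na l) 0.
    by rewrite n0 sgr0 mul0r.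
  have [b|nb] := pselect (body P (chart (normal l) (offset l) a y)); last first.
    by rewrite nfacetE// mul0r mulr0.
  (* A line that crosses a facet at a generic point enters the cell: near that point the cell is a
     half-space, and the direction [- na l *: delta_mx 0 a] has scalar product minus the square of
     [na l] with the normal. *)
  exfalso; apply: nS.
  have Hs := facet_strict nl0 (gen l nl0) b.
  have [e e0 He] := near_line (- na l *: delta_mx 0 a) (cell_near pP Hs).
  have e2 : 0 < e / 2 < e by rewrite divr_gt0//= ltr_pdivrMr// ltr_pMr// ltr1n.
  exists (T y l + e / 2 * - na l).
  have -> : ins a (T y l + e / 2 * - na l) y =
     chart (normal l) (offset l) a y + (e / 2) *: (- na l *: delta_mx 0 a).
    by rewrite chartT insD scalerA.
  apply: He => //; rewrite dot_line dot_chart// gtrDl.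
  rewrite -[X in dot _ X]add0r dot_line dot_delta (_ : dot _ 0 = 0).
    rewrite add0r -/(na l) mulNr mulrN oppr_lt0 mulr_gt0//; first by case/andP: e2.
    by rewrite -expr2 exprn_even_gt0.
  by rewrite /dot big1// => i _; rewrite mxE mulr0.
have [l1 p1] := exists_pos c0; have [l2 p2] := exists_neg c0.
(* The upper end is the lowest crossing among the facets with [na l > 0], the lower end the highest
   crossing among those with [na l < 0]. *)
have [lp plp Hp] := @arg_minP _ _ _ l1 (fun l => 0 < na l) (T y) p1.
have [lm plm Hm] := @arg_maxP _ _ _ l2 (fun l => na l < 0) (T y) p2.
have {}c0 : forall l : 'I_(nfacets P), dot (normal l) (ins a t0 y) < offset l.
  by move: c0; rewrite cellE.
have lmt : T y lm < t0 by rewrite -gtT.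
have tlp : t0 < T y lp by rewrite -ltT.
have lohi : T y lm < T y lp by exact: lt_trans tlp.
have Scell t : cell P (ins a t y) <-> t \in `]T y lm, T y lp[.
  rewrite cellE// in_itv/=; split => [H|/andP[h1 h2] l /=].
    by rewrite -gtT// -ltT// !H.
  have [n0|n0|n0] := ltgtP (na l) 0.
  - by rewrite gtT//; apply: le_lt_trans h1; exact: Hm.
  - by rewrite ltT//; apply: lt_le_trans h2 _; exact: Hp.
  - by rewrite (zeroT y t t0 n0); exact: c0.
have nlp : na lp != 0 by rewrite gt_eqF.
have nlm : na lm != 0 by rewrite lt_eqF.
have bp : body P (chart (normal lp) (offset lp) a y).
  rewrite chartT => l; have [n0|n0|n0] := ltgtP (na l) 0.
  - by apply: ltW; rewrite gtT//; apply: le_lt_trans lohi; exact: Hm.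
  - by rewrite leT//; exact: Hp.
  - by apply: ltW; rewrite (zeroT y _ t0 n0); exact: c0.
have bm : body P (chart (normal lm) (offset lm) a y).
  rewrite chartT => l; have [n0|n0|n0] := ltgtP (na l) 0.
  - by rewrite geT//; exact: Hm.
  - by apply: ltW; rewrite ltT//; apply: lt_le_trans lohi _; exact: Hp.
  - by apply: ltW; rewrite (zeroT y _ t0 n0); exact: c0.
rewrite (bigD1 lp)//= (bigD1 lm)/=; last by apply/eqP => E; move: plm; rewrite E ltNge ltW.
rewrite big1 ?addr0; last first.
  (* Any further facet hit inside the body would satisfy the inequalities of [lm] and [lp] strictly,
     against the extremality of these two. *)
  move=> l /andP[llp llm].
  have [n0|nl0] := eqVneq (na l) 0; first by rewrite n0 sgr0 mul0r.
  rewrite nfacetE ?mul0r ?mulr0// => b; have Hs := facet_strict nl0 (gen l nl0) b.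
  have [n0|n0|n0] := ltgtP (na l) 0; last by rewrite n0 eqxx in nl0.
    have := Hs lm; rewrite eq_sym llm chartT gtT// => /(_ isT).
    by rewrite ltNge; move/negP; apply; exact: Hm.
  have := Hs lp; rewrite eq_sym llp chartT ltT// => /(_ isT).
  by rewrite ltNge; move/negP; apply; exact: Hp.
rewrite !facetE// !mul1r gtr0_sg// ltr0_sg// mul1r mulN1r !chartT -ftc//.
rewrite [RHS]integral_mkcond; apply: eq_integral => t _; rewrite patchE indicE.
have [/Scell c|nc] := boolP (t \in `]T y lm, T y lp[).
  by rewrite mem_set// mem_set ?mul1r//; exact/Scell.
by rewrite memNset ?mul0r ?memNset//; [exact/negP|move=> /Scell; exact/negP].
Qed.

Lemma divergence_coord :
  \int[leb n.+1]_(x in cell P) w x =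
  \sum_(l < nfacets P) normal l 0 a * surfI (normal l) (offset l) (fun x => \1_(facet l) x * u x).
Proof.
have [_ _ P1 _ _] := pP.
have mc := measurable_cell pP.
have bw : blb (fun x => \1_(cell P) x * w x).
  by apply: blb_indic => //; exact: in_cube_cell.
have bu l : blb (fun x => \1_(@facet _ _ P l) x * u x).
  by apply: blb_indic => //; [exact: measurable_facet|exact: in_cube_facet].
have -> : \int[leb n.+1]_(x in cell P) w x = \int[borel_leb n.+1]_x (\1_(cell P) x * w x).
  rewrite -Rintegral_indic /Rintegral integral_leb//.
  by apply/measurable_EFinP; apply: measurable_funTS; exact: lw.1.
have bu' l : blb (fun y => Num.sg (na l) *
    (\1_(@facet _ _ P l) (chart (normal l) (offset l) a y) * u (chart (normal l) (offset l) a y))).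
  by apply: blbZ; exact: (blb_chart (normal l) (offset l) a (bu l)).
transitivity (\int[borel_leb n]_y (\sum_(l < nfacets P) Num.sg (na l) *
    (\1_(facet l) (chart (normal l) (offset l) a y) * u (chart (normal l) (offset l) a y)))).
  congr fine; rewrite (fubini_ins a (integrable_blb bw)).
  apply: ae_eq_integral => //.
  - exact: (measurable_line_integral a (integrable_blb bw)).
  - by apply/measurable_EFinP; exact: (blb_sum _ _ bu').1.1.
  have : {ae borel_leb n, forall y, forall l, na l != 0 ->
      generic P (normal l) (chart (normal l) (offset l) a y)}.
    apply: (@filter_fin _ _ _ _ (fun l y => na l != 0 ->
      generic P (normal l) (chart (normal l) (offset l) a y))) => l.
    have [n0|nl0] := eqVneq (na l) 0; first exact: filterE.
    apply: filterS (@ae_generic R n unit (fun=> P) _ (offset l) a nl0 (P1 l) (fun=> P1)) => y gy _.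
    exact: gy tt.
  by apply: filterS => y gy _; exact: line_integral.
rewrite (Rintegral_sum_blb _ _ bu'); apply: eq_bigr => l _.
rewrite (RintegralZl _ measurableT); last first.
  exact: (integrable_blb (blb_chart (normal l) (offset l) a (bu l))).
(* Facets parallel to direction [a] give zero on both sides. For the others the chart solved for
   coordinate [a] has density 1/|na l|, and multiplying it by [na l] leaves the sign. *)
have [n0|nl0] := eqVneq (na l) 0; first by rewrite -/(na l) n0 sgr0 !mul0r.
rewrite (surfI_any _ nl0); last exact: (bu l).1.1.
by rewrite mulrA; congr (_ * _); rewrite -/(na l) {2}[na l]numEsg mulfK ?normr_eq0.
Qed.

End OneCoordinate.
End Divergence.

(** * Facets of the elements and faces of the mesh *)
Section MeshGeometry.
Context {R : realType} {n : nat} {M : mesh R n.+1} (Omega : set 'rV[R]_n.+1).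
Hypotheses (hOmega : polygonal_domain Omega) (hM : mesh_of Omega M).
Implicit Types (i j : 'I_(nelem M)) (x y : 'rV[R]_n.+1).

Let pT i : proper_polytope (elem i) := let: And3 h _ _ := hM in h i.

Let clO : closure Omega = \bigcup_(i : 'I_(nelem M)) body (elem i) :=
  let: And3 _ h _ := hM in h.

Let cellT i j : i != j -> cell (elem i) `&` cell (elem j) = set0 :=
  let: And3 _ _ h := hM in h i j.

Let openO : open Omega := let: And5 h _ _ _ _ := hOmega in h.

Lemma elem_unit i (l : 'I_(nfacets (elem i))) : enorm (normal l) = 1.
Proof. by have [_ _ ->] := pT i. Qed.

Lemma body_closure i : body (elem i) `<=` closure Omega.
Proof. by rewrite clO => x ix; exists i. Qed.

(** [Omega] is the interior of a finite union of bodies. This union is closed, so it contains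
    [closure Omega], and an open subset of it lies in its interior. *)
Lemma closure_polygonal (A : set 'rV[R]_n.+1) : open A -> A `<=` closure Omega -> A `<=` Omega.
Proof.
move=> oA AO; have [_ _ _ _ [m [P [_ PE]]]] := hOmega.
have cU : closed (\bigcup_i body (P i)).
  rewrite (_ : \bigcup_i body (P i) = \big[setU/set0]_(i <- enum 'I_m) body (P i)).
    by apply: closed_bigsetU => i _; exact: closed_body.
  rewrite -bigcup_seq; apply/seteqP; split => x [i _ Cx]; exists i => //=.
  by rewrite mem_enum.
rewrite PE -open_subsetE//; apply: subset_trans AO _.
rewrite [X in _ `<=` X](closure_id _).1//; apply: closureS.
by rewrite PE; exact: interior_subset.
Qed.

Lemma cell_Omega i : cell (elem i) `<=` Omega.
Proof.
apply: closure_polygonal; first exact: cell_open.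
by apply: subset_trans (@body_closure i); exact: cell_body.
Qed.

Lemma frontier_Omega : frontier Omega = closure Omega `\` Omega.
Proof. by rewrite /frontier (interior_id _).1. Qed.

Let gen (nu x : 'rV[R]_n.+1) := forall i, generic (elem i) nu x.

Lemma facet_others j (l : 'I_(nfacets (elem j))) x : facet l x ->
  gen (normal l) x -> forall m, m != l -> dot (normal m) x < offset m.
Proof.
move=> [bx tx] gx.
have nc : ~ cell (elem j) x by rewrite cellE// => /(_ l); rewrite tx ltxx.
have [m [tm _ Hm]] := generic_facet (pT j) bx (gx j) nc.
suff E : m = l by rewrite E in Hm.
by apply/esym/eqP; apply: contrapT => /negP /Hm; rewrite tx ltxx.
Qed.

Lemma neighbour j (l : 'I_(nfacets (elem j))) i x : i != j -> facet l x ->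
  gen (normal l) x -> body (elem i) x ->
  exists l' : 'I_(nfacets (elem i)), [/\ normal l' = - normal l, offset l' = - offset l,
    dot (normal l') x = offset l' &
    forall m, m != l' -> dot (normal m) x < offset m].
Proof.
move=> ij [bx tx] gx ix; have ji : j != i by rewrite eq_sym.
have [m [m' [nn oo [tm _ Hm] [tm' Hm']]]] :=
  disjoint_facets (pT j) (pT i) (cellT ji) bx ix (gx j) (gx i).
have ml : m = l.
  by apply/esym/eqP; apply: contrapT => /negP /Hm; rewrite tx ltxx.
by exists m'; rewrite -ml.
Qed.

(** Two different neighbours across [l] would both have the normal opposite to that of [l]; but
    their cells are disjoint too, so these equal normals would also be opposite, which a unit vector
    does not allow. *)
Lemma neighbour_unique j (l : 'I_(nfacets (elem j))) i i' x : i != j -> i' != j ->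
  facet l x -> gen (normal l) x -> body (elem i) x -> body (elem i') x -> i = i'.
Proof.
move=> ij i'j fx gx ix i'x; apply/eqP; apply: contrapT => /negP ii'.
have [l1 [n1 _ _ H1]] := neighbour ij fx gx ix.
have [l2 [n2 _ _ H2]] := neighbour i'j fx gx i'x.
have [m [m' [nn _ [tm _ _] [tm' _]]]] :=
  disjoint_facets (pT i) (pT i') (cellT ii') ix i'x (gx i) (gx i').
have ml : m = l1.
  by apply/eqP; apply: contrapT => /negP /H1; rewrite tm ltxx.
have ml' : m' = l2.
  by apply/eqP; apply: contrapT => /negP /H2; rewrite tm' ltxx.
move: nn; rewrite ml ml' n1 n2 opprK => nn.
have [a na] := unit_coord (elem_unit l).
have := congr1 (fun r : 'rV[R]_n.+1 => r 0 a) nn; rewrite mxE => /eqP.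
by rewrite eqNr (negbTE na).
Qed.

Lemma near_not_bodies j x : (forall i, i != j -> ~ body (elem i) x) ->
  \forall y \near x, forall i, i != j -> ~ body (elem i) y.
Proof.
move=> H; apply: (@filter_fin _ (nbhs x) _ _ (fun i y => i != j -> ~ body (elem i) y)) => i.
have [->|ij] := eqVneq i j; first by apply: (@filterE _ (nbhs x)) => y.
have := closed_body (P := elem i); rewrite -openC openE => /(_ x (H i ij)).
by apply: filterS => y.
Qed.

(** If [x] were in the open set [Omega], the points near it would be covered by bodies; the other
    bodies are closed and stay away, so [x] would be interior to the body of its own element. *)
Lemma facet_frontier j (l : 'I_(nfacets (elem j))) x : facet l x ->
  (forall i, i != j -> ~ body (elem i) x) -> frontier Omega x.
Proof.
move=> [bx tx] H; rewrite frontier_Omega; split; first exact: body_closure bx.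
move=> Ox; suff : cell (elem j) x by rewrite cellE// => /(_ l); rewrite tx ltxx.
have nO : \forall y \near x, Omega y by exact: open_nbhs_nbhs.
apply: filterS2 nO (near_not_bodies H) => y Oy Hy.
have : closure Omega y by exact: subset_closure.
rewrite clO => -[i _ iy]; have [<-//|ij] := eqVneq i j.
by have := Hy i ij.
Qed.

Lemma near_neighbour j (l : 'I_(nfacets (elem j))) i x : i != j -> facet l x ->
  gen (normal l) x -> body (elem i) x ->
  \forall y \near x, (dot (normal l) y <= offset l -> body (elem j) y) /\
    (offset l <= dot (normal l) y -> body (elem i) y).
Proof.
move=> ij fx gx ix; have [l' [nn oo _ Hl']] := neighbour ij fx gx ix.
apply: filterS2 (body_near (facet_others fx gx)) (body_near Hl') => y Hj Hi.
by split=> // Hy; apply: Hi; rewrite nn oo dotNl lerN2.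
Qed.

(** The two bodies fill the two half-spaces near [x], so [x] is interior to [closure Omega]; by
    [closure_polygonal] it then belongs to [Omega]. *)
Lemma frontier_no_neighbour j (l : 'I_(nfacets (elem j))) i x : i != j -> facet l x ->
  gen (normal l) x -> body (elem i) x -> ~ frontier Omega x.
Proof.
move=> ij fx gx ix; rewrite frontier_Omega => -[_]; apply.
suff : (closure Omega)° x.
  by apply: closure_polygonal; [exact: open_interior|exact: interior_subset].
apply: filterS (near_neighbour ij fx gx ix) => y [Hj Hi].
have [h|/ltW h] := leP (dot (normal l) y) (offset l).
  by apply: body_closure (Hj h).
by apply: body_closure (Hi h).
Qed.

Definition interior_code j (l : 'I_(nfacets (elem j))) i : face M :=
  Tagged (fun j => ('I_(nfacets (elem j)) * option 'I_(nelem M))%type) (l, Some i).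

Definition boundary_code j (l : 'I_(nfacets (elem j))) : face M :=
  Tagged (fun j => ('I_(nfacets (elem j)) * option 'I_(nelem M))%type) (l, None).

(** One generic common point suffices: opposite inequalities confine the intersection of the two
    bodies to the hyperplane, and near [x] each body fills its half-space, so all nearby points of
    the hyperplane are common. *)
Lemma interior_face_ok j (l : 'I_(nfacets (elem j))) i x : i != j -> facet l x ->
  gen (normal l) x -> body (elem i) x -> face_ok Omega (interior_code l i).
Proof.
move=> ij fx gx ix; have [l' [nn oo tl' Hl']] := neighbour ij fx gx ix.
have opp y : body (elem j) y -> body (elem i) y -> dot (normal l) y = offset l.
  move=> /(_ l) h /(_ l'); rewrite nn oo dotNl lerN2 => h'.
  by apply/eqP; rewrite eq_le h.
split.
  by move=> y []; rewrite !frontier_body => -[jy _] [iy _]; exact: opp.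
have [r r0 Hr] := near_enorm (near_neighbour ij fx gx ix).
exists x, r; split => //; first by case: fx.
move=> y yl /Hr[Hj Hi]; rewrite /face_set/= !frontier_body; split; split.
- by apply: Hj; rewrite yl.
- by rewrite cellE// => /(_ l); rewrite yl ltxx.
- by apply: Hi; rewrite yl.
- by rewrite cellE// => /(_ l'); rewrite nn oo dotNl yl ltxx.
Qed.

Lemma interior_face_set j (l : 'I_(nfacets (elem j))) i : i != j ->
  face_ok Omega (interior_code l i) ->
  face_set Omega (interior_code l i) = facet l `&` body (elem i).
Proof.
move=> ij [H _]; apply/seteqP; split => x.
  move=> fx; have hx := H _ fx; move: fx; rewrite /face_set/= !frontier_body.
  by move=> [[jx _] [ix _]].
move=> [[jx tx] ix]; rewrite /face_set/= !frontier_body; split; split => //.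
  by rewrite cellE// => /(_ l); rewrite tx ltxx.
exact: disjoint_not_cell (cellT ij) jx.
Qed.

(** Borel substitute for the part of the facet on the boundary of [Omega]; [boundary_face_set] shows
    that the two agree at generic points. *)
Definition outer_facet j (l : 'I_(nfacets (elem j))) : set 'rV[R]_n.+1 :=
  facet l `\` \bigcup_(i in [set i : 'I_(nelem M) | i != j]) body (elem i).

Lemma boundary_face_ok j (l : 'I_(nfacets (elem j))) x : gen (normal l) x ->
  outer_facet l x -> face_ok Omega (boundary_code l).
Proof.
move=> gx [fx nx]; have H : forall i, i != j -> ~ body (elem i) x.
  by move=> i ij ix; apply: nx; exists i.
split; first by move=> y [[]].
have near_x := @filterI _ (nbhs x) _ _ _ (body_near (facet_others fx gx)) (near_not_bodies H).
have [r r0 Hr] := near_enorm (near_x _).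
exists x, r; split => //; first by case: fx.
move=> y yl /Hr[Hj Hi]; have fy : facet l y by split => //; apply: Hj; rewrite yl.
by split => //; exact: (facet_frontier fy).
Qed.

Lemma boundary_face_set j (l : 'I_(nfacets (elem j))) x : gen (normal l) x ->
  face_set Omega (boundary_code l) x <-> outer_facet l x.
Proof.
move=> gx; split => [[fx frx]|[fx nx]]; split => //.
  by move=> [i /= ij ix]; exact: (frontier_no_neighbour ij fx gx ix).
by apply: (facet_frontier fx) => i ij ix; apply: nx; exists i.
Qed.

Lemma measurable_outer_facet j (l : 'I_(nfacets (elem j))) : measurable (outer_facet l).
Proof.
apply: measurableD; first exact: measurable_facet.
rewrite bigcup_mkcond; apply: fin_bigcup_measurable => // i _; case: ifP => // _.
exact: measurable_body.
Qed.

Lemma measurable_common_facet j (l : 'I_(nfacets (elem j))) i :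
  measurable (facet l `&` body (elem i)).
Proof. by apply: measurableI; [exact: measurable_facet|exact: measurable_body]. Qed.

Lemma in_cube_common_facet j (l : 'I_(nfacets (elem j))) i :
  in_cube (facet l `&` body (elem i)).
Proof. by apply: in_cubeS (in_cube_body (pT i)) => x []. Qed.

Lemma in_cube_outer_facet j (l : 'I_(nfacets (elem j))) : in_cube (outer_facet l).
Proof. by apply: in_cubeS (in_cube_facet l (pT j)) => x []. Qed.

(** Defined for every pair of a facet and an element, whether or not the pair codes a face. *)
Definition common_surfI j (l : 'I_(nfacets (elem j))) i (F : 'rV[R]_n.+1 -> R) : R :=
  surfI (normal l) (offset l) (fun x => \1_(facet l `&` body (elem i)) x * F x).

Definition outer_surfI j (l : 'I_(nfacets (elem j))) (F : 'rV[R]_n.+1 -> R) : R :=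
  surfI (normal l) (offset l) (fun x => \1_(outer_facet l) x * F x).

Let blb_common j (l : 'I_(nfacets (elem j))) i F : lbm F ->
  blb (fun x => \1_(facet l `&` body (elem i)) x * F x).
Proof.
by apply: blb_indic; [exact: measurable_common_facet|exact: in_cube_common_facet].
Qed.

Let blb_outer j (l : 'I_(nfacets (elem j))) F : lbm F ->
  blb (fun x => \1_(outer_facet l) x * F x).
Proof.
by apply: blb_indic; [exact: measurable_outer_facet|exact: in_cube_outer_facet].
Qed.

Let surfI0 nu c : surfI nu c (fun _ : 'rV[R]_n.+1 => 0) = 0.
Proof.
by rewrite /surfI; case: pickP => // j _; rewrite /Rintegral integral0 mulr0.
Qed.

(** If the code is not a face, [interior_face_ok] leaves no generic common point, so the integral on
    the right vanishes. This allows sums over all codes. *)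
Lemma face_Rintegral_interior j (l : 'I_(nfacets (elem j))) i F : i != j -> lbm F ->
  (if `[< face_ok Omega (interior_code l i) >]
   then face_Rintegral Omega (interior_code l i) F else 0) = common_surfI l i F.
Proof.
move=> ij lF; case: asboolP => ok.
  rewrite /face_Rintegral /face_integral interior_face_set//.
  apply: (@surface_integral_surfI _ _ _ (fun i => elem i)) => //.
  - exact: elem_unit.
  - exact: elem_unit.
  - exact: measurable_common_facet.
  - exact: in_cube_common_facet.
rewrite -(surfI0 (normal l) (offset l)); apply: (@eq_surfI _ _ _ (fun i => elem i)).
- exact: elem_unit.
- exact: elem_unit.
- exact: measurable_cst.
- exact: (blb_common l i lF).1.1.
move=> x tx gx; rewrite indicE memNset ?mul0r// => -[fx ix].
exact/ok/(interior_face_ok ij fx gx ix).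
Qed.

Lemma face_Rintegral_boundary j (l : 'I_(nfacets (elem j))) F : lbm F ->
  (if `[< face_ok Omega (boundary_code l) >]
   then face_Rintegral Omega (boundary_code l) F else 0) = outer_surfI l F.
Proof.
move=> lF; case: asboolP => ok.
  rewrite /face_Rintegral /face_integral.
  apply: (@surface_integral_surfI _ _ _ (fun i => elem i)) => //.
  - exact: elem_unit.
  - exact: elem_unit.
  - exact: measurable_outer_facet.
  - exact: in_cube_outer_facet.
  - by move=> x _ gx; exact: boundary_face_set.
rewrite -(surfI0 (normal l) (offset l)); apply: (@eq_surfI _ _ _ (fun i => elem i)).
- exact: elem_unit.
- exact: elem_unit.
- exact: measurable_cst.
- exact: (blb_outer l lF).1.1.
move=> x tx gx; rewrite indicE memNset ?mul0r// => ox.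
exact/ok/(boundary_face_ok gx ox).
Qed.

(** Several elements may share the facet, but a generic point lies on at most one of them, so the
    indicators of the common parts and of the outer part add up to the indicator of the facet. *)
Lemma facet_split j (l : 'I_(nfacets (elem j))) F : lbm F ->
  surfI (normal l) (offset l) (fun x => \1_(facet l) x * F x) =
  \sum_(i | i != j) common_surfI l i F + outer_surfI l F.
Proof.
move=> lF; rewrite /common_surfI /outer_surfI -surfI_sum; last by move=> i; exact: blb_common.
rewrite -surfID; [|by apply: blb_sum => i; exact: blb_common|exact: blb_outer].
have bf : blb (fun x => \1_(facet l) x * F x).
  by apply: blb_indic => //; [exact: measurable_facet|exact: (in_cube_facet l (pT j))].
apply: (@eq_surfI _ _ _ (fun i => elem i)).
- exact: elem_unit.
- exact: elem_unit.
- exact: bf.1.1.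
- have b1 := blb_sum (index_enum _) (fun i => i != j) (fun i => blb_common l i lF).
  exact: (blbD b1 (blb_outer l lF)).1.1.
move=> x tx gx; have [fx|nfx] := pselect (facet l x); last first.
  have o0 : \1_(outer_facet l) x = 0 :> R by rewrite indicE memNset// => -[].
  rewrite indicE memNset// o0 !mul0r addr0 big1// => i _.
  by rewrite indicE memNset ?mul0r// => -[].
rewrite indicE mem_set// mul1r.
have [[i ij ix]|H] := pselect (exists2 i, i != j & body (elem i) x).
  rewrite (bigD1 i)//= big1 => [|i' /andP[i'j i'i]].
    rewrite !indicE mem_set// memNset; last by case=> _; apply; exists i.
    by rewrite mul1r mul0r !addr0.
  rewrite indicE memNset ?mul0r// => -[_ i'x].
  by move: i'i; rewrite (neighbour_unique i'j ij fx gx i'x ix) eqxx.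
rewrite big1 => [|i ij]; last first.
  by rewrite indicE memNset ?mul0r// => -[_ ix]; apply: H; exists i.
by rewrite add0r indicE mem_set ?mul1r//; split => // -[i /= ij ix]; apply: H; exists i.
Qed.

(** The facets of T_j and T_i are matched by opposite normals and offsets. Matched facets meet the
    other body in the same set, and only the sign of the normal changes. *)
Lemma common_surfI_opp j i a F : i != j -> lbm F ->
  \sum_l normal l 0 a * @common_surfI j l i F =
  - \sum_l normal l 0 a * @common_surfI i l j F.
Proof.
move=> ij lF; have ji : j != i by rewrite eq_sym.
pose c (l : 'I_(nfacets (elem j))) (l' : 'I_(nfacets (elem i))) :=
  (normal l' == - normal l) && (offset l' == - offset l).
(* The sum over matching facets has at most one term because normals are injective; if it has none,
   [neighbour] excludes generic common points and the integral is zero. *)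
have sel j0 i0 (l : 'I_(nfacets (elem j0))) : i0 != j0 ->
    common_surfI l i0 F = \sum_(l' : 'I_(nfacets (elem i0)) |
      (normal l' == - normal l) && (offset l' == - offset l)) common_surfI l i0 F.
  move=> i0j0.
  have [l' /andP[/eqP nn /eqP oo]|none] := pickP (fun l' : 'I_(nfacets (elem i0)) =>
      (normal l' == - normal l) && (offset l' == - offset l)).
    rewrite (bigD1 l')/= ?nn ?oo ?eqxx// big1 ?addr0// => m /andP[/andP[/eqP mn _] ml'].
    have [_ _ _ inj _] := pT i0.
    by move: ml'; rewrite (inj m l') ?eqxx// mn nn.
  rewrite big1; last by move=> m; rewrite none.
  rewrite -(surfI0 (normal l) (offset l)); apply: (@eq_surfI _ _ _ (fun i => elem i)).
  - exact: elem_unit.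
  - exact: elem_unit.
  - exact: (blb_common l i0 lF).1.1.
  - exact: measurable_cst.
  move=> x tx gx; rewrite indicE memNset ?mul0r// => -[fx ix].
  have [l' [nn oo _ _]] := neighbour i0j0 fx gx ix.
  by have := none l'; rewrite nn oo !eqxx.
rewrite (eq_bigr (fun l => \sum_(l' | c l l') normal l 0 a * common_surfI l i F)); last first.
  by move=> l _; rewrite {1}(sel j i l ij) mulr_sumr.
rewrite [in RHS](eq_bigr (fun l' => \sum_(l | c l l') normal l' 0 a * common_surfI l' j F)); last first.
  move=> l' _; rewrite {1}(sel i j l' ji) mulr_sumr; apply: eq_bigl => l.
  by rewrite /c; congr (_ && _); rewrite -eqr_oppLR eq_sym.
rewrite (exchange_big_dep xpredT)//= -sumrN; apply: eq_bigr => l' _.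
rewrite -sumrN; apply: eq_bigr => l /andP[/eqP nn /eqP oo].
rewrite nn mxE mulNr opprK; congr (_ * _).
rewrite /common_surfI nn oo surfI_opp; last first.
  by have := (blb_common l' j lF).1.1.
congr surfI; apply/funext => x; congr (_ * _); rewrite !indicE; congr (_%:R).
congr (nat_of_bool (_ \in _)); apply/seteqP; split => y [[by1 ty] by2].
  by split => //; split => //; rewrite /hyperplane/= nn oo dotNl ty.
split => //; split => //; move: ty; rewrite /hyperplane/= nn oo dotNl.
exact: oppr_inj.
Qed.

Lemma sum_face (X : face M -> R) : \sum_e X e =
  \sum_j \sum_(l < nfacets (elem j)) (X (boundary_code l) + \sum_i X (interior_code l i)).
Proof.
rewrite (eq_bigr (fun j => \sum_(z : 'I_(nfacets (elem j)) * option 'I_(nelem M)) X (Tagged (fun j => ('I_(nfacets (elem j)) * option 'I_(nelem M))%type) z))); last first.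
  move=> j _; rewrite [RHS](_ : _ = \sum_(l < nfacets (elem j)) \sum_(o : option 'I_(nelem M))
      X (Tagged (fun j => ('I_(nfacets (elem j)) * option 'I_(nelem M))%type) (l, o))).
    apply: eq_bigr => l _; rewrite (bigD1 None)//=; congr (_ + _).
    rewrite (reindex_omap Some id); last by case.
    by apply: eq_bigl => i; rewrite eqxx.
  by rewrite pair_bigA; apply: eq_bigr => -[].
rewrite sig_big_dep/=; apply: eq_bigr => -[j z] _ //.
Qed.

Lemma sum_face_cond (P : pred (face M)) (X : face M -> R) : \sum_(e | P e) X e =
  \sum_j \sum_(l < nfacets (elem j)) ((if P (boundary_code l) then X (boundary_code l) else 0) +
    \sum_i (if P (interior_code l i) then X (interior_code l i) else 0)).
Proof. by rewrite big_mkcond (sum_face (fun e => if P e then X e else 0)). Qed.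

Lemma common_surfIB j (l : 'I_(nfacets (elem j))) i F G : lbm F -> lbm G ->
  common_surfI l i (fun x => F x - G x) = common_surfI l i F - common_surfI l i G.
Proof.
move=> lF lG; rewrite /common_surfI -[X in _ - X]mul1r -mulNr -surfIZ; last exact: blb_common.
rewrite -surfID; [|exact: blb_common|by apply: blbZ; exact: blb_common].
by congr surfI; apply/funext => x; ring.
Qed.

(** Every pair of distinct elements occurs twice, once from each side. [common_surfI_opp] moves both
    contributions to the element of larger index, which is T^+, and their difference is the jump of
    [F]. *)
Lemma mesh_surface_sum a (F : 'I_(nelem M) -> 'rV[R]_n.+1 -> R) : (forall i, lbm (F i)) ->
  \sum_j \sum_(l < nfacets (elem j)) normal l 0 a *
     surfI (normal l) (offset l) (fun x => \1_(facet l) x * F j x) =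
  \sum_(e | interior_face Omega e) face_normal e 0 a *
     face_Rintegral Omega e (fun x => jump F e x) +
  \sum_(e | boundary_face Omega e) face_normal e 0 a *
     face_Rintegral Omega e (fun x => F (face_plus e) x).
Proof.
move=> lF.
have lB j i : lbm (fun x => F j x - F i x) by apply: lbmB.
transitivity (\sum_j \sum_(l < nfacets (elem j)) (\sum_(i < nelem M | (i < j)%N)
   normal l 0 a * common_surfI l i (fun x => F j x - F i x) + normal l 0 a * outer_surfI l (F j))).
  under eq_bigr => j _ do under eq_bigr => l _ do rewrite facet_split// mulrDr.
  under [RHS]eq_bigr => j _ do rewrite big_split/=.
  under eq_bigr => j _ do rewrite big_split/=.
  rewrite big_split [RHS]big_split/=; congr (_ + _).
  pose G j i (H : 'rV[R]_n.+1 -> R) :=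
    \sum_(l < nfacets (elem j)) normal l 0 a * common_surfI l i H.
  transitivity (\sum_j \sum_(i | i != j) G j i (F j)).
    apply: eq_bigr => j _; rewrite /G exchange_big/=; apply: eq_bigr => l _.
    by rewrite mulr_sumr.
  transitivity (\sum_(j < nelem M) \sum_(i < nelem M | (i < j)%N) (G j i (F j) - G j i (F i))).
    transitivity (\sum_(j < nelem M) \sum_(i < nelem M | (i < j)%N) G j i (F j) +
                  \sum_(j < nelem M) \sum_(i < nelem M | (j < i)%N) G j i (F j)).
      rewrite -big_split/=; apply: eq_bigr => j _.
      rewrite (bigID (fun i : 'I_(nelem M) => (i < j)%N))/=; congr (_ + _).
        by apply: eq_bigl => i; rewrite -val_eqE/=; case: ltngtP.
      by apply: eq_bigl => i; rewrite -val_eqE/=; case: ltngtP.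
    rewrite [X in _ + X](exchange_big_dep xpredT)//= -big_split/=; apply: eq_bigr => j _.
    rewrite -big_split/=; apply: eq_bigr => i ij; congr (_ + _).
    by apply: common_surfI_opp => //; rewrite -val_eqE/= neq_ltn ij orbT.
  apply: eq_bigr => j _; rewrite exchange_big/=; apply: eq_bigr => i ij.
  rewrite /G -sumrB; apply: eq_bigr => l _.
  by rewrite common_surfIB// mulrBr.
rewrite (sum_face_cond (interior_face Omega)) (sum_face_cond (boundary_face Omega)).
rewrite -big_split/=; apply: eq_bigr => j _; rewrite -big_split/=; apply: eq_bigr => l _.
rewrite add0r [X in _ = _ + (_ + X)]big1// addr0; congr (_ + _).
  rewrite big_mkcond/=; apply: eq_bigr => i _; rewrite /interior_face/=.
  case: ltnP => //= ij; rewrite -(@face_Rintegral_interior j l i (fun x => F j x - F i x))//.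
    by case: ifP => _; rewrite ?mulr0.
  by rewrite -val_eqE/= neq_ltn ij.
by rewrite /boundary_face/= -face_Rintegral_boundary//; case: ifP => _; rewrite ?mulr0.
Qed.

End MeshGeometry.

(** * Polynomial functions *)
Section Polynomials.
Context {R : realType} {n : nat}.
Local Notation E := 'rV[R]_n.+1.
Implicit Types (k : nat) (q : E -> R).

(** Exponents are unbounded natural numbers, so that differentiation can lower them without carrying
    the degree bound in the type. *)
Definition monom (m : {ffun 'I_n.+1 -> nat}) (x : E) : R := \prod_a x 0 a ^+ m a.

Lemma poly_funD k q1 q2 : poly_fun k q1 -> poly_fun k q2 ->
  poly_fun k (fun x => q1 x + q2 x).
Proof.
move=> [c1 E1] [c2 E2]; exists (fun m => c1 m + c2 m) => x.
by rewrite E1 E2 -big_split/=; apply: eq_bigr => m _; rewrite mulrDl.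
Qed.

Lemma poly_funZ k c q : poly_fun k q -> poly_fun k (fun x => c * q x).
Proof.
move=> [c1 E1]; exists (fun m => c * c1 m) => x.
by rewrite E1 mulr_sumr; apply: eq_bigr => m _; rewrite mulrA.
Qed.

Lemma poly_fun0 k : poly_fun k (fun _ : E => 0).
Proof. by exists (fun=> 0) => x; rewrite big1// => m _; rewrite mul0r. Qed.

Lemma poly_fun_sum k (I : Type) (s : seq I) (P : pred I) (q : I -> E -> R) :
  (forall i, P i -> poly_fun k (q i)) -> poly_fun k (fun x => \sum_(i <- s | P i) q i x).
Proof.
move=> pq; elim: s => [|i s IH].
  by under eq_fun do rewrite big_nil; exact: poly_fun0.
under eq_fun do rewrite big_cons.
by have := pq i; case: (P i) => // /(_ isT) pqi; exact: poly_funD.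
Qed.

Lemma poly_fun_monom k (m : {ffun 'I_n.+1 -> nat}) : (\sum_a m a <= k)%N -> poly_fun k (monom m).
Proof.
move=> mk; have ma a : (m a < k.+1)%N.
  by rewrite ltnS; apply: leq_trans mk; rewrite (bigD1 a)//= leq_addr.
pose m' : {ffun 'I_n.+1 -> 'I_k.+1} := [ffun a => Ordinal (ma a)].
exists (fun m2 => (m2 == m')%:R) => x.
rewrite (bigD1 m')/=; last by under eq_bigr do rewrite ffunE.
rewrite eqxx mul1r [X in _ + X]big1 => [|i /andP[_ /negbTE ->]]; last by rewrite mul0r.
rewrite addr0.
by apply: eq_bigr => a _; rewrite ffunE.
Qed.

Definition expo k (m : {ffun 'I_n.+1 -> 'I_k.+1}) : {ffun 'I_n.+1 -> nat} :=
  [ffun a => nat_of_ord (m a)].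

Lemma poly_funE k q : poly_fun k q -> exists c : {ffun 'I_n.+1 -> 'I_k.+1} -> R,
  q = fun x => \sum_(m : {ffun 'I_n.+1 -> 'I_k.+1} | (\sum_a m a <= k)%N) c m * monom (expo m) x.
Proof.
move=> [c E]; exists c; apply/funext => x; rewrite E; apply: eq_bigr => m _.
by congr (_ * _); apply: eq_bigr => a _; rewrite ffunE.
Qed.

Lemma lbm_monom m : lbm (monom m).
Proof. by apply: lbm_prod => a; apply: lbmX; exact: lbm_coord. Qed.

Lemma lbm_poly_fun k q : poly_fun k q -> lbm q.
Proof.
move=> /poly_funE[c ->]; apply: lbm_sum => m; apply: lbmM; first exact: lbm_cst.
exact: lbm_monom.
Qed.

Lemma monom_line m (x w : E) : exists p : {poly R}, forall t, monom m (x + t *: w) = p.[t].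
Proof.
exists (\prod_a ((x 0 a)%:P + (w 0 a)%:P * 'X) ^+ m a) => t.
rewrite horner_prod; apply: eq_bigr => a _.
by rewrite horner_exp !hornerE !mxE (mulrC t).
Qed.

Lemma poly_fun_line k q (x w : E) : poly_fun k q ->
  exists p : {poly R}, forall t, q (x + t *: w) = p.[t].
Proof.
move=> /poly_funE[c ->]; pose P m := sval (cid (monom_line m x w)).
exists (\sum_(m : {ffun 'I_n.+1 -> 'I_k.+1} | (\sum_a m a <= k)%N) c m *: P (expo m)) => t.
rewrite horner_sum; apply: eq_bigr => m _; rewrite hornerZ /P.
by case: cid => p /= <-.
Qed.

(** On the line from [x] to [y] the function is a polynomial in one variable with too many zeros
    near [x]. *)
Lemma poly_fun_zero k q (A : set E) (x : E) : poly_fun k q -> nbhs x A ->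
  (forall y, A y -> q y = 0) -> forall y, q y = 0.
Proof.
move=> pq Ax q0 y; have [p Hp] := poly_fun_line x (y - x) pq.
have [e e0 He] := near_line (y - x) Ax.
suff p0 : p = 0.
  by have := Hp 1; rewrite p0 horner0 scale1r addrC subrK.
(* The denominators start at 2, which keeps every root strictly below [e]. *)
apply: (roots_geq_poly_eq0 (rs := [seq e / (i.+2)%:R | i <- iota 0 (size p)])).
- apply/allP => _ /mapP[i _ ->]; apply/eqP; rewrite -Hp; apply: q0; apply: He.
  by rewrite divr_gt0 ?ltr0n//= ltr_pdivrMr ?ltr0n// ltr_pMr// ltr1n.
- rewrite map_inj_uniq ?iota_uniq// => i j /(congr1 (fun z => e^-1 * z)).
  rewrite !mulKf ?gt_eqF// => /invr_inj /eqP; rewrite eqr_nat => /eqP [].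
  by [].
- by rewrite size_map size_iota.
Qed.

(** The partial derivative of [monom m] in direction [a]. For [m a = 0] the truncated predecessor is
    harmless, because the factor in front is zero. *)
Definition dmonom a (m : {ffun 'I_n.+1 -> nat}) (x : E) : R :=
  (m a)%:R * monom [ffun b => if b == a then (m b).-1 else m b] x.

Lemma monomD1 a m (x : E) : monom m x = x 0 a ^+ m a * \prod_(b | b != a) x 0 b ^+ m b.
Proof. by rewrite /monom (bigD1 a). Qed.

Lemma dmonomE a m (x : E) :
  dmonom a m x = x 0 a ^+ (m a).-1 *+ m a * \prod_(b | b != a) x 0 b ^+ m b.
Proof.
rewrite /dmonom (monomD1 a) ffunE eqxx mulrA mulr_natl; congr (_ * _).
by apply: eq_bigr => b ba; rewrite ffunE (negbTE ba).
Qed.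

Lemma monom_coord_line a m (x : E) : exists p : {poly R},
  (forall s, monom m (x + s *: delta_mx 0 a) = p.[s]) /\
  (forall t, p^`().[t] = dmonom a m (x + t *: delta_mx 0 a)).
Proof.
have coord s b : (x + s *: delta_mx 0 a) 0 b = if b == a then x 0 a + s else x 0 b.
  by rewrite !mxE eqxx/=; have [->|_] := eqVneq b a; rewrite ?mulr1 ?mulr0 ?addr0.
have rest s : \prod_(b | b != a) (x + s *: delta_mx 0 a) 0 b ^+ m b = \prod_(b | b != a) x 0 b ^+ m b.
  by apply: eq_bigr => b ba; rewrite coord (negbTE ba).
exists ((\prod_(b | b != a) x 0 b ^+ m b) *: ((x 0 a)%:P + 'X) ^+ m a); split => s.
  by rewrite (monomD1 a) rest coord eqxx hornerZ horner_exp !hornerE mulrC.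
rewrite dmonomE rest coord eqxx derivZ deriv_exp derivD derivC derivX add0r mul1r.
by rewrite hornerZ hornerMn horner_exp !hornerE mulrC.
Qed.

Definition dpoly a k (c : {ffun 'I_n.+1 -> 'I_k.+1} -> R) (x : E) : R :=
  \sum_(m : {ffun 'I_n.+1 -> 'I_k.+1} | (\sum_a m a <= k)%N) c m * dmonom a (expo m) x.

Lemma poly_fun_dmonom k a (m : {ffun 'I_n.+1 -> nat}) : (\sum_a m a <= k)%N -> poly_fun k (dmonom a m).
Proof.
move=> mk; apply: poly_funZ; apply: poly_fun_monom; apply: leq_trans mk.
by apply: leq_sum => b _; rewrite ffunE; case: eqP => // _; exact: leq_pred.
Qed.

Lemma poly_fun_derive k q a : poly_fun k q -> exists w, [/\ poly_fun k w,
  partial a q = w & forall x (t : R), is_derive t (1 : R) (fun s => q (x + s *: delta_mx 0 a))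
     (w (x + t *: delta_mx 0 a))].
Proof.
move=> /poly_funE[c qE]; exists (dpoly a c).
have D x (t : R) : is_derive t (1 : R) (fun s => q (x + s *: delta_mx 0 a))
     (dpoly a c (x + t *: delta_mx 0 a)).
  pose P m := sval (cid (monom_coord_line a m x)).
  pose Q := \sum_(m : {ffun 'I_n.+1 -> 'I_k.+1} | (\sum_a m a <= k)%N) c m *: P (expo m).
  rewrite (_ : (fun s => _) = horner Q); last first.
    apply/funext => s; rewrite qE horner_sum; apply: eq_bigr => m _.
    by rewrite hornerZ /P; case: cid => p [/= <-].
  rewrite (_ : dpoly a c _ = Q^`().[t]); first exact: is_derive_poly.
  rewrite raddf_sum horner_sum; apply: eq_bigr => m _.
  by rewrite /= derivZ hornerZ /P; case: cid => p [/= _ ->].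
split => //.
  apply: poly_fun_sum => m mk; apply: poly_funZ; apply: poly_fun_dmonom.
  by under eq_bigr do rewrite ffunE.
apply/funext => x; rewrite /partial /derive.
have := D x 0; rewrite scale0r addr0 => -[_ <-].
rewrite /derive.
(* The difference quotient defining [partial] is the one of the restriction to the coordinate line,
   at parameter 0. *)
have -> : (fun h : R => h^-1 *: ((q \o shift x) (h *: delta_mx 0 a) - q x)) =
  (fun h : R => h^-1 *: (((fun s : R => q (x + s *: delta_mx 0 a)) \o shift 0) (h *: (1 : R)) -
     q (x + 0 *: delta_mx 0 a))) => //.
apply/funext => h /=.
rewrite scale0r !addr0 [_ + x]addrC; congr (_ *: (q (x + _ *: _) - _)).
by rewrite /GRing.scale/= mulr1.
Qed.

Lemma poly_fun_continuous_line k q a (y : 'rV[R]_n) : poly_fun k q ->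
  continuous (fun t : R => q (ins a t y)).
Proof.
move=> pq; have [p Hp] := poly_fun_line (ins a 0 y) (delta_mx 0 a) pq.
rewrite (_ : (fun t => _) = horner p); last by apply/funext => t; rewrite -Hp -insD add0r.
exact: continuous_horner.
Qed.

End Polynomials.

(** * Riesz representation of functionals on the polynomials of one element *)

Section Riesz.
Context {R : realType} {n : nat}.
Local Arguments borel_leb : simpl never.
Local Notation E := 'rV[R]_n.+1.

Definition box d (x : 'rV[R]_d) (e : R) : set 'rV[R]_d := [set y | forall i, `|y 0 i - x 0 i| < e].

Lemma measurable_box d (x : 'rV[R]_d) e : measurable (box x e).
Proof.
rewrite (_ : box x e = \bigcap_(i : 'I_d) (coords i @^-1` `]x 0 i - e, x 0 i + e[)).
  rewrite bigcap_mkcond; apply: fin_bigcap_measurable => // i _.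
  case: ifP => // _; rewrite -[X in measurable X]setTI.
  by apply: measurable_coord => //; exact: measurable_itv.
by apply/seteqP; split => y H i; [move=> _|]; have := H i; rewrite /= in_itv/= -ltr_distl//; exact.
Qed.

Lemma box_gt0 d (x : 'rV[R]_d) e : 0 < e -> (0 < borel_leb d (box x e))%E.
Proof.
move=> e0; elim: d x => [|d IH] x.
  by rewrite [X in (_ < X)%E]diracE mem_set ?lte01// => -[].
rewrite (_ : borel_leb d.+1 (box x e) =
  (lebesgue_measure \x borel_leb d)%E (`]x 0 ord0 - e, x 0 ord0 + e[ `*` box (delrow ord0 x) e)).
  rewrite product_measure1E//; last exact: measurable_box.
  have I0 : (0 < lebesgue_measure (`](x 0 ord0 - e)%R, (x 0 ord0 + e)%R[%classic : set R))%E.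
    rewrite lebesgue_measure_itv/= lte_fin ltrBlDr -addrA ltrDl addr_gt0//.
    by rewrite -EFinB lte_fin subr_gt0 ltrBlDr -addrA ltrDl addr_gt0.
  exact: mule_gt0.
transitivity ((lebesgue_measure \x borel_leb d)%E (@cons_rV R d @^-1` box x e)); first by [].
congr ((lebesgue_measure \x borel_leb d)%E _); apply/seteqP; split => -[t y] /=.
  rewrite cons_rVE => H; split.
    by rewrite in_itv/= -ltr_distl; have := H ord0; rewrite ins_at.
  by move=> i; have := H (lift ord0 i); rewrite ins_lift mxE.
rewrite in_itv/= -ltr_distl => -[Ht Hy]; rewrite cons_rVE => i.
case: (unliftP ord0 i) => [l|] ->; rewrite ?ins_lift ?ins_at//.
by have := Hy l; rewrite mxE.
Qed.

Lemma near_box (x : E) (A : set E) : nbhs x A -> exists2 e, 0 < e & box x e `<=` A.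
Proof.
move=> /nbhs_ballP[e /= e0 eA]; exists e => // y xy; apply: eA; split=> // i j.
by rewrite ord1 /ball/= distrC; exact: xy.
Qed.

Lemma continuous_poly_fun k (q : E -> R) : poly_fun k q -> continuous q.
Proof.
move=> /poly_funE[c ->] x.
have cX a j : continuous (fun y : E => y 0 a ^+ j).
  move=> y; apply: (@continuous_comp _ _ _ (fun y : E => y 0 a) (fun t : R => t ^+ j)).
    exact: coord_continuous.
  exact: exprn_continuous.
have cm m : continuous (fun y : E => monom m y).
  rewrite /monom; elim: (index_enum _) => [|i s IH] y.
    by rewrite (_ : (fun y => _) = cst 1); [exact: cst_continuous|apply/funext => z; rewrite big_nil].
  under eq_fun do rewrite big_cons.
  by apply: (@continuousM _ _ (fun y : E => y 0 i ^+ m i)); [exact: cX|exact: IH].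
elim: (index_enum _) => [|m s IH].
  by rewrite (_ : (fun y => _) = cst 0); [exact: cst_continuous|apply/funext => z; rewrite big_nil].
under eq_fun do rewrite big_cons.
case: ifP => // _; apply: (@continuousD _ _ _ (fun y => c m * monom (expo m) y)); last exact: IH.
by apply: (@continuousM _ _ (cst (c m)) (fun y => monom (expo m) y)); [exact: cst_continuous|exact: cm].
Qed.

Variable P : polytope R n.+1.
Hypothesis pP : proper_polytope P.
Local Notation I F := (\int[leb n.+1]_(x in cell P) F x).

Let mc : measurable (cell P : set (lebT R n.+1)).
Proof. by apply: measurable_lebT; exact: measurable_cell. Qed.

Lemma integrable_cell F : lbm F -> (leb n.+1).-integrable (cell P) (EFin \o F).
Proof. by move=> lF; apply: integrable_lbm_leb => //; exact: in_cube_cell. Qed.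

Lemma cell_IntD F G : lbm F -> lbm G -> I (fun x => F x + G x) = I F + I G.
Proof. by move=> lF lG; rewrite RintegralD//; exact: integrable_cell. Qed.

Lemma cell_IntZ c F : lbm F -> I (fun x => c * F x) = c * I F.
Proof. by move=> lF; rewrite RintegralZl//; exact: integrable_cell. Qed.

Lemma cell_Int_sum (J : Type) (s : seq J) (Q : pred J) (F : J -> E -> R) :
  (forall j, lbm (F j)) ->
  I (fun x => \sum_(j <- s | Q j) F j x) = \sum_(j <- s | Q j) I (F j).
Proof.
move=> lF; elim: s => [|j s IH].
  rewrite big_nil /Rintegral integral0_eq// => x _; by rewrite big_nil.
rewrite big_cons -IH; case: ifP => Qj.
  by rewrite -cell_IntD//; [apply: eq_Rintegral => x _; rewrite big_cons Qj|exact: lbm_sum].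
by apply: eq_Rintegral => x _; rewrite big_cons Qj.
Qed.

(** The square vanishes almost everywhere on the cell. If [q] were nonzero at a point of it, then by
    continuity it would be nonzero on a box, which has positive measure. Being zero on an open set,
    [q] is zero everywhere. *)
Lemma cell_sqr_eq0 k (q : E -> R) : poly_fun k q -> I (fun x => q x * q x) = 0 ->
  forall x, q x = 0.
Proof.
move=> pq I0.
have lq := lbm_poly_fun pq.
have [_ [z Pz] _ _ _] := pP.
suff q0 : forall x, cell P x -> q x = 0.
  by apply: (poly_fun_zero pq _ q0); exact: (open_nbhs_nbhs (conj (@cell_open _ _ P) Pz)).
have mcB := measurable_cell pP.
have mqq : measurable_fun (cell P) (fun x => (q x * q x)%:E : \bar R).
  by apply/measurable_EFinP; apply: measurable_funTS; exact: (lbmM lq lq).1.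
have iqq : (borel_leb n.+1).-integrable (cell P) (EFin \o (fun x => q x * q x)).
  by apply: integrable_lbm => //; [exact: lbmM|exact: in_cube_cell].
have e0 : (\int[borel_leb n.+1]_(x in cell P) `|(q x * q x)%:E| = 0)%E.
  have := integrable_fin_num mcB iqq => /fineK.
  rewrite (_ : fine _ = 0); last by rewrite -[RHS]I0 /Rintegral integral_leb.
  move=> /esym e0; apply: etrans e0; apply: eq_integral => x _ /=.
  by rewrite ger0_norm// -expr2 sqr_ge0.
have [N [mN N0 sub]] := (ae_eq_integral_abs _ mcB mqq).1 e0.
move=> x Px; apply: contrapT => /eqP qx.
have nq : \forall y \near x, q y != 0.
  have := continuous_poly_fun pq (x := x).
  move=> /(_ [set t | t != 0]) /=; apply.
  by apply: open_nbhs_nbhs; split => //; exact: open_neq.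
have [e ep He] := near_box (filterI nq (open_nbhs_nbhs (conj (@cell_open _ _ P) Px))).
have : (borel_leb n.+1 (box x e) <= borel_leb n.+1 N)%E.
  apply: le_measure; rewrite ?inE//; first exact: measurable_box.
  move=> y /He[qy Py]; apply: sub => /(_ Py) [] /eqP.
  by rewrite mulf_eq0 orbb (negbTE qy).
by rewrite N0 leNgt box_gt0.
Qed.

(** The coefficients solve a linear system with the Gram matrix of a spanning family. The matrix may
    be singular, so solvability is obtained from symmetry: the right side has to vanish on the
    kernel. *)
Lemma riesz_cell k (ell : (E -> R) -> R) :
  (forall q1 q2, poly_fun k q1 -> poly_fun k q2 ->
     ell (fun x => q1 x + q2 x) = ell q1 + ell q2) ->
  (forall c q, poly_fun k q -> ell (fun x => c * q x) = c * ell q) ->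
  exists2 q, poly_fun k q & forall psi, poly_fun k psi ->
    I (fun x => q x * psi x) = ell psi.
Proof.
move=> ellD ellZ.
pose T := {ffun 'I_n.+1 -> 'I_k.+1}.
(* Exponents of total degree above [k] yield the zero function, so that the family is indexed by a
   whole finite type. *)
pose mono (m : T) : E -> R := if (\sum_a m a <= k)%N then monom (expo m) else fun=> 0.
have pmono m : poly_fun k (mono m).
  rewrite /mono; case: ifP => mk; last exact: poly_fun0.
  by apply: poly_fun_monom; under eq_bigr do rewrite ffunE.
have ell0 : ell (fun=> 0) = 0.
  transitivity (ell (fun x => 0 * (fun=> 0) x)); last by rewrite ellZ ?mul0r//; exact: poly_fun0.
  congr ell.
  by apply/funext => x; rewrite mul0r.
have ell_sum (J : Type) (s : seq J) (F : J -> E -> R) (c : J -> R) : (forall j, poly_fun k (F j)) ->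
    ell (fun x => \sum_(j <- s) c j * F j x) = \sum_(j <- s) c j * ell (F j).
  move=> pF; elim: s => [|j s IH].
    by rewrite big_nil -[RHS]ell0; congr ell; apply/funext => x; rewrite big_nil.
  rewrite big_cons -IH -ellZ// -ellD; last 2 first.
  - exact: poly_funZ.
  - by apply: poly_fun_sum => i _; exact: poly_funZ.
  by congr ell; apply/funext => x; rewrite big_cons.
pose N := #|{: T}|.
pose phi (i : 'I_N) := mono (enum_val i).
have pphi i : poly_fun k (phi i) by exact: pmono.
have lphi i : lbm (phi i) by exact: lbm_poly_fun (pphi i).
pose A : 'M[R]_N := \matrix_(i, j) I (fun x => phi i x * phi j x).
pose b : 'rV[R]_N := \row_j ell (phi j).
have AI (z : 'rV[R]_N) (j : 'I_N) :
    (z *m A) 0 j = I (fun x => (\sum_i z 0 i * phi i x) * phi j x).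
  rewrite mxE.
  rewrite (_ : (fun x => _) = fun x => \sum_i z 0 i * (phi i x * phi j x)); last first.
    by apply/funext => x; rewrite mulr_suml; apply: eq_bigr => i _; rewrite mulrA.
  rewrite cell_Int_sum => [|i]; last by apply: lbmM; [exact: lbm_cst|exact: lbmM].
  by apply: eq_bigr => i _; rewrite mxE cell_IntZ//; exact: lbmM.
have pz (z : 'rV[R]_N) : poly_fun k (fun x => \sum_i z 0 i * phi i x).
  by apply: poly_fun_sum => i _; exact: poly_funZ.
have symA : A^T = A.
  by apply/matrixP => i j; rewrite !mxE; apply: eq_Rintegral => x _; rewrite mulrC.
(* A kernel vector is a combination of zero L^2 norm, thus the zero function, on which the
   functional vanishes. *)
have ker (z : 'rV[R]_N) : z *m A = 0 -> \sum_i z 0 i * b 0 i = 0.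
  move=> zA; have q0 : forall x, \sum_i z 0 i * phi i x = 0.
    apply: (cell_sqr_eq0 (pz z)).
    rewrite (_ : (fun x => _) = fun x => \sum_j z 0 j * ((\sum_i z 0 i * phi i x) * phi j x)); last first.
      by apply/funext => x; rewrite mulr_sumr; apply: eq_bigr => j _; rewrite mulrCA.
    rewrite cell_Int_sum => [|j]; last first.
      by apply: lbmM; [exact: lbm_cst|apply: lbmM => //; exact: lbm_poly_fun (pz z)].
    rewrite big1// => j _; rewrite cell_IntZ; last first.
      by apply: lbmM => //; exact: lbm_poly_fun (pz z).
    by rewrite -AI zA mxE mulr0.
  transitivity (ell (fun x => \sum_i z 0 i * phi i x)).
    by rewrite ell_sum//; apply: eq_bigr => i _; rewrite mxE.
  by rewrite -[RHS]ell0; congr ell; apply/funext => x.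
(* Membership in the row space is tested on the columns of [cokermx A], whose transposes are kernel
   vectors because [A] is symmetric. *)
have : (b <= A)%MS.
  rewrite submxE; apply/eqP/matrixP => i j; rewrite (ord1 i) [RHS]mxE.
  have zA : (col j (cokermx A))^T *m A = 0.
    by apply: trmx_inj; rewrite trmx_mul trmxK symA colE mulmxA mulmx_coker mul0mx trmx0.
  apply: etrans (ker _ zA); rewrite [LHS]mxE; apply: eq_bigr => l _.
  by rewrite !mxE mulrC.
move=> /submxP[c bE]; exists (fun x => \sum_i c 0 i * phi i x); first exact: pz.
move=> psi ppsi; have [e psiE] := poly_funE ppsi.
have pe : psi = (fun x => \sum_(j : 'I_N) e (enum_val j) * phi j x).
  apply/funext => x; rewrite psiE -(big_enum_val (A := {: T}) (fun m => e m * mono m x))/= [LHS]big_mkcond/=.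
  by apply: eq_bigr => m _; rewrite /mono; case: ifP => // _; rewrite mulr0.
rewrite pe ell_sum//.
rewrite (_ : (fun x => _) = fun x => \sum_j e (enum_val j) * ((\sum_i c 0 i * phi i x) * phi j x)); last first.
  by apply/funext => x; rewrite mulr_sumr; apply: eq_bigr => j _; rewrite mulrCA.
have lc := lbm_poly_fun (pz c).
rewrite cell_Int_sum => [|j]; last by apply: lbmM; [exact: lbm_cst|exact: lbmM].
apply: eq_bigr => j _; rewrite cell_IntZ; last exact: lbmM.
by rewrite -AI -bE mxE.
Qed.

End Riesz.

(** * Lifting and numerical gradient *)
Section CentralGradient.
Context {R : realType} {n : nat} {M : mesh R n.+1} (Omega : set 'rV[R]_n.+1).
Hypotheses (hOmega : polygonal_domain Omega) (hM : mesh_of Omega M).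
Local Arguments leb : simpl never.
Local Arguments borel_leb : simpl never.
Local Notation E := 'rV[R]_n.+1.
Implicit Types (i j : 'I_(nelem M)).

Let pT i : proper_polytope (elem i) := let: And3 h _ _ := hM in h i.

Let cellT i j : i != j -> cell (elem i) `&` cell (elem j) = set0 :=
  let: And3 _ _ h := hM in h i j.

Lemma skeleton_null : exists N : set E, [/\ measurable N, borel_leb n.+1 N = 0%E &
  Omega `\` \bigcup_(i : 'I_(nelem M)) cell (elem i) `<=` N].
Proof.
have : {ae borel_leb n.+1, forall x, forall i (l : 'I_(nfacets (elem i))),
    dot (normal l) x != offset l}.
  apply: (@filter_fin _ _ _ _ (fun i x => forall l : 'I_(nfacets (elem i)),
    dot (normal l) x != offset l)) => i.
  apply: (@filter_fin _ _ _ _ (fun (l : 'I_(nfacets (elem i))) x => dot (normal l) x != offset l)) => l.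
  exists [set x | dot (normal l) x = offset l]; split.
  - exact: measurable_dot_eq.
  - apply: hyperplane_null; left; apply/eqP => l0.
    have [a] := unit_coord (elem_unit hM l); by rewrite l0 mxE eqxx.
  - by move=> x /= /negP; rewrite negbK => /eqP.
move=> [N [mN N0 sub]]; exists N; split => // x [Ox nc]; apply: sub => /= H; apply: nc.
have [_ clO _] := hM.
have : closure Omega x by exact: subset_closure.
rewrite clO => -[i _ ix]; exists i => //; rewrite cellE// => l /=.
by rewrite lt_neqAle H ix.
Qed.

(** The cells are Borel, and the rest of [Omega] is a subset of a null set, measurable by
    completeness. *)
Lemma measurable_Omega : measurable (Omega : set (lebT R n.+1)).
Proof.
have [N [mN N0 sub]] := skeleton_null.
have [mD _] := negligible_lebT mN N0 sub.
have mU : measurable (\bigcup_(i : 'I_(nelem M)) cell (elem i) : set (lebT R n.+1)).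
  apply: measurable_lebT; rewrite bigcup_mkcond; apply: fin_bigcup_measurable => // i _.
  by case: ifP => // _; exact: measurable_cell.
rewrite (_ : Omega = (\bigcup_(i : 'I_(nelem M)) cell (elem i)) `|`
    (Omega `\` \bigcup_(i : 'I_(nelem M)) cell (elem i))).
  exact: measurableU.
by rewrite setUC setDKU// => x [i _]; exact: (cell_Omega hOmega hM).
Qed.

Lemma integral_Omega (H : E -> \bar R) : (forall x, Omega x -> 0 <= H x)%E ->
  (\int[leb n.+1]_(x in Omega) H x = \sum_(i < nelem M) \int[leb n.+1]_(x in cell (elem i)) H x)%E.
Proof.
move=> H0; apply: (@ge0_integral_cover _ (lebT R n.+1) R (leb n.+1) _ (fun i => cell (elem i))).
- exact: measurable_Omega.
- by move=> i; apply: measurable_lebT; exact: measurable_cell.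
- exact: (cell_Omega hOmega hM).
- exact: cellT.
- have [N [mN N0 sub]] := skeleton_null; exact: (negligible_lebT mN N0 sub).2.
- exact: H0.
Qed.

Lemma Rintegral_Omega (H : E -> R) (F : pwfun M R) :
  (forall i x, cell (elem i) x -> H x = F i x) -> (forall i, lbm (F i)) ->
  \int[leb n.+1]_(x in Omega) H x = \sum_i \int[leb n.+1]_(x in cell (elem i)) F i x.
Proof.
move=> HF lF; have iF i := integrable_cell (pT i) (lF i).
have fp i : (\int[leb n.+1]_(x in cell (elem i)) ((EFin \o F i)^\+ x))%E \is a fin_num.
  apply: integrable_pos_fin_num; last exact: iF.
  by apply: measurable_lebT; exact: measurable_cell.
have fn i : (\int[leb n.+1]_(x in cell (elem i)) ((EFin \o F i)^\- x))%E \is a fin_num.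
  apply: integrable_neg_fin_num; last exact: iF.
  by apply: measurable_lebT; exact: measurable_cell.
rewrite {1}/Rintegral integralE !integral_Omega; last 2 first.
- by move=> x _; exact: funeneg_ge0.
- by move=> x _; exact: funepos_ge0.
have -> : (\sum_(i < nelem M) \int[leb n.+1]_(x in cell (elem i)) (fun x => (H x)%:E)^\+ x =
    (\sum_(i < nelem M) fine (\int[leb n.+1]_(x in cell (elem i)) ((EFin \o F i)^\+ x)))%:E)%E.
  rewrite -sumEFin; apply: eq_bigr => i _; rewrite fineK//; apply: eq_integral => x /set_mem ix.
  by rewrite !funeposE /= (HF i).
have -> : (\sum_(i < nelem M) \int[leb n.+1]_(x in cell (elem i)) (fun x => (H x)%:E)^\- x =
    (\sum_(i < nelem M) fine (\int[leb n.+1]_(x in cell (elem i)) ((EFin \o F i)^\- x)))%:E)%E.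
  rewrite -sumEFin; apply: eq_bigr => i _; rewrite fineK//; apply: eq_integral => x /set_mem ix.
  by rewrite !funenegE /= (HF i).
rewrite -EFinB /= -sumrB; apply: eq_bigr => i _.
rewrite -fineB; [|exact: fp|exact: fn].
congr fine; apply/esym; exact: integralE.
Qed.

Lemma glue_cell (V : nmodType) (w : pwfun M V) i x : cell (elem i) x -> Defs.glue w x = w i x.
Proof.
move=> ix; rewrite /Defs.glue (bigD1 i)/=; last by rewrite inE.
rewrite big1 ?addr0// => j /andP[/set_mem jx ji].
by have : (cell (elem j) `&` cell (elem i)) x by []; rewrite cellT.
Qed.

(** One Borel set serves all integrands, which gives linearity of the face integrals. *)
Lemma face_RintegralE (e : face M) : interior_face Omega e || boundary_face Omega e ->
  exists B : set E, [/\ measurable B, in_cube B & forall F, lbm F ->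
    face_Rintegral Omega e F = surfI (face_normal e) (face_offset e) (fun x => \1_B x * F x)].
Proof.
case: e => j [l [i|]]; rewrite /interior_face /boundary_face /= ?orbF.
  move=> /andP[ij ok]; exists (facet l `&` body (elem i)); split.
  - exact: measurable_common_facet.
  - exact: (in_cube_common_facet hM).
  move=> F lF; have ne : i != j by rewrite -val_eqE/= neq_ltn ij.
  by rewrite -[RHS](face_Rintegral_interior hM l ne lF) ok.
move=> ok; exists (outer_facet l); split.
- exact: measurable_outer_facet.
- exact: (in_cube_outer_facet hM).
by move=> F lF; rewrite -[RHS](face_Rintegral_boundary hOmega hM l lF) ok.
Qed.

Lemma face_RintegralD (e : face M) F G : interior_face Omega e || boundary_face Omega e ->
  lbm F -> lbm G ->
  face_Rintegral Omega e (fun x => F x + G x) = face_Rintegral Omega e F + face_Rintegral Omega e G.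
Proof.
move=> he lF lG; have [B [mB bB HB]] := face_RintegralE he.
rewrite !HB//; last exact: lbmD.
rewrite -surfID; [|exact: blb_indic|exact: blb_indic].
by congr surfI; apply/funext => x; rewrite mulrDr.
Qed.

Lemma face_RintegralZ (e : face M) c F : interior_face Omega e || boundary_face Omega e ->
  lbm F ->
  face_Rintegral Omega e (fun x => c * F x) = c * face_Rintegral Omega e F.
Proof.
move=> he lF; have [B [mB bB HB]] := face_RintegralE he.
rewrite !HB//; last by apply: lbmM => //; exact: lbm_cst.
rewrite -surfIZ; last exact: blb_indic.
by congr surfI; apply/funext => x; rewrite mulrCA.
Qed.

Variables (k : nat) (v : pwfun M R).
Hypothesis hv : in_Vh k v.

Lemma lbm_Vh kk (w : pwfun M R) i : in_Vh kk w -> lbm (w i).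
Proof. by move=> hw; exact: lbm_poly_fun (hw i). Qed.

Lemma lbm_jump (w : pwfun M R) e : (forall i, lbm (w i)) -> lbm (jump w e).
Proof. by move=> lw; rewrite /jump; case: face_minus => [i|//]; exact: lbmB. Qed.

Lemma lbm_avg (w : pwfun M R) e : (forall i, lbm (w i)) -> lbm (avg w e).
Proof.
move=> lw; rewrite /avg; case: face_minus => [i|//].
by apply: lbmM; [exact: lbmD|exact: lbm_cst].
Qed.

Lemma avgD (w1 w2 : pwfun M R) e x :
  avg (fun i y => w1 i y + w2 i y) e x = avg w1 e x + avg w2 e x.
Proof. by rewrite /avg; case: face_minus => [i|//]; field. Qed.

Lemma avgZ c (w : pwfun M R) e x : avg (fun i y => c * w i y) e x = c * avg w e x.
Proof. by rewrite /avg; case: face_minus => [i|//]; field. Qed.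

Lemma avg_sum (I : Type) (s : seq I) (w : I -> pwfun M R) e x :
  avg (fun i y => \sum_(t <- s) w t i y) e x = \sum_(t <- s) avg (w t) e x.
Proof.
rewrite /avg; case: face_minus => [i|//].
by rewrite -big_split/= mulr_suml.
Qed.

(** The right side of the lifting equation for the test field with [a]-th component [phi] and all
    other components zero. *)
Definition jump_functional (a : 'I_n.+1) (phi : pwfun M R) : R :=
  - \sum_(e | interior_face Omega e)
      face_Rintegral Omega e (fun x => jump v e x * (face_normal e 0 a * avg phi e x)).

Let lv i : lbm (v i). Proof. exact: lbm_Vh hv. Qed.

Lemma lbm_jump_term a (phi : pwfun M R) e : (forall i, lbm (phi i)) ->
  lbm (fun x => jump v e x * (face_normal e 0 a * avg phi e x)).
Proof.
move=> lphi; apply: lbmM; first exact: lbm_jump.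
by apply: lbmM; [exact: lbm_cst|exact: lbm_avg].
Qed.

Lemma jump_functionalD a (w1 w2 : pwfun M R) : (forall i, lbm (w1 i)) -> (forall i, lbm (w2 i)) ->
  jump_functional a (fun i y => w1 i y + w2 i y) = jump_functional a w1 + jump_functional a w2.
Proof.
move=> l1 l2; rewrite /jump_functional -opprD -big_split/=; congr (- _); apply: eq_bigr => e he.
rewrite -face_RintegralD ?he//; [|exact: lbm_jump_term|exact: lbm_jump_term].
by congr face_Rintegral; apply/funext => x; rewrite avgD; ring.
Qed.

Lemma jump_functionalZ a c (w : pwfun M R) : (forall i, lbm (w i)) ->
  jump_functional a (fun i y => c * w i y) = c * jump_functional a w.
Proof.
move=> l1; rewrite /jump_functional mulrN mulr_sumr; congr (- _); apply: eq_bigr => e he.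
rewrite -face_RintegralZ ?he//; last exact: lbm_jump_term.
by congr face_Rintegral; apply/funext => x; rewrite avgZ; ring.
Qed.

(** Test functions living on one element decouple the global equations. *)
Definition single i (psi : E -> R) : pwfun M R := fun j => if j == i then psi else fun=> 0.

Lemma lbm_single i psi j : lbm psi -> lbm (single i psi j).
Proof. by rewrite /single; case: ifP => // _ _; exact: lbm_cst. Qed.

Lemma sum_single (phi : pwfun M R) : phi = fun j y => \sum_i single i (phi i) j y.
Proof.
apply/funext => j; apply/funext => y; rewrite (bigD1 j)//= /single eqxx big1 ?addr0// => i ij.
by rewrite eq_sym (negbTE ij).
Qed.

Lemma jump_functional_sum a (phi : pwfun M R) : (forall i, lbm (phi i)) ->
  jump_functional a phi = \sum_i jump_functional a (single i (phi i)).
Proof.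
move=> lphi; rewrite {1}(sum_single phi).
have ls i j : lbm (single i (phi i) j) by exact: lbm_single.
elim: (index_enum _) => [|i s IH].
  rewrite big_nil /jump_functional big1 ?oppr0// => e he.
  have -> : (fun x => jump v e x * (face_normal e 0 a *
      avg (fun j y => \sum_(i <- [::]) single i (phi i) j y) e x)) = fun x => 0 * 0.
    by apply/funext => x; rewrite avg_sum big_nil !mulr0.
  by rewrite (@face_RintegralZ e 0 (fun=> 0)) ?he ?mul0r//; exact: lbm_cst.
rewrite big_cons -IH -jump_functionalD//; last by move=> j; exact: lbm_sum.
by congr jump_functional; apply/funext => j; apply/funext => y; rewrite big_cons.
Qed.

(** For each component [a] and element [i], Riesz representation is applied to the functional that
    tests with functions living on T_i; linearity of [jump_functional] reassembles a general test
    field. *)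
Lemma lifting_exists : exists L, is_lifting Omega k v L.
Proof.
have ex a i : exists2 q, poly_fun k q & forall psi, poly_fun k psi ->
    \int[leb n.+1]_(x in cell (elem i)) (q x * psi x) = jump_functional a (single i psi).
  apply: (riesz_cell (pT i) (ell := fun psi => jump_functional a (single i psi))).
    move=> q1 q2 p1 p2; have l1 := lbm_poly_fun p1; have l2 := lbm_poly_fun p2.
    rewrite -jump_functionalD; [|by move=> j; exact: lbm_single..].
    congr jump_functional; apply/funext => j; apply/funext => y.
    by rewrite /single; case: ifP => // _; rewrite addr0.
  move=> c q pq; have lq := lbm_poly_fun pq.
  rewrite -jump_functionalZ; last by move=> j; exact: lbm_single.
  congr jump_functional; apply/funext => j; apply/funext => y.
  by rewrite /single; case: ifP => // _; rewrite mulr0.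
pose q a i := s2val (cid2 (ex a i)).
have pq a i : poly_fun k (q a i) by exact: s2valP (cid2 (ex a i)).
have qP a i psi : poly_fun k psi ->
    \int[leb n.+1]_(x in cell (elem i)) (q a i x * psi x) = jump_functional a (single i psi).
  exact: s2valP' (cid2 (ex a i)) psi.
exists (fun i x => \row_a q a i x); split.
  move=> a i; rewrite (_ : component _ a i = q a i)//.
  by apply/funext => x; rewrite /component mxE.
move=> phi pphi; have lphi a i : lbm (component phi a i) by exact: lbm_Vh (pphi a).
rewrite (@Rintegral_Omega _ (fun i x => \sum_a q a i x * component phi a i x)); first last.
- by move=> i; apply: lbm_sum => a; apply: lbmM => //; exact: lbm_poly_fun (pq a i).
- move=> i x ix; rewrite /dot; apply: eq_bigr => a _.
  by rewrite !(glue_cell _ ix) mxE.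
transitivity (\sum_a jump_functional a (component phi a)).
  under [RHS]eq_bigr => a _ do rewrite jump_functional_sum//.
  rewrite exchange_big/=; apply: eq_bigr => i _.
  rewrite (cell_Int_sum (pT i)).
    by apply: eq_bigr => a _; apply: qP; exact: pphi.
  by move=> a; apply: lbmM => //; exact: lbm_poly_fun (pq a i).
rewrite /jump_functional sumrN; congr (- _); rewrite exchange_big/=; apply: eq_bigr => e he.
have FS (I : Type) (s : seq I) (F : I -> E -> R) : (forall t, lbm (F t)) ->
    \sum_(t <- s) face_Rintegral Omega e (F t) = face_Rintegral Omega e (fun x => \sum_(t <- s) F t x).
  move=> lF; elim: s => [|t s IH].
    rewrite big_nil (_ : (fun x => _) = fun x => 0 * 0).
      by rewrite (@face_RintegralZ e 0 (fun=> 0)) ?he ?mul0r//; exact: lbm_cst.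
    by apply/funext => x; rewrite big_nil mul0r.
  rewrite big_cons IH -face_RintegralD ?he//; last exact: lbm_sum.
  by congr face_Rintegral; apply/funext => x; rewrite big_cons.
rewrite FS => [|a]; last exact: lbm_jump_term.
congr face_Rintegral; apply/funext => x; rewrite -mulr_sumr; congr (_ * _).
rewrite (_ : (fun i y => _) = fun i y => \sum_a (face_normal e 0 a * component phi a i y)).
  by rewrite avg_sum; apply: eq_bigr => a _; rewrite avgZ.
by apply/funext => i; apply/funext => y; apply: eq_bigr => a _; rewrite mulrC.
Qed.

Lemma dg_gradient_of_lifting L : is_lifting Omega k v L ->
  is_dg_gradient Omega k v (fun i x => gradient (v i) x + L i x).
Proof.
move=> [pL HL].
have dv i a := poly_fun_derive a (hv i).
have compE a i : component (fun i x => gradient (v i) x + L i x) a i =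
    fun x => partial a (v i) x + component L a i x.
  by apply/funext => x; rewrite /component !mxE.
have pdv a i : poly_fun k (partial a (v i)) by have [w [pw -> _]] := dv i a.
split.
  by move=> a i; rewrite compE; apply: poly_funD; [exact: pdv|exact: pL].
move=> a phi pphi.
have lphi i : lbm (phi i) by exact: lbm_Vh pphi.
have ldv i : lbm (partial a (v i)) by exact: lbm_poly_fun (pdv a i).
have lL i : lbm (component L a i) by exact: lbm_poly_fun (pL a i).
have pdphi i : poly_fun k (partial a (phi i)).
  by have [w [pw -> _]] := poly_fun_derive a (pphi i).
have ldphi i : lbm (partial a (phi i)) by exact: lbm_poly_fun (pdphi i).
rewrite (@Rintegral_Omega _ (fun i x => partial a (v i) x * phi i x + component L a i x * phi i x)); first last.
- by move=> i; apply: lbmD; apply: lbmM.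
- by move=> i x ix; rewrite !(glue_cell _ ix) compE mulrDl.
have -> : \sum_i \int[leb n.+1]_(x in cell (elem i))
    (partial a (v i) x * phi i x + component L a i x * phi i x) =
  \sum_i \int[leb n.+1]_(x in cell (elem i)) (partial a (v i) x * phi i x) +
  \sum_i \int[leb n.+1]_(x in cell (elem i)) (component L a i x * phi i x).
  rewrite -big_split/=; apply: eq_bigr => i _.
  by rewrite (cell_IntD (pT i))//; apply: lbmM.
have -> : \sum_i \int[leb n.+1]_(x in cell (elem i)) (component L a i x * phi i x) =
    - \sum_(e | interior_face Omega e) face_Rintegral Omega e
       (fun x => jump v e x * (face_normal e 0 a * avg phi e x)).
  (* The lifting equation is tested with [phi] times the [a]-th unit vector. *)
  pose phia : pwfun M E := fun i x => phi i x *: delta_mx 0 a.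
  have cphia b i : component phia b i = if b == a then phi i else fun=> 0.
    apply/funext => x; rewrite /component /phia !mxE eqxx/=.
    by case: eqP => _; rewrite ?mulr1 ?mulr0.
  have dphia nu i x : dot (phia i x) nu = nu 0 a * phi i x.
    rewrite /dot (bigD1 a)//= big1 ?addr0 => [|b /negbTE ba].
      by rewrite !mxE !eqxx mulr1 mulrC.
    by rewrite !mxE ba andbF mulr0 mul0r.
  have pphia : in_Vh_vec k phia.
    by move=> b i; rewrite cphia; case: eqP => _; [exact: pphi|exact: poly_fun0].
  have := HL phia pphia.
  rewrite (@Rintegral_Omega _ (fun i x => component L a i x * phi i x)); first last.
  - by move=> i; apply: lbmM.
  - by move=> i x ix; rewrite !(glue_cell _ ix) dotC dphia.
  move=> ->; congr (- _); apply: eq_bigr => e _; congr face_Rintegral; apply/funext => x.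
  rewrite (_ : (fun i y => _) = fun i y => face_normal e 0 a * phi i y); first by rewrite avgZ.
  by apply/funext => i; apply/funext => y; rewrite dphia.
(* The product rule and the divergence theorem for v phi on each cell, followed by regrouping the
   facets into faces. *)
have ibp : \sum_i \int[leb n.+1]_(x in cell (elem i)) (partial a (v i) x * phi i x) +
    \sum_i \int[leb n.+1]_(x in cell (elem i)) (v i x * partial a (phi i) x) =
    \sum_(e | interior_face Omega e) face_normal e 0 a *
      face_Rintegral Omega e (fun x => jump (fun i y => v i y * phi i y) e x) +
    \sum_(e | boundary_face Omega e) face_normal e 0 a *
      face_Rintegral Omega e (fun x => v (face_plus e) x * phi (face_plus e) x).
  rewrite -(mesh_surface_sum hOmega hM a (F := fun i y => v i y * phi i y)); last first.
    by move=> i; apply: lbmM.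
  rewrite -big_split/=; apply: eq_bigr => i _.
  rewrite -(cell_IntD (pT i)); [|by apply: lbmM..].
  apply: (divergence_coord (pT i)).
  - exact: lbmM.
  - by apply: lbmD; apply: lbmM.
  - move=> y t; have [w [_ wE Dw]] := dv i a.
    have [z [_ zE Dz]] := poly_fun_derive a (pphi i).
    rewrite wE zE (_ : (fun s => _) = (fun s => v i (ins a 0 y + s *: delta_mx 0 a)) *
      (fun s => phi i (ins a 0 y + s *: delta_mx 0 a))); last first.
      by apply/funext => s; rewrite -{1 2}[s]add0r insD.
    rewrite -[t]add0r insD add0r.
    apply: (is_derive_eq (is_deriveM (Dw (ins a 0 y) t) (Dz (ins a 0 y) t))).
    by rewrite /GRing.scale/=; ring.
  - move=> y.
    have cv := @poly_fun_continuous_line R n k _ a y (hv i).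
    have cp := @poly_fun_continuous_line R n k _ a y (pphi i).
    have cdv := @poly_fun_continuous_line R n k _ a y (pdv a i).
    have cdp := @poly_fun_continuous_line R n k _ a y (pdphi i).
    move=> t; apply: (@continuousD _ _ _ (fun t => partial a (v i) (ins a t y) * phi i (ins a t y))).
      by apply: (@continuousM _ _ (fun t => partial a (v i) (ins a t y))); [exact: cdv|exact: cp].
    by apply: (@continuousM _ _ (fun t => v i (ins a t y))); [exact: cv|exact: cdp].
have disj (e : face M) : ~~ (interior_face Omega e && boundary_face Omega e).
  by rewrite /interior_face /boundary_face; case: face_minus => [i|] /=; rewrite ?andbF.
(* On boundary faces average and jump are both the trace, so the DG gradient takes the whole
   boundary term v phi; the lifting contains interior faces only. *)
have -> : \sum_(e | interior_face Omega e || boundary_face Omega e)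
     face_Rintegral Omega e (fun x => avg v e x * face_normal e 0 a * jump phi e x) =
  \sum_(e | interior_face Omega e)
     face_Rintegral Omega e (fun x => avg v e x * face_normal e 0 a * jump phi e x) +
  \sum_(e | boundary_face Omega e)
     face_normal e 0 a * face_Rintegral Omega e (fun x => v (face_plus e) x * phi (face_plus e) x).
  rewrite (bigID (interior_face Omega))/=; congr (_ + _).
    by apply: eq_bigl => e; case: interior_face; rewrite ?andbF ?andbT.
  apply: eq_big => [e|e].
    by have := disj e; case: interior_face => //=; rewrite ?andbF ?andbT//; case: boundary_face.
  move=> /andP[/orP[->//|be] _]; rewrite -face_RintegralZ ?be ?orbT//; last exact: lbmM.
  congr face_Rintegral; apply/funext => x; move: be; rewrite /boundary_face /avg /jump.
  by case: face_minus => //= _; ring.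
have split e : interior_face Omega e -> face_normal e 0 a *
      face_Rintegral Omega e (fun x => jump (fun i y => v i y * phi i y) e x) =
    face_Rintegral Omega e (fun x => jump v e x * (face_normal e 0 a * avg phi e x)) +
    face_Rintegral Omega e (fun x => avg v e x * face_normal e 0 a * jump phi e x).
  move=> ie; rewrite -face_RintegralZ ?ie//; last first.
    by apply: (@lbm_jump (fun i y => v i y * phi i y)) => i; apply: lbmM.
  rewrite -face_RintegralD ?ie//; first last.
  - apply: lbmM; last exact: lbm_jump.
    by apply: lbmM; [exact: lbm_avg|exact: lbm_cst].
  - exact: lbm_jump_term.
  congr face_Rintegral; apply/funext => x; move: ie; rewrite /interior_face /avg /jump.
  by case: face_minus => //= i _; field.
move: ibp; rewrite (eq_bigr _ split) big_split/=.
set A := \sum_i _; set B := \sum_i _; set C := \sum_(e | _) _; set D := \sum_(e | _) _.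
set F := \sum_(e | _) _ => H; have -> : A = C + D + F - B by rewrite -H addrK.
ring.
Qed.

(** Both equations are tested with the difference of the [a]-th components on one element and zero
    elsewhere, which gives that difference zero L^2 norm on the cell. *)
Lemma dg_gradient_unique G1 G2 : is_dg_gradient Omega k v G1 -> is_dg_gradient Omega k v G2 ->
  forall i x, G1 i x = G2 i x.
Proof.
move=> [p1 H1] [p2 H2] i x; apply/rowP => a.
pose q y := component G1 a i y - component G2 a i y.
have pq : poly_fun k q.
  rewrite /q (_ : (fun y => _) = fun y => component G1 a i y + -1 * component G2 a i y).
    by apply: poly_funD; [exact: p1|apply: poly_funZ; exact: p2].
  by apply/funext => y; rewrite mulN1r.
have lq : lbm q by exact: lbm_poly_fun pq.
have ps : in_Vh k (single i q).
  by move=> j; rewrite /single; case: ifP => // _; exact: poly_fun0.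
have l1 j : lbm (component G1 a j) by exact: lbm_poly_fun (p1 a j).
have l2 j : lbm (component G2 a j) by exact: lbm_poly_fun (p2 a j).
have ls j : lbm (single i q j) by exact: lbm_single.
have red G : (forall j, lbm (component G a j)) ->
    \int[leb n.+1]_(x in Omega) (Defs.glue (component G a) x * Defs.glue (single i q) x) =
    \int[leb n.+1]_(x in cell (elem i)) (component G a i x * q x).
  move=> lG; rewrite (@Rintegral_Omega _ (fun j x => component G a j x * single i q j x)); first last.
  - by move=> j; apply: lbmM.
  - by move=> j y jy; rewrite !(glue_cell _ jy).
  rewrite (bigD1 i)//= [X in _ + X]big1 ?addr0 => [|j ji].
    by apply: eq_Rintegral => y _; rewrite /single eqxx.
  rewrite /Rintegral integral0_eq// => y _.
  by rewrite /single (negbTE ji) mulr0.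
have E : \int[leb n.+1]_(x in cell (elem i)) (component G1 a i x * q x) =
    \int[leb n.+1]_(x in cell (elem i)) (component G2 a i x * q x).
  by rewrite -!red// H1// H2.
suff /eqP : q x = 0 by rewrite /q subr_eq0 => /eqP.
apply: (cell_sqr_eq0 (pT i) pq).
rewrite (_ : (fun y => _) = fun y => component G1 a i y * q y + -1 * (component G2 a i y * q y)); last first.
  by apply/funext => y; rewrite {1}/q; ring.
rewrite (cell_IntD (pT i)); [|by apply: lbmM|by apply: lbmM; [exact: lbm_cst|apply: lbmM]].
by rewrite (cell_IntZ (pT i)) ?E ?mulN1r ?subrr//; apply: lbmM.
Qed.

(** Existence of a lifting makes the [xget] choice a lifting; the gradient built from it shows that
    a DG gradient exists, so the chosen one is genuine and uniqueness identifies the two. *)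
Lemma dg_gradientE i x : dg_gradient Omega k v i x = gradient (v i) x + lifting Omega k v i x.
Proof.
have [L0 hL0] := lifting_exists.
have hL : is_lifting Omega k v (lifting Omega k v).
  exact: (@xgetPex _ (fun _ _ => 0) [set L | is_lifting Omega k v L] (ex_intro _ L0 hL0)).
have hG := dg_gradient_of_lifting hL.
have hD : is_dg_gradient Omega k v (dg_gradient Omega k v).
  exact: (@xgetPex _ (fun _ _ => 0) [set G | is_dg_gradient Omega k v G] (ex_intro _ _ hG)).
exact: (dg_gradient_unique hD hG).
Qed.

End CentralGradient.

Theorem lemma5p1 (R : realType) (d : nat) (hd : (1 <= d <= 3)%N)
    (Omega : set 'rV[R]_d) (hOmega : polygonal_domain Omega)
    (M : mesh R d) (hM : mesh_of Omega M)
    (kappa sigma : R)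
    (hkappa : shape_regular kappa M) (hsigma : quasi_uniform sigma M)
    (k : nat) (p : R) (hp : 1 < p)
    (f : 'rV[R]_d -> R -> 'rV[R]_d -> R) (hf : admissible_density p Omega f)
    (g : 'rV[R]_d -> R)
    (gamma h : face M -> R)
    (hgamma : forall e, interior_face Omega e || boundary_face Omega e ->
       0 < gamma e)
    (hh : forall e, interior_face Omega e || boundary_face Omega e -> 0 < h e)
    (v : pwfun M R) (hv : in_Vh k v) :
  J_h Omega k p f g gamma h v = J_BO Omega k p f g gamma h v.
Proof.
(* The bound [1 <= d] puts the dimension in successor form, as charts of dimension [n] require. *)
case: d => [//|n] in hd Omega hOmega M hM hkappa hsigma f hf g gamma h hgamma hh v hv *.
rewrite /J_h /J_BO; congr (_ + _)%E.
rewrite (integral_Omega hOmega hM); last first.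
  by move=> x Ox; rewrite lee_fin; exact: (density_ge0 hf).
apply: eq_bigr => i _; apply: eq_integral => x /set_mem ix.
by rewrite !(glue_cell hM _ ix) (dg_gradientE hOmega hM hv).
Qed.
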